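(* Let $(M,L)$ and $(M,\widetilde L)$ be conformally related Finsler manifolds with $\widetilde g=e^{2\sigma(x)}g$. Then the v-, hv- and h-curvature tensors of the associated Hashiguchi connections $D^{*}$, $\widetilde{D^{*}}$ satisfy, for all $\pi$-vector fields $\overline X,\overline Y,\overline Z$: (a) $\widetilde{S^{*}}(\overline{X},\overline{Y})\overline{Z}=S^{*}(\overline{X},\overline{Y})\overline{Z}$; (b) $\widetilde{P^{*}}(\overline{X},\overline{Y})\overline{Z}=P^{*}(\overline{X},\overline{Y})\overline{Z}-S^{*}(N\overline{X},\overline{Y})\overline{Z}+(D^{*}_{\gamma\overline{Y}}B^{*})(\overline{X},\overline{Z})+B^{*}(T(\overline{Y},\overline{X}),\overline{Z})$; (c) $\widetilde{R^{*}}(\overline{X},\overline{Y})\overline{Z}=R^{*}(\overline{X},\overline{Y})\overline{Z}+S^{*}(N\overline{X},N\overline{Y})\overline{Z}-\mathfrak{U}_{\overline{X},\overline{Y}}\{P^{*}(\overline{X},N\overline{Y})\overline{Z}+(D^{*}_{\beta\overline{X}}B^{*})(\overline{Y},\overline{Z})-(D^{*}_{\gamma N\overline{X}}B^{*})(\overline{Y},\overline{Z})+B^{*}(\overline{X},B^{*}(\overline{Y},\overline{Z}))-B^{*}(T(N\overline{X},\overline{Y}),\overline{Z})\}$.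
   Context: $M$ is a real paracompact $C^\infty$ manifold of finite dimension $n$; all objects are $C^\infty$. $\pi:\mathcal{T}M\to M$ is the bundle of nonzero tangent vectors, $\pi^{-1}(TM)$ the pullback of $TM$ by $\pi$. Sections of $\pi^{-1}(TM)$ are called $\pi$-vector fields and written $\overline X,\overline Y,\dots$; $\overline\eta(u)=(u,u)$. $\rho:T(\mathcal{T}M)\to\pi^{-1}(TM)$ is $\rho=(\pi_{\mathcal{T}M},d\pi)$ and $\gamma:\pi^{-1}(TM)\to T(\mathcal{T}M)$ is the vertical lift. For a linear connection $D$ on $\pi^{-1}(TM)$, $K(X):=D_X\overline\eta$; $D$ is regular if $T(\mathcal{T}M)=V(\mathcal{T}M)\oplus H(\mathcal{T}M)$ with $H=\ker K$, $V$ the vertical bundle, and then $\beta:=(\rho|_{H})^{-1}$. Torsion: $\mathbf{T}(X,Y)=D_X\rho Y-D_Y\rho X-\rho[X,Y]$, $Q(\overline X,\overline Y)=\mathbf{T}(\beta\overline X,\beta\overline Y)$, $T(\overline X,\overline Y)=\mathbf{T}(\gamma\overline X,\beta\overline Y)$. Curvature: $\mathbf{K}(X,Y)\rho Z=-D_XD_Y\rho Z+D_YD_X\rho Z+D_{[X,Y]}\rho Z$, with h-, hv-, v-curvature tensors $R(\overline X,\overline Y)\overline Z=\mathbf{K}(\beta\overline X,\beta\overline Y)\overline Z$, $P(\overline X,\overline Y)\overline Z=\mathbf{K}(\beta\overline X,\gamma\overline Y)\overline Z$, $S(\overline X,\overline Y)\overline Z=\mathbf{K}(\gamma\overline X,\gamma\overline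 Y)\overline Z$; $\widehat P(\overline X,\overline Y)=P(\overline X,\overline Y)\overline\eta$. $(M,L)$ is a Finsler manifold and $g$ the Finsler metric on $\pi^{-1}(TM)$ defined by $L$. The Cartan connection $\nabla$ is the unique regular connection with $\nabla g=0$, $Q=0$ and $g(T(\overline X,\overline Y),\overline Z)=g(T(\overline X,\overline Z),\overline Y)$; $T$, $K$, $\beta$, $\widehat P$ denote those of $\nabla$. The Hashiguchi connection is $D^{*}_X\overline Y=\nabla_X\overline Y+\widehat P(\rho X,\overline Y)$ (same $\beta$, $K$); its curvature tensors are $R^*,P^*,S^*$. $(M,L)$ and $(M,\widetilde L)$ are conformally related if $\widetilde g=e^{2\sigma(x)}g$ for a positive differentiable function $\sigma$ on $M$. Objects of $(M,\widetilde L)$ carry a tilde (in particular $\widetilde{P^*}$, $\widetilde{R^*}$ are formed with $\widetilde\beta$). $N(\overline X):=\widetilde\nabla_{\beta\overline X}\overline\eta-\nabla_{\beta\overline X}\overline\eta$, so that $\widetilde\beta=\beta-\gamma\circ N$. $B^{*}(\overline X,\overline Y):=\omega^*(\beta\overline X,\overline Y)$, where $\omega^*(X,\overline Y):=\widetilde{D^*}_X\overline Y-D^*_X\overline Y$. $\mathfrak{U}_{\overline X,\overline Y}\{A(\overline X,\overline Y)\}:=A(\overline X,\overline Y)-A(\overline Y,\overline X)$. *)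

(* Defs.v *)
From HB Require Import structures.
From mathcomp Require Import all_boot all_order all_algebra.
From mathcomp Require Import all_classical all_reals all_analysis.

Set Implicit Arguments.
Unset Strict Implicit.
Unset Printing Implicit Defensive.

Import Order.TTheory GRing.Theory Num.Theory.
Import numFieldNormedType.Exports.

Local Open Scope classical_set_scope.
Local Open Scope ring_scope.

(* [Ck k U f] and [Cinf U f] are meant for open [U]: being [C^(k+1)] is being
   differentiable with all directional derivatives of class [C^k]. *)
Fixpoint Ck (R : realType) (V W : normedModType R) (k : nat) (U : set V)
    (f : V -> W) : Prop :=
  match k with
  | 0%N => forall x, U x -> {for x, continuous f}
  | k'.+1 => (forall x, U x -> differentiable f x) /\
             (forall v, Ck k' U (fun x => 'D_v f x))
  end.

Definition Cinf (R : realType) (V W : normedModType R) (U : set V)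
    (f : V -> W) : Prop := forall k, Ck k U f.

(* The atlas is an indexed family of charts, as bare data: the axioms of a
   smooth manifold are in [smooth_manifold]. *)
Record atlas (R : realType) (T : Type) (m : nat) := Atlas {
  chart : Type;
  dom : chart -> set T;
  xcoord : chart -> T -> 'rV[R]_m }.

(* [rep A i f] is [f \o (xcoord i)^-1], extended by 0 off the image of the
   chart. *)
Definition rep (R : realType) (T : Type) (m : nat) (A : atlas R T m)
    (i : chart A) (W : normedModType R) (f : T -> W) : 'rV[R]_m -> W :=
  fun z => xget 0 (f @` (dom i `&` xcoord i @^-1` [set z])).

Definition paracompact (T : topologicalType) : Prop :=
  forall C : set (set T),
    (forall U, C U -> open U) -> (forall x, exists2 U, C U & U x) ->
  exists D : set (set T),
    [/\ forall V, D V -> open V,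
        forall x, exists2 V, D V & V x,
        forall V, D V -> exists2 U, C U & V `<=` U &
        forall x : T, exists2 W : set T, nbhs x W &
          finite_set [set V | D V /\ V `&` W !=set0]].

Record smooth_manifold (R : realType) (M : topologicalType) (n : nat)
    (A : atlas R M n) : Prop := SmoothManifold {
  manifold_hausdorff : hausdorff_space M;
  manifold_paracompact : paracompact M;
  manifold_cover : forall p, exists i : chart A, dom i p;
  manifold_dom_open : forall i : chart A, open (dom i);
  manifold_coord_inj : forall i : chart A, {in dom i &, injective (xcoord i)};
  manifold_coord_continuous : forall (i : chart A) p,
    dom i p -> {for p, continuous (xcoord i)};
  manifold_coord_open : forall (i : chart A) (V : set M),
    open V -> V `<=` dom i -> open (xcoord i @` V);
  manifold_transition : forall i j : chart A,
    Cinf (xcoord i @` (dom i `&` dom j)) (rep i (xcoord j)) }.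

Definition smooth (R : realType) (T : Type) (m : nat) (A : atlas R T m)
    (W : normedModType R) (f : T -> W) : Prop :=
  forall i : chart A, Cinf (xcoord i @` dom i) (rep i f).

(* A tangent vector at [p] is the family of its components in the charts around
   [p], related by the Jacobians of the transition maps. The components in the
   other charts are set to 0, so that equality of tangent vectors is [=]. *)
Definition tvec (R : realType) (T : Type) (m : nat) (A : atlas R T m) : Type :=
  chart A -> 'rV[R]_m.

Definition tangent (R : realType) (T : Type) (m : nat) (A : atlas R T m)
    (p : T) (v : tvec A) : Prop :=
  (forall i, ~ dom i p -> v i = 0) /\
  (forall i j, dom i p -> dom j p ->
     v j = 'd (rep i (xcoord j)) (xcoord i p) (v i)).

Definition vfield (R : realType) (T : Type) (m : nat) (A : atlas R T m)
    (X : T -> tvec A) : Prop :=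
  (forall p, tangent p (X p)) /\
  (forall i, Cinf (xcoord i @` dom i) (rep i (fun p => X p i))).

(* The function [X f]; the value does not depend on the chart. *)
Definition lie (R : realType) (T : Type) (m : nat) (A : atlas R T m)
    (X : T -> tvec A) (f : T -> R) : T -> R :=
  fun p => xget 0 [set 'd (rep i (f : T -> R^o)) (xcoord i p) (X p i) |
                   i in [set i | dom i p]].

(* Coordinate expression of the Lie bracket, [X f] being [lie X f]:
   [X, Y]^k = X (Y^k) - Y (X^k). *)
Definition bracket (R : realType) (T : Type) (m : nat) (A : atlas R T m)
    (X Y : T -> tvec A) : T -> tvec A :=
  fun p i => 'd (rep i (fun q => Y q i)) (xcoord i p) (X p i)
           - 'd (rep i (fun q => X q i)) (xcoord i p) (Y p i).

(* The bundle of nonzero tangent vectors, with the charts [(x, y)] induced by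
   the charts [x] of [M]. *)
Definition slit (R : realType) (M : Type) (n : nat) (A : atlas R M n) : Type :=
  {u : M * tvec A | tangent u.1 u.2 /\ u.2 <> 0}.

Definition base (R : realType) (M : Type) (n : nat) (A : atlas R M n)
    (u : slit A) : M := (sval u).1.

Definition slit_atlas (R : realType) (M : Type) (n : nat) (A : atlas R M n) :
    atlas R (slit A) (n + n) :=
  @Atlas R (slit A) (n + n) (chart A)
    (fun i => [set u | dom i (base u)])
    (fun i u => row_mx (xcoord i (base u)) ((sval u).2 i)).

(* Tangent vectors of the slit bundle have components [row_mx a b], standing for
   [a^k d/dx^k + b^k d/dy^k]. *)
Definition stvec (R : realType) (M : Type) (n : nat) (A : atlas R M n) : Type :=
  tvec (slit_atlas A).

(* The smooth sections of the pullback of [TM]. *)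
Definition pivfield (R : realType) (M : Type) (n : nat) (A : atlas R M n)
    (X : slit A -> tvec A) : Prop :=
  (forall u, tangent (base u) (X u)) /\
  (forall i, Cinf (xcoord (a := slit_atlas A) i @` dom (a := slit_atlas A) i)
                  (rep (A := slit_atlas A) i (fun u => X u i))).

Definition etabar (R : realType) (M : Type) (n : nat) (A : atlas R M n) :
    slit A -> tvec A := fun u => (sval u).2.

(* The differential of the projection, which is [(x, y) |-> x] in the charts. *)
Definition rho (R : realType) (M : Type) (n : nat) (A : atlas R M n)
    (X : slit A -> stvec A) : slit A -> tvec A :=
  fun u i => lsubmx (X u i).

(* The vertical lift gamma: at [u], the velocity at 0 of [t |-> u + t X(u)]. *)
Definition vlift (R : realType) (M : Type) (n : nat) (A : atlas R M n)
    (X : slit A -> tvec A) : slit A -> stvec A :=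
  fun u i => row_mx 0 (X u i).

Definition connop (R : realType) (M : Type) (n : nat) (A : atlas R M n) : Type :=
  (slit A -> stvec A) -> (slit A -> tvec A) -> (slit A -> tvec A).

Record linear_connection (R : realType) (M : Type) (n : nat) (A : atlas R M n)
    (D : connop A) : Prop := LinearConnection {
  conn_smooth : forall X Y, vfield X -> pivfield Y -> pivfield (D X Y);
  conn_addl : forall X X' Y, vfield X -> vfield X' -> pivfield Y ->
    D (X + X') Y = D X Y + D X' Y;
  conn_scalel : forall (f : slit A -> R) X Y,
    smooth (slit_atlas A) (f : _ -> R^o) -> vfield X -> pivfield Y ->
    D (fun u => f u *: X u) Y = (fun u => f u *: D X Y u);
  conn_addr : forall X Y Y', vfield X -> pivfield Y -> pivfield Y' ->
    D X (Y + Y') = D X Y + D X Y';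
  conn_leibniz : forall (f : slit A -> R) X Y,
    smooth (slit_atlas A) (f : _ -> R^o) -> vfield X -> pivfield Y ->
    D X (fun u => f u *: Y u) =
      (fun u => lie X f u *: Y u + f u *: D X Y u) }.

(* [w] is in the kernel of [K] at [u]. As [K] is tensorial, [K X u] only
   depends on [X u]. *)
Definition horizontal (R : realType) (M : Type) (n : nat) (A : atlas R M n)
    (D : connop A) (u : slit A) (w : stvec A) : Prop :=
  tangent (A := slit_atlas A) u w /\
  forall X, vfield X -> X u = w -> D X (etabar (A := A)) u = 0.

Definition vertical (R : realType) (M : Type) (n : nat) (A : atlas R M n)
    (u : slit A) (w : stvec A) : Prop :=
  tangent (A := slit_atlas A) u w /\ forall i, lsubmx (w i) = 0.

Definition regular (R : realType) (M : Type) (n : nat) (A : atlas R M n)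
    (D : connop A) : Prop :=
  forall u : slit A,
    (forall w, tangent (A := slit_atlas A) u w -> exists v h : stvec A,
       [/\ vertical u v, horizontal D u h & w = v + h]) /\
    (forall w, vertical u w -> horizontal D u w -> w = 0).

(* For a regular [D], this determines [beta] on the pi-vector fields: it is the
   (smooth) inverse of the restriction of rho to the kernel of [K]. *)
Definition horizontal_lift (R : realType) (M : Type) (n : nat) (A : atlas R M n)
    (D : connop A) (beta : (slit A -> tvec A) -> (slit A -> stvec A)) : Prop :=
  forall X, pivfield X ->
    [/\ vfield (beta X), forall u, horizontal D u (beta X u) &
        rho (beta X) = X].

Definition torsion (R : realType) (M : Type) (n : nat) (A : atlas R M n)
    (D : connop A) (X Y : slit A -> stvec A) : slit A -> tvec A :=
  D X (rho Y) - D Y (rho X) - rho (bracket X Y).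

Definition htorsion (R : realType) (M : Type) (n : nat) (A : atlas R M n)
    (D : connop A) (beta : (slit A -> tvec A) -> (slit A -> stvec A))
    (X Y : slit A -> tvec A) : slit A -> tvec A :=
  torsion D (beta X) (beta Y).

Definition hvtorsion (R : realType) (M : Type) (n : nat) (A : atlas R M n)
    (D : connop A) (beta : (slit A -> tvec A) -> (slit A -> stvec A))
    (X Y : slit A -> tvec A) : slit A -> tvec A :=
  torsion D (vlift X) (beta Y).

Definition curvature (R : realType) (M : Type) (n : nat) (A : atlas R M n)
    (D : connop A) (X Y : slit A -> stvec A) (Z : slit A -> tvec A) :
    slit A -> tvec A :=
  - D X (D Y Z) + D Y (D X Z) + D (bracket X Y) Z.

Definition hcurv (R : realType) (M : Type) (n : nat) (A : atlas R M n)
    (D : connop A) (beta : (slit A -> tvec A) -> (slit A -> stvec A))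
    (X Y Z : slit A -> tvec A) : slit A -> tvec A :=
  curvature D (beta X) (beta Y) Z.

Definition hvcurv (R : realType) (M : Type) (n : nat) (A : atlas R M n)
    (D : connop A) (beta : (slit A -> tvec A) -> (slit A -> stvec A))
    (X Y Z : slit A -> tvec A) : slit A -> tvec A :=
  curvature D (beta X) (vlift Y) Z.

Definition vcurv (R : realType) (M : Type) (n : nat) (A : atlas R M n)
    (D : connop A) (X Y Z : slit A -> tvec A) : slit A -> tvec A :=
  curvature D (vlift X) (vlift Y) Z.

Definition hatP (R : realType) (M : Type) (n : nat) (A : atlas R M n)
    (D : connop A) (beta : (slit A -> tvec A) -> (slit A -> stvec A))
    (X Y : slit A -> tvec A) : slit A -> tvec A :=
  hvcurv D beta X Y (etabar (A := A)).

(* [L p v] is only meaningful for [v] tangent at [p]. *)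
Definition fundamental_tensor (R : realType) (M : Type) (n : nat)
    (A : atlas R M n) (L : M -> tvec A -> R) (u : slit A) (v w : tvec A) : R :=
  2^-1 * derive1 (fun s : R => derive1 (fun t : R =>
    (L (base u) ((sval u).2 + s *: v + t *: w)) ^+ 2 : R^o) 0) 0.

Record finsler (R : realType) (M : Type) (n : nat) (A : atlas R M n)
    (L : M -> tvec A -> R) : Prop := Finsler {
  finsler_smooth :
    smooth (slit_atlas A) ((fun u => L (base u) (sval u).2) : _ -> R^o);
  finsler_pos : forall p v, tangent p v -> v <> 0 -> 0 < L p v;
  finsler_homogeneous : forall p v (t : R), tangent p v -> 0 < t ->
    L p (t *: v) = t * L p v;
  finsler_convex : forall (u : slit A) v, tangent (base u) v -> v <> 0 ->
    0 < fundamental_tensor L u v v }.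

Record cartan_connection (R : realType) (M : Type) (n : nat) (A : atlas R M n)
    (L : M -> tvec A -> R) (nabla : connop A)
    (beta : (slit A -> tvec A) -> (slit A -> stvec A)) : Prop :=
    CartanConnection {
  cartan_linear : linear_connection nabla;
  cartan_regular : regular nabla;
  cartan_lift : horizontal_lift nabla beta;
  cartan_metric : forall X Y Z, vfield X -> pivfield Y -> pivfield Z ->
    forall u, lie X (fun u => fundamental_tensor L u (Y u) (Z u)) u =
      fundamental_tensor L u (nabla X Y u) (Z u) +
      fundamental_tensor L u (Y u) (nabla X Z u);
  cartan_htorsion : forall X Y, pivfield X -> pivfield Y ->
    htorsion nabla beta X Y = 0;
  cartan_hvtorsion : forall X Y Z, pivfield X -> pivfield Y -> pivfield Z ->
    forall u, fundamental_tensor L u (hvtorsion nabla beta X Y u) (Z u) =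
      fundamental_tensor L u (hvtorsion nabla beta X Z u) (Y u) }.

Definition hashiguchi (R : realType) (M : Type) (n : nat) (A : atlas R M n)
    (nabla : connop A) (beta : (slit A -> tvec A) -> (slit A -> stvec A)) :
    connop A :=
  fun X Y => nabla X Y + hatP nabla beta (rho X) Y.

(* The metric of [L'] is [exp (2 sigma)] times the metric of [L]. *)
Definition conformal (R : realType) (M : Type) (n : nat) (A : atlas R M n)
    (L L' : M -> tvec A -> R) (sigma : M -> R) : Prop :=
  forall (u : slit A) v w, tangent (base u) v -> tangent (base u) w ->
    fundamental_tensor L' u v w =
      expR (2 * sigma (base u)) * fundamental_tensor L u v w.

(* Covariant derivative along [X] of a (1,2) pi-tensor field. *)
Definition covder2 (R : realType) (M : Type) (n : nat) (A : atlas R M n)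
    (D : connop A) (X : slit A -> stvec A)
    (B : (slit A -> tvec A) -> (slit A -> tvec A) -> (slit A -> tvec A))
    (Y Z : slit A -> tvec A) : slit A -> tvec A :=
  D X (B Y Z) - B (D X Y) Z - B Y (D X Z).

(* The operator fraktur U. *)
Definition alternate (R : realType) (M : Type) (n : nat) (A : atlas R M n)
    (F : (slit A -> tvec A) -> (slit A -> tvec A) -> (slit A -> tvec A))
    (X Y : slit A -> tvec A) : slit A -> tvec A :=
  F X Y - F Y X.

(* Main.v *)
Require Import Defs.
From HB Require Import structures.
From mathcomp Require Import all_boot all_order all_algebra.
From mathcomp Require Import all_classical all_reals all_analysis.
From mathcomp Require Import ring lra.

(* Write D, D' for the two Hashiguchi connections and B for the horizontal part
   of D' - D.

   In a chart, g(T(X,Y),Z) is a quarter of the third vertical derivative of L^2.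
   Hence T is symmetric, T(.,eta) = 0 by homogeneity, and T is unchanged by a
   conformal change, whose factor is constant on the fibres. So the two Cartan
   connections agree on vertical fields, D' = D + B o rho, and
   beta' = beta - gamma N.

   Expanding the curvatures of D' with these two formulas only uses additivity.
   The terms match those of the statement once rho[beta X, beta Y] is
   D_{beta X} Y - D_{beta Y} X, that is, once hatP is symmetric. For this, pair the
   first Bianchi identity for (beta X, gamma Y, beta Z) with eta: as the
   curvature is skew for g, it follows that g(hatP(X,Y),Z) is symmetric in X and
   Z, and that hatP(eta,.) = 0. The same identity with Z = eta then gives
   hatP(X,Y) = (nabla_{beta eta} T)(Y,X). *)

(** The lifts beta and beta' differ, and T is defined through the lift. The comparison rests on
    [rho_bracket_vlift]: the projection of [gamma X, V] is the derivative of rho V along gamma X, so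
    all lifts V of a given field give the same result. The third derivative of L^2 enters through
    nabla g = 0: the vertical derivative of g splits into two torsion terms, which the Cartan
    condition on T makes equal.

    Pairing the Bianchi identity with eta is effective because eta is g-orthogonal to every value of
    T and parallel along horizontal fields. All torsion terms then disappear and only curvatures
    remain.

    Connections are operators on global smooth fields. An equality of fields is therefore tested by
    pairing with the difference of its two sides, which is itself a smooth field; tangent vectors
    need not be extended to fields. *)

Import Order.TTheory GRing.Theory Num.Theory.
Import numFieldNormedType.Exports.

Set Implicit Arguments.
Unset Strict Implicit.
Unset Printing Implicit Defensive.

Local Open Scope classical_set_scope.
Local Open Scope ring_scope.

(** * Calculus of smooth functions on open sets *)

Section Calculus.
Context {R : realType} {V W : normedModType R}.
Implicit Types (U : set V) (f g : V -> W).

Lemma near_eq_differentiable f g (x : V) :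
  {near x, f =1 g} -> differentiable f x -> differentiable g x.
Proof.
move=> fg.
move=> /diffP[dfc dfE].
have gx : g x = f x by exact/esym/(nbhs_singleton fg).
apply: (diffP (nbhs x) g).2 => /=.
(* The differential is picked by a choice operator, so it is enough to exhibit one continuous linear
   map with the required expansion; the differential of [f] serves. *)
apply: (@getPex _ (fun (dg : {linear V -> W}) => continuous dg /\
  forall y, g y = g (lim (nbhs x)) + dg (y - lim (nbhs x))
                  +o_(y \near x) (y - lim (nbhs x)))).
exists ('d f x); split=> //.
have dfE' : f = cst (f x) + (fun y => 'd f x (y - x)) +o_x (center x).
  by apply/funext => y; rewrite [LHS]dfE !lim_id.
move/eqaddoP : dfE' => {}dfE.
have H : g = cst (g x) + 'd f x \o center x +o_x (center x).
  apply/eqaddoP => e e0; have := dfE _ e0.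
  apply: filterS2 fg => y fgy; rewrite /= -gx.
  by rewrite -[(f - _) y]/(f y - _) -[(g - _) y]/(g y - _) fgy.
by move=> y; rewrite lim_id //; move/funeqP : H => /(_ y).
Qed.

Lemma near_open_eq U f g x : open U -> {in U, f =1 g} -> U x -> {near x, f =1 g}.
Proof.
move=> oU fg Ux; have : \near x, U x by exact: open_nbhs_nbhs.
by apply: filterS => y Uy; apply: fg; rewrite inE.
Qed.

Lemma open_eq_derive U f g x v : open U -> {in U, f =1 g} -> U x ->
  'D_v f x = 'D_v g x.
Proof. by move=> oU fg Ux; apply: near_eq_derive; exact: near_open_eq fg Ux. Qed.

Lemma open_eq_differentiable U f g x : open U -> {in U, f =1 g} -> U x ->
  differentiable f x -> differentiable g x.
Proof.
by move=> oU fg Ux; apply: near_eq_differentiable; exact: near_open_eq fg Ux.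
Qed.

Lemma open_eq_diff U f g x v : open U -> {in U, f =1 g} -> U x ->
  differentiable f x -> 'd f x v = 'd g x v.
Proof.
move=> oU fg Ux df; have dg := open_eq_differentiable oU fg Ux df.
by rewrite -!deriveE //; apply: open_eq_derive fg Ux.
Qed.

Lemma eq_Ck k U f g : open U -> {in U, f =1 g} -> Ck k U f -> Ck k U g.
Proof.
move=> oU; elim: k f g => [|k IH] f g fg /=.
  move=> cf x Ux; rewrite /prop_for /continuous_at.
  rewrite -(fg x) ?inE //; apply: cvg_trans (cf x Ux); apply: near_eq_cvg.
  exact: (near_open_eq oU fg Ux).
move=> [df Df]; split=> [x Ux|v]; first exact: (open_eq_differentiable oU fg Ux (df x Ux)).
apply: IH (Df v) => x; rewrite inE => Ux; exact: (open_eq_derive _ oU fg Ux).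
Qed.

(** [rep] is meaningful only on the image of its chart. This lemma lets a closed formula valid there
    replace it. *)
Lemma eq_Cinf U f g : open U -> {in U, f =1 g} -> Cinf U f -> Cinf U g.
Proof. by move=> oU fg cf k; apply: eq_Ck fg (cf k). Qed.

Lemma Ck_subset k U U' f : U' `<=` U -> Ck k U f -> Ck k U' f.
Proof.
move=> UU; elim: k f => [|k IH] f /=; first by move=> cf x /UU; exact: cf.
by move=> [df Df]; split=> [x /UU/df //|v]; exact: IH.
Qed.

Lemma Cinf_subset U U' f : U' `<=` U -> Cinf U f -> Cinf U' f.
Proof. by move=> UU cf k; apply: Ck_subset (cf k). Qed.

Lemma Cinf_differentiable U f x : Cinf U f -> U x -> differentiable f x.
Proof. by move=> /(_ 1%N) [df _] /df. Qed.

Lemma Cinf_derive U f v : Cinf U f -> Cinf U ('D_v f).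
Proof. by move=> cf k; have [_ Df] := cf k.+1; exact: Df. Qed.

Lemma Cinf_diffE U f x v : Cinf U f -> U x -> 'd f x v = 'D_v f x.
Proof. by move=> cf Ux; rewrite deriveE //; exact: Cinf_differentiable cf Ux. Qed.

Lemma Ck_cst k U (a : W) : Ck k U (cst a).
Proof.
elim: k a => [|k IH] a /=; first by move=> x _; exact: cst_continuous.
split=> [x _|v]; first exact: differentiable_cst.
rewrite (_ : (fun x => _) = cst 0) //; apply/funext => x; exact: derive_cst.
Qed.

Lemma CkD k U f g : open U ->
  Ck k U f -> Ck k U g -> Ck k U (fun x => f x + g x).
Proof.
move=> oU; elim: k f g => [|k IH] f g /=.
  by move=> cf cg x Ux; apply: continuousD; [exact: cf|exact: cg].
move=> [df Df] [dg Dg]; split=> [x Ux|v].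
  by apply: differentiableD; [exact: df|exact: dg].
apply: eq_Ck (IH _ _ (Df v) (Dg v)) => // x; rewrite inE => Ux.
by rewrite -deriveD //; apply: diff_derivable; [exact: df|exact: dg].
Qed.

Lemma CinfD U f g : open U ->
  Cinf U f -> Cinf U g -> Cinf U (fun x => f x + g x).
Proof. by move=> oU cf cg k; exact: CkD. Qed.

Lemma Cinf_cst U (a : W) : Cinf U (cst a).
Proof. by move=> k; exact: Ck_cst. Qed.

Lemma Cinf_sum I (r : seq I) U (F : I -> V -> W) : open U ->
  (forall i, Cinf U (F i)) -> Cinf U (fun x => \sum_(i <- r) F i x).
Proof.
move=> oU cF; elim: r => [|i r IH].
  rewrite (_ : (fun x => _) = cst 0); first exact: Cinf_cst.
  by apply/funext => x; rewrite big_nil.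
rewrite (_ : (fun x => _) = fun x => F i x + \sum_(i <- r) F i x).
  exact: CinfD.
by apply/funext => x; rewrite big_cons.
Qed.

Lemma differentiable_sumE I (r : seq I) (F : I -> V -> W) x :
  (forall i, differentiable (F i) x) ->
  differentiable (fun x => \sum_(i <- r) F i x) x.
Proof.
move=> cF; elim: r => [|i r IH].
  rewrite (_ : (fun x => _) = cst 0); first exact: differentiable_cst.
  by apply/funext => y; rewrite big_nil.
rewrite (_ : (fun x => _) = F i + fun x => \sum_(i <- r) F i x).
  exact: differentiableD.
by apply/funext => y; rewrite big_cons.
Qed.

Lemma derive_sumE I (r : seq I) (F : I -> V -> W) x v :
  (forall i, differentiable (F i) x) ->
  'D_v (fun x => \sum_(i <- r) F i x) x = \sum_(i <- r) 'D_v (F i) x.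
Proof.
move=> cF; elim: r => [|i r IH].
  rewrite big_nil (_ : (fun x => _) = cst 0); first exact: derive_cst.
  by apply/funext => y; rewrite big_nil.
rewrite big_cons -IH (_ : (fun x => _) = F i + fun x => \sum_(i <- r) F i x).
  by rewrite deriveD //; apply: diff_derivable => //; exact: differentiable_sumE.
by apply/funext => y; rewrite big_cons.
Qed.

(** Covers maps that are affine along a single line only, such as [slit_transition] along a
    fibre. *)
Lemma derive_affine f (x v : V) (c : W) :
  (forall h : R, f (h *: v + x) = f x + h *: c) -> 'D_v f x = c.
Proof.
move=> fE; apply/cvg_lim => //; apply: (cvg_trans _ (@cvg_cst _ c R 0^' _)).
apply: near_eq_cvg; near=> h; rewrite /= fE [f x + _]addrC addrK scalerA mulVf ?scale1r //.
by near: h; exact: nbhs_dnbhs_neq.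
Unshelve. all: by end_near. Qed.

Lemma derive_linear (l : {linear V -> W}) v x : continuous l ->
  'D_v l x = l v.
Proof.
move=> lc; rewrite deriveE; last exact: linear_differentiable.
by rewrite diff_lin.
Qed.

Lemma Cinf_linear U (l : {linear V -> W}) : continuous l -> Cinf U (l : V -> W).
Proof.
move=> lc [|k] /=; first by move=> x _; exact: lc.
split=> [x _|v]; first exact: linear_differentiable.
rewrite (_ : (fun x => _) = cst (l v)); first exact: Ck_cst.
by apply/funext => x; exact: (derive_linear _ _ lc).
Qed.

(** The two difference quotients are the same function, so [f] need not be differentiable. *)
Lemma derive_pre_linear (V' : normedModType R) (l : {linear V' -> V}) f v x :
  'D_v (f \o l) x = 'D_(l v) f (l x).
Proof.
rewrite /derive (_ : (fun h => _) = (fun h => h^-1 *: ((f \o shift (l x)) (h *: l v) - f (l x)))) //.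
apply/funext => h /=.
by rewrite [l _]linearD [l (h *: v)]linearZ.
Qed.

(** With a linear inner map, a derivative pulls back to a derivative in one fixed direction, so the
    induction on the order meets no higher chain rule. *)
Lemma Cinf_pre_linear (V' : normedModType R) (l : {linear V' -> V}) U f :
  continuous l -> Cinf U f -> Cinf (l @^-1` U) (f \o l).
Proof.
move=> lc cf k; elim: k f cf => [|k IH] f cf /=.
  move=> x Ux; apply: continuous_comp; first exact: lc.
  by exact: (cf 0%N).
split=> [x Ux|v].
  apply: differentiable_comp; first exact: linear_differentiable.
  exact: Cinf_differentiable Ux.
rewrite (_ : (fun x => _) = 'D_(l v) f \o l).
  by apply: IH; exact: Cinf_derive.
by apply/funext => x; rewrite derive_pre_linear.
Qed.

End Calculus.

Section ScalarCalculus.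
Context {R : realType} {V : normedModType R}.
Implicit Types (U : set V) (f g : V -> R^o).

Lemma derive_mul f g x v : differentiable f x -> differentiable g x ->
  'D_v (fun y => f y * g y : R^o) x = f x * 'D_v g x + g x * 'D_v f x.
Proof.
move=> df dg.
have df' : derivable f x v by exact: diff_derivable.
have dg' : derivable g x v by exact: diff_derivable.
exact: (deriveM df' dg').
Qed.

Lemma CinfM U f g : open U ->
  Cinf U f -> Cinf U g -> Cinf U (fun x => f x * g x : R^o).
Proof.
move=> oU cf cg k; elim: k f g cf cg => [|k IH] f g cf cg /=.
  by move=> x Ux; apply: continuousM; [exact: (cf 0%N)|exact: (cg 0%N)].
split=> [x Ux|v].
  exact: (differentiableM (Cinf_differentiable cf Ux) (Cinf_differentiable cg Ux)).
apply: (@eq_Ck _ _ _ _ _ (fun x => f x * 'D_v g x + g x * 'D_v f x : R^o)) => //.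
  move=> x; rewrite inE => Ux; apply/esym.
  by rewrite derive_mul //; [exact: (Cinf_differentiable cf Ux)|exact: (Cinf_differentiable cg Ux)].
by apply: CkD => //; apply: IH => //; exact: Cinf_derive.
Qed.

End ScalarCalculus.

Section Coordinates.
Context {R : realType} {V : normedModType R} {m : nat}.
Implicit Types (U : set V) (f : V -> 'rV[R]_m).

Lemma differentiable_rV f x :
  differentiable f x <-> forall k, differentiable (fun y => f y 0 k : R^o) x.
Proof.
split=> [df k|df].
  exact: (differentiable_comp df (differentiable_coord _ _ _)).
rewrite (_ : f = fun y => \sum_k (f y 0 k : R) *: (delta_mx 0 k : 'rV[R]_m)).
  by apply: differentiable_sumE => k; apply: differentiableZl; exact: df.
by apply/funext => y; rewrite -row_sum_delta.
Qed.

Lemma derive_rV f x v k : differentiable f x ->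
  'D_v f x 0 k = 'D_v (fun y => f y 0 k : R^o) x.
Proof. by move=> df; rewrite derive_mx ?mxE //; exact: diff_derivable. Qed.

Lemma diff_rV f x v k : differentiable f x ->
  'd f x v 0 k = 'd (fun y => f y 0 k : R^o) x v.
Proof.
move=> df; rewrite -!deriveE //; first exact: derive_rV.
by move/differentiable_rV : df.
Qed.

Lemma Cinf_rV U f : open U ->
  Cinf U f <-> forall k, Cinf U (fun y => f y 0 k : R^o).
Proof.
move=> oU; split=> [cf k n|cf n].
  elim: n f cf => [|n IH] f cf.
    move=> x Ux; apply: differentiable_continuous.
    by have /differentiable_rV := Cinf_differentiable cf Ux; exact.
  split=> [x Ux|v].
    by have /differentiable_rV := Cinf_differentiable cf Ux; exact.
  apply: eq_Ck (IH _ (Cinf_derive v cf)) => // x; rewrite inE => Ux.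
  by rewrite derive_rV //; exact: Cinf_differentiable Ux.
have df (g : V -> 'rV[R]_m) x : (forall k, Cinf U (fun y => g y 0 k : R^o)) -> U x ->
    differentiable g x.
  by move=> cg Ux; apply/differentiable_rV => k; exact: Cinf_differentiable Ux.
elim: n f cf => [|n IH] f cf.
  by move=> x Ux; apply: differentiable_continuous; exact: df.
split=> [x Ux|v]; first exact: df.
apply: IH => k; apply: eq_Cinf (Cinf_derive v (cf k)) => // x; rewrite inE => Ux.
by rewrite derive_rV //; exact: df.
Qed.

End Coordinates.

(** * Symmetry of second derivatives *)

Section Schwarz.
Context {R : realType} {V : normedModType R}.
Implicit Types (U : set V) (f g : V -> R^o).

Lemma mean_value_line f (y v : V) (d : R) : 0 < d ->
  (forall t, 0 <= t <= d -> differentiable f (y + t *: v)) ->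
  exists2 t, 0 <= t <= d & f (y + d *: v) - f y = d * 'D_v f (y + t *: v).
Proof.
move=> d0 df; pose h (t : R) : R := f (y + t *: v).
have hE t : (fun r : R => r^-1 *: ((h \o shift t) (r *: 1) - h t)) =
    (fun r : R => r^-1 *: ((f \o shift (y + t *: v)) (r *: v) - f (y + t *: v))).
  apply/funext => r; rewrite /h /= [r *: 1]mulr1 scalerDl.
  by rewrite [y + (_ + _)]addrCA.
have hd t : t \in `[0, d] -> derivable h t 1.
  rewrite in_itv /= => td; rewrite /derivable hE.
  have H := @diff_derivable _ _ _ f _ v (df _ td).
  exact H.
have hD t : t \in `]0, d[ -> is_derive t 1 h ('D_v f (y + t *: v)).
  move=> td; split; last by rewrite /derive hE.
  by apply: hd; rewrite in_itv /= !ltW ?(itvP td).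
have [t td E] := MVT d0 hD (derivable_within_continuous hd).
exists t; first by rewrite !ltW ?(itvP td).
by move: E; rewrite /h scale0r addr0 subr0 mulrC.
Qed.

Lemma differentiable_translate f (a x : V) :
  differentiable f (x + a) -> differentiable (fun z => f (z + a) : R^o) x.
Proof.
move=> df.
have ds : differentiable (fun z => z + a : V) x.
  have H := differentiableD (@ex_diff _ _ _ _ _ _ _ (is_diff_id x)) (differentiable_cst a x).
  exact H.
exact: (differentiable_comp ds df).
Qed.

Lemma derive_translate f (a x v : V) :
  'D_v (fun z => f (z + a) : R^o) x = 'D_v f (x + a).
Proof.
rewrite /derive (_ : (fun h => _) =
  fun h : R => h^-1 *: ((f \o shift (x + a)) (h *: v) - f (x + a))) //.
by apply/funext => h /=; rewrite addrA.
Qed.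

(** Two mean values: first in direction [v] for the increment z |-> f (z + d w) - f z, then in
    direction [w] for the derivative of [f] along [v]. *)
Lemma second_difference U f (x v w : V) (d : R) : 0 < d ->
  (forall s t, 0 <= s <= d -> 0 <= t <= d -> U (x + s *: v + t *: w)) ->
  Cinf U f ->
  exists s t, [/\ 0 <= s <= d, 0 <= t <= d &
    f (x + d *: v + d *: w) - f (x + d *: v) - (f (x + d *: w) - f x) =
    d * (d * 'D_w ('D_v f) (x + s *: v + t *: w))].
Proof.
move=> d0 UQ cf; have dd : 0 <= d <= d by rewrite lexx ltW.
have zd : 0 <= (0 : R) <= d by rewrite lexx ltW.
have Ut s : 0 <= s <= d -> U (x + s *: v).
  by move=> sd; have := UQ s 0 sd zd; rewrite scale0r addr0.
pose g z : R^o := f (z + d *: w) - f z.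
have dg1 s : 0 <= s <= d -> differentiable (fun z => f (z + d *: w) : R^o) (x + s *: v).
  move=> sd; apply: differentiable_translate.
  by apply: (Cinf_differentiable cf); exact: UQ.
have dg2 s : 0 <= s <= d -> differentiable f (x + s *: v).
  by move=> sd; apply: (Cinf_differentiable cf); exact: Ut.
have [|s sd gE] := @mean_value_line g x v d d0.
  by move=> s sd; apply: differentiableB; [exact: dg1|exact: dg2].
have [|t td E] := @mean_value_line ('D_v f) (x + s *: v) w d d0.
  by move=> t td; apply: (Cinf_differentiable (Cinf_derive v cf)); exact: UQ.
exists s, t; split=> //.
rewrite -E -derive_translate.
have -> : 'D_v (fun z => f (z + d *: w) : R^o) (x + s *: v) - 'D_v f (x + s *: v) =
    'D_v g (x + s *: v).
  by rewrite /g deriveB //; apply: diff_derivable; [exact: dg1|exact: dg2].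
by rewrite -gE.
Qed.

(** The second difference over a parallelogram is symmetric in its two sides, so its two mean value
    expressions coincide. *)
Lemma second_difference_inj (a b c e d h h' : R) : 0 < d ->
  a - b - (c - e) = d * (d * h) -> a - c - (b - e) = d * (d * h') -> h = h'.
Proof.
move=> d0 E E'.
have /eqP : d * d * (h - h') = 0.
  have -> : d * d * (h - h') = d * (d * h) - d * (d * h') by ring.
  rewrite -E -E'; ring.
by rewrite !mulf_eq0 (gt_eqF d0) /= subr_eq0 => /eqP.
Qed.

Lemma close_half (a b c e : R) :
  `|a - c| < e / 2 -> `|b - c| < e / 2 -> `|a - b| <= e.
Proof.
move=> L1 L2; have -> : a - b = (a - c) - (b - c) by rewrite opprB addrA subrK.
by apply: (le_trans (ler_normB _ _)); rewrite [leRHS]splitr lerD // ltW.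
Qed.

(** On a small parallelogram at [x] the two mixed derivatives take a common value, at two different
    points; both are continuous at [x]. *)
Lemma derive_comm U f (x v w : V) : open U -> Cinf U f -> U x ->
  'D_v ('D_w f) x = 'D_w ('D_v f) x.
Proof.
move=> oU cf Ux; apply/eqP; rewrite -subr_eq0 -normr_le0; apply/ler_addgt0Pr => e e0.
rewrite add0r.
have e20 : 0 < e / 2 by rewrite divr_gt0.
have c1 : {for x, continuous ('D_v ('D_w f))}.
  exact: (Cinf_derive v (Cinf_derive w cf) 0%N).
have c2 : {for x, continuous ('D_w ('D_v f))}.
  exact: (Cinf_derive w (Cinf_derive v cf) 0%N).
have N : \forall y \near x, U y /\ (`|'D_v ('D_w f) x - 'D_v ('D_w f) y| < e / 2 /\
    `|'D_w ('D_v f) x - 'D_w ('D_v f) y| < e / 2).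
  have N0 : \near x, U x by exact: open_nbhs_nbhs.
  move/cvgrPdist_lt : c1 => /(_ _ e20) N1.
  move/cvgrPdist_lt : c2 => /(_ _ e20) N2.
  apply: filterI; first exact N0.
  by apply: filterI; [exact N1|exact N2].
have [r /= r0 rN] := (nbhs_ballP _ _).1 N.
(* Side [d = r / k] keeps the parallelogram in the ball of radius [r]. The summand 1 makes [k]
   positive and the inclusion strict, since r = d (|v| + |w|) + d. *)
pose k := `|v| + `|w| + 1; have k0 : 0 < k by rewrite ltr_wpDl.
pose d := r / k; have d0 : 0 < d by rewrite divr_gt0.
have Q s t : 0 <= s <= d -> 0 <= t <= d -> ball x r (x + s *: v + t *: w).
  move=> /andP[s0 sd] /andP[t0 td].
  rewrite -ball_normE /= -addrA opprD addrA subrr sub0r normrN.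
  apply: (le_lt_trans (ler_normD _ _)); rewrite !normrZ !ger0_norm //.
  have -> : r = d * (`|v| + `|w|) + d.
    by rewrite -[X in _ = _ + X]mulr1 -mulrDr /d divfK // gt_eqF.
  by rewrite ltr_pwDr // mulrDr lerD // ler_wpM2r.
have QU s t : 0 <= s <= d -> 0 <= t <= d -> U (x + s *: v + t *: w).
  by move=> sd td; have [] := rN _ (Q _ _ sd td).
have QU' s t : 0 <= s <= d -> 0 <= t <= d -> U (x + s *: w + t *: v).
  by move=> sd td; rewrite -addrA [s *: w + _]addrC addrA; exact: QU.
have [s [t [sd td E]]] := second_difference d0 QU cf.
have [s' [t' [sd' td' E']]] := second_difference d0 QU' cf.
have {E E'} H : 'D_w ('D_v f) (x + s *: v + t *: w) =
                'D_v ('D_w f) (x + s' *: w + t' *: v).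
  move: E'; rewrite -[x + d *: w + _]addrA [d *: w + _]addrC addrA => E'.
  refine (second_difference_inj d0 E E').
have [_ [_ L1]] := rN _ (Q _ _ sd td).
have [_ [L2 _]] := rN _ (Q _ _ td' sd').
rewrite -addrA [t' *: v + _]addrC addrA -H in L2.
exact (close_half L2 L1).
Qed.

End Schwarz.

Section Lines.
Context {R : realType} {V : normedModType R}.
Implicit Types (U : set V) (f g : V -> R^o).

(** Only the behaviour of [l] along one line matters. The intended [l] is the scaling of the
    fibres. *)
Lemma derive_comp_line f (l : V -> V) (x v w : V) :
  (forall h : R, l (h *: v + x) = h *: w + l x) ->
  'D_v (f \o l) x = 'D_w f (l x).
Proof.
move=> lE; rewrite /derive (_ : (fun h => _) =
  fun h : R => h^-1 *: ((f \o shift (l x)) (h *: w) - f (l x))) //.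
by apply/funext => h /=; rewrite lE.
Qed.

Lemma derive_line f (y v : V) :
  'D_1 (fun t : R => f (y + t *: v)) 0 = 'D_v f y.
Proof.
pose g (t : R) : R^o := f (y + t *: v).
have gE : (fun h : R => h^-1 *: ((g \o shift 0) (h *: 1) - g 0)) =
    (fun h : R => h^-1 *: ((f \o shift y) (h *: v) - f y)).
  apply/funext => h.
  by rewrite /g /= [h *: 1]mulr1 addr0 scale0r addr0 [y + _]addrC.
exact (f_equal (fun F : R -> R^o => lim (F @ 0^')) gE).
Qed.

(** For functions known to agree on one fibre but not on an open set, as under a conformal
    change. *)
Lemma near_line_derive f g (y v : V) :
  (\forall t \near (0 : R), f (y + t *: v) = g (y + t *: v)) ->
  'D_v f y = 'D_v g y.
Proof.
move=> fg; rewrite -(derive_line f) -(derive_line g).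
exact: near_eq_derive.
Qed.

Lemma near_line U (y v : V) : open U -> U y ->
  \forall t \near (0 : R), U (y + t *: v).
Proof.
move=> oU Uy.
have c : {for (0 : R), continuous (fun t : R => y + t *: v)}.
  apply: continuousD; first exact: cst_continuous.
  exact: scalel_continuous.
by apply: c; rewrite scale0r addr0; exact: open_nbhs_nbhs.
Qed.

Lemma derive_cstM f (k : R) (y v : V) : differentiable f y ->
  'D_v (fun x => k * f x : R^o) y = k * 'D_v f y.
Proof.
move=> df; have dfv : derivable f y v by exact: diff_derivable.
exact (deriveZ k dfv).
Qed.

Lemma derive_scale f (k : R) (y v : V) : differentiable f y ->
  'D_(k *: v) f y = k * 'D_v f y.
Proof. by move=> df; rewrite !deriveE //; exact: linearZ. Qed.

Lemma derive_add_vec f (y v w : V) : differentiable f y ->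
  'D_(v + w) f y = 'D_v f y + 'D_w f y.
Proof. by move=> df; rewrite !deriveE //; exact: linearD. Qed.

End Lines.

(** * Derivatives along vector fields, and their commutators *)

Section DirectionalDerivative.
Context {R : realType} {m : nat}.
Local Notation V := 'rV[R]_m.
Implicit Types (U : set V) (f : V -> R^o) (X Y : V -> V).

Lemma diff_coord (W : normedModType R) (f : V -> W) (z a : V) :
  'd f z a = \sum_k a 0 k *: 'd f z (delta_mx 0 k).
Proof.
rewrite {1}(row_sum_delta a) linear_sum.
by apply: eq_bigr => k _; rewrite linearZ.
Qed.

Lemma dfield_coord U f X z : Cinf U f -> U z ->
  'd f z (X z) = \sum_k X z 0 k * 'D_(delta_mx 0 k) f z.
Proof.
move=> cf Uz; rewrite diff_coord; apply: eq_bigr => k _.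
by rewrite (Cinf_diffE _ cf Uz).
Qed.

(** [Ck] speaks of fixed directions, so a direction that moves with the point is split into its
    coordinates. *)
Lemma Cinf_dfield U f X : open U -> Cinf U f -> Cinf U X ->
  Cinf U (fun z => 'd f z (X z) : R^o).
Proof.
move=> oU cf cX.
apply: (@eq_Cinf _ _ _ _ (fun z => \sum_k X z 0 k * 'D_(delta_mx 0 k) f z : R^o)) => //.
  by move=> z; rewrite inE => Uz; rewrite (dfield_coord _ cf Uz).
apply: Cinf_sum => // k; apply: CinfM => //; last exact: Cinf_derive.
by move/Cinf_rV : cX; apply.
Qed.

(** The product rule, with the second order term written for the field frozen at [z]: this is the
    shape in which [derive_comm] applies. *)
Lemma derive_dfield U f X z a : open U -> Cinf U f -> Cinf U X -> U z ->
  'D_a (fun y => 'd f y (X y) : R^o) z =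
  'D_a ('D_(X z) f) z + 'd f z ('D_a X z).
Proof.
move=> oU cf cX Uz.
have dX := Cinf_differentiable cX Uz.
have dXk k : differentiable (fun y => X y 0 k : R^o) z.
  by move/differentiable_rV : dX; apply.
have dfk k := Cinf_differentiable (Cinf_derive (delta_mx 0 k) cf) Uz.
have dM k : differentiable (fun y => X y 0 k * 'D_(delta_mx 0 k) f y : R^o) z.
  exact: (differentiableM (dXk k) (dfk k)).
rewrite (@open_eq_derive _ _ _ U _ (fun y => \sum_k X y 0 k * 'D_(delta_mx 0 k) f y : R^o)) //;
  last by move=> y; rewrite inE => Uy; rewrite (dfield_coord _ cf Uy).
rewrite derive_sumE //.
(* The same coordinate expansion for the constant field [X z], whose coefficients have zero
   derivative. *)
have -> : 'D_a ('D_(X z) f) z = \sum_k X z 0 k * 'D_a ('D_(delta_mx 0 k) f) z.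
  rewrite (@open_eq_derive _ _ _ U _ (fun y => \sum_k X z 0 k * 'D_(delta_mx 0 k) f y : R^o)) //.
    rewrite derive_sumE => [|k]; last exact: (differentiableM (differentiable_cst _ _) (dfk k)).
    apply: eq_bigr => k _.
    have dc : differentiable (cst (X z 0 k) : V -> R^o) z by exact: differentiable_cst.
    have -> := derive_mul a dc (dfk k).
    have -> : 'D_a (cst (X z 0 k) : V -> R^o) z = 0 by exact: derive_cst.
    by rewrite mulr0 addr0.
  move=> y; rewrite inE => Uy; rewrite -(Cinf_diffE _ cf Uy).
  exact: (dfield_coord (cst (X z)) cf Uy).
rewrite [X in _ = _ + X]diff_coord -big_split /=; apply: eq_bigr => k _.
rewrite derive_mul // derive_rV // (Cinf_diffE _ cf Uz) //.
by congr (_ + _); rewrite mulrC.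
Qed.

End DirectionalDerivative.

Local Opaque diff derive.

Section VectorDerivative.
Context {R : realType} {m p : nat}.
Local Notation V := 'rV[R]_m.
Local Notation W := 'rV[R]_p.
Implicit Types (U : set V) (f : V -> W) (X Y : V -> V).

Definition vbracket X Y : V -> V := fun z => 'd Y z (X z) - 'd X z (Y z).

Lemma differentiable_dfield U (f : V -> R^o) X z : open U -> Cinf U f -> Cinf U X -> U z ->
  differentiable (fun y => 'd f y (X y) : R^o) z.
Proof. by move=> oU cf cX; exact: (Cinf_differentiable (Cinf_dfield oU cf cX)). Qed.

Lemma dfield_rV U f X k z : open U -> Cinf U f -> U z ->
  'd f z (X z) 0 k = 'd (fun y => f y 0 k : R^o) z (X z).
Proof. by move=> oU cf Uz; rewrite diff_rV //; exact: (Cinf_differentiable cf Uz). Qed.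

Lemma Cinf_dfield_rV U f X : open U -> Cinf U f -> Cinf U X ->
  Cinf U (fun z => 'd f z (X z)).
Proof.
move=> oU cf cX; apply/Cinf_rV => // k.
have cfk := (Cinf_rV f oU).1 cf k.
apply: eq_Cinf (Cinf_dfield oU cfk cX) => // z; rewrite inE => Uz.
by rewrite (dfield_rV _ _ oU cf Uz).
Qed.

Lemma diff_dfield U (f : V -> R^o) X z a :
  open U -> Cinf U f -> Cinf U X -> U z ->
  'd (fun y => 'd f y (X y) : R^o) z a =
  'D_a ('D_(X z) f) z + 'd f z ('d X z a).
Proof.
move=> oU cf cX Uz.
have <- := deriveE a (Cinf_differentiable cX Uz).
have E1 := deriveE a (differentiable_dfield oU cf cX Uz).
exact (etrans (esym E1) (derive_dfield a oU cf cX Uz)).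
Qed.

Lemma sub_common (A B u v s s' r : R) :
  A = s + u -> B = s' + v -> s = s' -> r = u - v -> A - B = r.
Proof. by move=> -> -> -> ->; rewrite opprD addrACA subrr add0r. Qed.

(** The second derivatives of [f] cancel by [derive_comm]; what remains is the first order part of
    [derive_dfield]. *)
Lemma diff_comm_field U (f : V -> R^o) X Y z :
  open U -> Cinf U f -> Cinf U X -> Cinf U Y -> U z ->
  'd (fun y => 'd f y (Y y) : R^o) z (X z) - 'd (fun y => 'd f y (X y) : R^o) z (Y z) =
  'd f z (vbracket X Y z).
Proof.
move=> oU cf cX cY Uz.
have E : 'd f z (vbracket X Y z) = 'd f z ('d Y z (X z)) - 'd f z ('d X z (Y z)).
  exact: linearB.
have EX := diff_dfield (Y z) oU cf cX Uz.
have EY := diff_dfield (X z) oU cf cY Uz.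
exact (sub_common EY EX (derive_comm (X z) (Y z) oU cf Uz) E).
Qed.

Lemma diff_comm_field_rV U f X Y z :
  open U -> Cinf U f -> Cinf U X -> Cinf U Y -> U z ->
  'd (fun y => 'd f y (Y y)) z (X z) - 'd (fun y => 'd f y (X y)) z (Y z) =
  'd f z (vbracket X Y z).
Proof.
move=> oU cf cX cY Uz; apply/rowP => k; rewrite !mxE.
have cfk := (Cinf_rV f oU).1 cf k.
have E X' Z : Cinf U X' ->
    'd (fun y => 'd f y (X' y)) z Z 0 k =
    'd (fun y => 'd (fun y => f y 0 k : R^o) y (X' y) : R^o) z Z.
  move=> cX'; rewrite diff_rV; last first.
    exact: (Cinf_differentiable (Cinf_dfield_rV oU cf cX') Uz).
  apply: (open_eq_diff _ oU) => //.
    by move=> y; rewrite inE => Uy; rewrite (dfield_rV _ _ oU cf Uy).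
  move/differentiable_rV : (Cinf_differentiable (Cinf_dfield_rV oU cf cX') Uz).
  exact.
rewrite !E // (diff_comm_field oU cfk cX cY Uz).
by rewrite diff_rV //; exact: (Cinf_differentiable cf Uz).
Qed.

End VectorDerivative.

Section VectorBracket.
Context {R : realType} {m : nat}.
Local Notation V := 'rV[R]_m.
Implicit Types (U : set V) (X Y Z : V -> V).

Lemma Cinf_opp U (p : nat) (f : V -> 'rV[R]_p) : open U -> Cinf U f -> Cinf U (fun z => - f z).
Proof.
move=> oU /(Cinf_rV _ oU) cf; apply/(Cinf_rV _ oU) => k.
apply: eq_Cinf (CinfM oU (Cinf_cst U (-1 : R^o)) (cf k)) => // z _.
by rewrite mulN1r mxE.
Qed.

Lemma Cinf_vbracket U X Y : open U -> Cinf U X -> Cinf U Y -> Cinf U (vbracket X Y).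
Proof.
move=> oU cX cY; apply: CinfD => //; first exact: Cinf_dfield_rV.
by apply: Cinf_opp => //; exact: Cinf_dfield_rV.
Qed.

Lemma jacobi_sum (A B C a b c d e f : V) :
  A = a - b - (c - d) -> B = c - e - (f - b) -> C = f - d - (a - e) ->
  A + B + C = 0.
Proof. by move=> -> -> ->; apply/rowP => k; rewrite !mxE; ring. Qed.

(** In each double bracket the commutator formula rewrites the derivative along the inner bracket.
    The cyclic sum then consists of six iterated derivatives, each occurring twice with opposite
    signs. *)
Lemma vbracket_jacobi U X Y Z z :
  open U -> Cinf U X -> Cinf U Y -> Cinf U Z -> U z ->
  vbracket X (vbracket Y Z) z + vbracket Y (vbracket Z X) z
    + vbracket Z (vbracket X Y) z = 0.
Proof.
move=> oU cX cY cZ Uz.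
have E X' Y' Z' : Cinf U X' -> Cinf U Y' -> Cinf U Z' ->
    vbracket X' (vbracket Y' Z') z =
    'd (fun y => 'd Z' y (Y' y)) z (X' z) - 'd (fun y => 'd Y' y (Z' y)) z (X' z)
    - ('d (fun y => 'd X' y (Z' y)) z (Y' z) - 'd (fun y => 'd X' y (Y' y)) z (Z' z)).
  move=> cX' cY' cZ'; rewrite [LHS]/vbracket (diff_comm_field_rV oU cX' cY' cZ' Uz).
  congr (_ - _).
  have := diffB (Cinf_differentiable (Cinf_dfield_rV oU cZ' cY') Uz)
     (Cinf_differentiable (Cinf_dfield_rV oU cY' cZ') Uz).
  by move/(congr1 (fun g => g (X' z))).
exact (jacobi_sum (E X Y Z cX cY cZ) (E Y Z X cY cZ cX) (E Z X Y cZ cX cY)).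
Qed.

End VectorBracket.

Section ChangeOfCoordinates.
Context {R : realType} {m p : nat}.
Local Notation V := 'rV[R]_m.
Local Notation W := 'rV[R]_p.
(** By the chain rule the left side is the commutator of the derivatives of [phi] along [X] and [Y],
    and [diff_comm_field_rV] evaluates that commutator. *)
Lemma vbracket_change U U' (phi : V -> W) (X Y : V -> V) (X' Y' : W -> W) z :
  open U -> open U' -> Cinf U phi -> Cinf U X -> Cinf U Y ->
  Cinf U' X' -> Cinf U' Y' -> (forall y, U y -> U' (phi y)) ->
  (forall y, U y -> X' (phi y) = 'd phi y (X y)) ->
  (forall y, U y -> Y' (phi y) = 'd phi y (Y y)) -> U z ->
  vbracket X' Y' (phi z) = 'd phi z (vbracket X Y z).
Proof.
move=> oU oU' cphi cX cY cX' cY' phiU XX YY Uz.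
rewrite -(diff_comm_field_rV oU cphi cX cY Uz).
have E X1 Y1 Y1' : Cinf U Y1 -> Cinf U' Y1' ->
    (forall y, U y -> Y1' (phi y) = 'd phi y (Y1 y)) ->
    'd Y1' (phi z) ('d phi z (X1 z)) = 'd (fun y => 'd phi y (Y1 y)) z (X1 z).
  move=> cY1 cY1' H.
  have dphi := Cinf_differentiable cphi Uz.
  have dY := Cinf_differentiable cY1' (phiU _ Uz).
  have <- : 'd (Y1' \o phi) z (X1 z) = 'd Y1' (phi z) ('d phi z (X1 z)).
    exact (f_equal (fun g : V -> W => g (X1 z)) (diff_comp dphi dY)).
  apply: (open_eq_diff _ oU) => //.
    by move=> y; rewrite inE => Uy /=; exact: H.
  exact: differentiable_comp.
have EX := E X Y Y' cY cY' YY; have EY := E Y X X' cX cX' XX.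
rewrite /vbracket (XX _ Uz) (YY _ Uz).
by congr (_ - _); [exact EX|exact EY].
Qed.
End ChangeOfCoordinates.

(** * Vector fields and their brackets *)

(** What the base and the slit bundle have in common. [slit A] carries no topology, so openness is
    required of the images of the charts and not of their domains. *)
Record smooth_atlas (R : realType) (T : Type) (m : nat) (A : atlas R T m) :
    Prop := SmoothAtlas {
  atlas_cover : forall p, exists i : chart A, dom i p;
  atlas_inj : forall i : chart A, {in dom i &, injective (xcoord i)};
  atlas_open : forall i j : chart A, open (xcoord i @` (dom i `&` dom j));
  atlas_transition : forall i j : chart A,
    Cinf (xcoord i @` (dom i `&` dom j)) (rep i (xcoord j)) }.

Arguments atlas_open {R T m A} _ i j.
Arguments atlas_transition {R T m A} _ i j.

Lemma sub_split (M : zmodType) (a b c d e f : M) :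
  a = b + c -> d = e + f -> a - d = (b - e) + (c - f).
Proof. by move=> -> ->; rewrite opprD addrACA. Qed.

Section SmoothAtlas.
Context {R : realType} {T : Type} {m : nat} {A : atlas R T m}.
Hypothesis sA : smooth_atlas A.
Implicit Types (i j : chart A) (p : T) (X Y Z : T -> tvec A).

Lemma repE i (W : normedModType R) (F : T -> W) p :
  dom i p -> rep i F (xcoord i p) = F p.
Proof.
move=> dp; rewrite /rep; set S := (X in xget 0 X).
have : S (xget 0 S) by apply: xgetPex; exists (F p); exists p.
by case=> q [dq /= xq] <-; congr F; apply: (atlas_inj sA) xq; rewrite inE.
Qed.

Lemma chart_open i : open (xcoord i @` dom i).
Proof. by have := atlas_open sA i i; rewrite setIid. Qed.

Arguments chart_open : clear implicits.

Lemma chart_image i p : dom i p -> (xcoord i @` dom i) (xcoord i p).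
Proof. by move=> dp; exists p. Qed.

Lemma rep_change i j (W : normedModType R) (F : T -> W) z :
  (xcoord i @` (dom i `&` dom j)) z -> rep j F (rep i (xcoord j) z) = rep i F z.
Proof. by move=> [p [dp dp'] <-]; rewrite !repE. Qed.

Lemma transition_image i j z :
  (xcoord i @` (dom i `&` dom j)) z -> (xcoord j @` dom j) (rep i (xcoord j) z).
Proof. by move=> [p [dp dp'] <-]; exists p; rewrite ?repE. Qed.

Lemma differentiable_transition i j p : dom i p -> dom j p ->
  differentiable (rep i (xcoord j)) (xcoord i p).
Proof.
move=> dp dp'; apply: (Cinf_differentiable (atlas_transition sA i j)).
by exists p.
Qed.

Lemma diff_rep_change i j (W : normedModType R) (F : T -> W) p v :
  dom i p -> dom j p -> differentiable (rep j F) (xcoord j p) ->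
  'd (rep i F) (xcoord i p) v =
  'd (rep j F) (xcoord j p) ('d (rep i (xcoord j)) (xcoord i p) v).
Proof.
move=> dp dp' dF; have dt := differentiable_transition dp dp'.
have E : rep i (xcoord j) (xcoord i p) = xcoord j p by rewrite repE.
rewrite -E in dF; rewrite -[in RHS]E.
have H := f_equal (fun g : 'rV[R]_m -> W => g v) (diff_comp dt dF).
rewrite -[RHS]H; apply/esym; apply: (open_eq_diff _ (atlas_open sA i j)).
- by move=> z; rewrite inE => Uz /=; exact: rep_change.
- by exists p.
- exact: differentiable_comp.
Qed.

(** [lie] selects a value from an unspecified chart around [p]; the chain rule through the
    transition map brings it to the chart [i]. *)
Lemma lieE X (f : T -> R) i p : tangent p (X p) -> smooth A (f : _ -> R^o) ->
  dom i p -> lie X f p = 'd (rep i (f : T -> R^o)) (xcoord i p) (X p i).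
Proof.
move=> [_ tX] sf dp; rewrite /lie; set S := (X in xget 0 X).
have : S (xget 0 S).
  by apply: xgetPex; exists ('d (rep i (f : T -> R^o)) (xcoord i p) (X p i)); exists i.
move=> [j /= dp' <-].
have -> := tX _ _ dp dp'.
exact (esym (diff_rep_change (X p i) dp dp'
  (Cinf_differentiable (sf j) (chart_image dp')))).
Qed.

Definition vrep i (X : T -> tvec A) : 'rV[R]_m -> 'rV[R]_m :=
  rep i (fun p => X p i).

Lemma vrepE i X p : dom i p -> vrep i X (xcoord i p) = X p i.
Proof. exact: repE. Qed.

Lemma vfield_smooth X i : vfield X -> Cinf (xcoord i @` dom i) (vrep i X).
Proof. by move=> []. Qed.

Lemma vfield_differentiable X i p : vfield X -> dom i p ->
  differentiable (vrep i X) (xcoord i p).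
Proof.
move=> vX dp; exact: (Cinf_differentiable (vfield_smooth i vX) (chart_image dp)).
Qed.

Lemma vrepD i X Y z : (xcoord i @` dom i) z ->
  vrep i (X + Y) z = vrep i X z + vrep i Y z.
Proof. by move=> [p dp <-]; rewrite !vrepE. Qed.

Lemma vrepN i X z : (xcoord i @` dom i) z -> vrep i (- X) z = - vrep i X z.
Proof. by move=> [p dp <-]; rewrite !vrepE. Qed.

Lemma tangentD p (v w : tvec A) : tangent p v -> tangent p w -> tangent p (v + w).
Proof.
move=> [v0 tv] [w0 tw]; split=> [i dp|i j dp dp'].
  by rewrite -[LHS]/(v i + w i) v0 // w0 // addr0.
by rewrite -[LHS]/(v j + w j) (tv i j) // (tw i j) // -linearD.
Qed.

Lemma tangentZ p (a : R) (v : tvec A) : tangent p v -> tangent p (a *: v).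
Proof.
move=> [v0 tv]; split=> [i dp|i j dp dp'].
  by rewrite -[LHS]/(a *: v i) v0 // scaler0.
by rewrite -[LHS]/(a *: v j) (tv i j) // -linearZ.
Qed.

Lemma tangentN p (v : tvec A) : tangent p v -> tangent p (- v).
Proof. by rewrite -scaleN1r; exact: tangentZ. Qed.

Lemma vfieldD X Y : vfield X -> vfield Y -> vfield (X + Y : T -> tvec A).
Proof.
move=> vX vY; split=> [p|i].
  by apply: tangentD; [exact: (proj1 vX)|exact: (proj1 vY)].
have oU := chart_open i.
apply: (eq_Cinf oU _ (CinfD oU (proj2 vX i) (proj2 vY i))) => z.
by rewrite inE => Uz; rewrite -[LHS]/(vrep i X z + vrep i Y z) -vrepD.
Qed.

Lemma vfieldN X : vfield X -> vfield (- X : T -> tvec A).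
Proof.
move=> vX; split=> [p|i]; first by apply: tangentN; exact: (proj1 vX).
have oU := chart_open i.
apply: (eq_Cinf oU _ (Cinf_opp oU (proj2 vX i))) => z.
by rewrite inE => Uz; rewrite -[LHS]/(- vrep i X z) -vrepN.
Qed.

Lemma vfieldB X Y : vfield X -> vfield Y -> vfield (X - Y : T -> tvec A).
Proof. by move=> vX vY; apply: vfieldD => //; exact: vfieldN. Qed.

Lemma eq_tangent p (v w : tvec A) : tangent p v -> tangent p w ->
  (forall i, dom i p -> v i = w i) -> v = w.
Proof.
move=> [v0 _] [w0 _] vw; apply/funext => i.
by have [/vw //|dp] := pselect (dom i p); rewrite v0 ?w0.
Qed.

(** The components in the other charts around [p] follow by the Jacobians, and those in the
    remaining charts are 0. *)
Lemma tangent1_eq p (v w : tvec A) i : dom i p -> tangent p v -> tangent p w ->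
  v i = w i -> v = w.
Proof.
move=> dp tv tw vw; apply: (eq_tangent tv tw) => j dp'.
by rewrite (proj2 tv i j) // (proj2 tw i j) // vw.
Qed.

Lemma bracketE X Y i p : dom i p ->
  bracket X Y p i = vbracket (vrep i X) (vrep i Y) (xcoord i p).
Proof. by move=> dp; rewrite /vbracket !vrepE. Qed.

Lemma vrep_bracket X Y i z : (xcoord i @` dom i) z ->
  vrep i (bracket X Y) z = vbracket (vrep i X) (vrep i Y) z.
Proof. by move=> [p dp <-]; rewrite vrepE // bracketE. Qed.

Lemma vfield_bracket X Y : vfield X -> vfield Y -> vfield (bracket X Y).
Proof.
move=> vX vY; split=> [p|i]; last first.
  have oU := chart_open i.
  apply: (eq_Cinf oU _ (Cinf_vbracket oU (vfield_smooth i vX) (vfield_smooth i vY))).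
  by move=> z; rewrite inE => Uz; rewrite -vrep_bracket.
split=> [i ndp|i j dp dp'].
  (* In a chart that misses [p] both fields have zero components, and a linear map sends 0 to 0. *)
  rewrite /bracket (proj1 (proj1 vX p)) // (proj1 (proj1 vY p)) //.
  have d0 (f : 'rV[R]_m -> 'rV[R]_m) x : 'd f x 0 = 0 by exact: linear0.
  by apply/eqP; rewrite subr_eq0; apply/eqP; exact (etrans (d0 _ _) (esym (d0 _ _))).
rewrite !bracketE //.
have E : rep i (xcoord j) (xcoord i p) = xcoord j p by rewrite repE.
rewrite -E.
have sub : xcoord i @` (dom i `&` dom j) `<=` xcoord i @` dom i.
  by move=> z [q [dq _] <-]; exists q.
apply: (vbracket_change (atlas_open sA i j) (chart_open j) (atlas_transition sA i j)
  (Cinf_subset sub (vfield_smooth i vX)) (Cinf_subset sub (vfield_smooth i vY))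
  (vfield_smooth j vX) (vfield_smooth j vY)).
- by move=> y Uy; exact: transition_image.
- move=> y [q [dq dq'] <-]; rewrite repE // !vrepE //.
  exact: (proj2 (proj1 vX q)).
- move=> y [q [dq dq'] <-]; rewrite repE // !vrepE //.
  exact: (proj2 (proj1 vY q)).
- by exists p.
Qed.

Lemma bracketC (X Y : T -> tvec A) : bracket X Y = - bracket Y X.
Proof.
apply/funext => p; apply/funext => i.
by rewrite -[RHS]/(- (bracket Y X p i)) /bracket opprB.
Qed.

Lemma bracketDl X X' Y : vfield X -> vfield X' -> vfield Y ->
  bracket (X + X') Y = bracket X Y + bracket X' Y.
Proof.
move=> vX vX' vY; apply/funext => p.
have vXX := vfieldD vX vX'.
apply: eq_tangent.
- exact: (proj1 (vfield_bracket vXX vY)).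
- apply: tangentD; [exact: (proj1 (vfield_bracket vX vY))|
                    exact: (proj1 (vfield_bracket vX' vY))].
move=> i dp; rewrite -[RHS]/(bracket X Y p i + bracket X' Y p i) /bracket.
have dX := vfield_differentiable vX dp; have dX' := vfield_differentiable vX' dp.
have E : 'd (vrep i (X + X')) (xcoord i p) (Y p i) =
    'd (vrep i X) (xcoord i p) (Y p i) + 'd (vrep i X') (xcoord i p) (Y p i).
  have H := f_equal (fun g : _ -> 'rV[R]_m => g (Y p i)) (diffD dX dX').
  rewrite -[RHS]H; apply: (open_eq_diff _ (chart_open i)).
  - by move=> z; rewrite inE => Uz; exact: vrepD.
  - exact: chart_image.
  - exact: vfield_differentiable.
have L : 'd (vrep i Y) (xcoord i p) ((X + X') p i) =
    'd (vrep i Y) (xcoord i p) (X p i) + 'd (vrep i Y) (xcoord i p) (X' p i).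
  exact: linearD.
exact (sub_split L E).
Qed.

Lemma bracketDr X Y Y' : vfield X -> vfield Y -> vfield Y' ->
  bracket X (Y + Y') = bracket X Y + bracket X Y'.
Proof.
move=> vX vY vY'.
rewrite (bracketC X (Y + Y')) (bracketC X Y) (bracketC X Y').
by rewrite (bracketDl vY vY' vX) opprD.
Qed.

Lemma bracketBl X X' Y : vfield X -> vfield X' -> vfield Y ->
  bracket (X - X') Y = bracket X Y - bracket X' Y.
Proof.
move=> vX vX' vY; have := bracketDl (vfieldB vX vX') vX' vY.
by rewrite subrK => ->; rewrite addrK.
Qed.

Lemma bracketBr X Y Y' : vfield X -> vfield Y -> vfield Y' ->
  bracket X (Y - Y') = bracket X Y - bracket X Y'.
Proof.
move=> vX vY vY'; have := bracketDr vX (vfieldB vY vY') vY'.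
by rewrite subrK => ->; rewrite addrK.
Qed.

Lemma eq_vbracket i (X X' Y Y' : 'rV[R]_m -> 'rV[R]_m) p : dom i p ->
  {in xcoord i @` dom i, X =1 X'} -> {in xcoord i @` dom i, Y =1 Y'} ->
  Cinf (xcoord i @` dom i) X -> Cinf (xcoord i @` dom i) Y ->
  vbracket X Y (xcoord i p) = vbracket X' Y' (xcoord i p).
Proof.
move=> dp XX YY cX cY; have oU := chart_open i; have Up := chart_image dp.
set z := xcoord i p.
have XE : X z = X' z by apply: XX; rewrite inE.
have YE : Y z = Y' z by apply: YY; rewrite inE.
have EY := open_eq_diff (X z) oU YY Up (Cinf_differentiable cY Up).
have EX := open_eq_diff (Y z) oU XX Up (Cinf_differentiable cX Up).
exact (f_equal2 (fun a b => a - b) (etrans EY (f_equal ('d Y' z) XE))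
  (etrans EX (f_equal ('d X' z) YE))).
Qed.

Lemma bracket_jacobi X Y Z : vfield X -> vfield Y -> vfield Z ->
  bracket X (bracket Y Z) + bracket Y (bracket Z X) + bracket Z (bracket X Y) = 0.
Proof.
move=> vX vY vZ; apply/funext => p.
have [i dp] := atlas_cover sA p.
have vB (U V : T -> tvec A) := @vfield_bracket U V.
apply: (tangent1_eq dp).
- apply: tangentD; last exact: (proj1 (vB _ _ vZ (vB _ _ vX vY))).
  apply: tangentD; last exact: (proj1 (vB _ _ vY (vB _ _ vZ vX))).
  exact: (proj1 (vB _ _ vX (vB _ _ vY vZ))).
- by split=> // j k _ _; rewrite -[RHS]/('d _ _ (0 : 'rV[R]_m)) linear0.
rewrite -[LHS]/(bracket X (bracket Y Z) p i + bracket Y (bracket Z X) p i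
    + bracket Z (bracket X Y) p i) !bracketE //.
have E (U V W : T -> tvec A) : vfield U -> vfield V -> vfield W ->
    vbracket (vrep i U) (vrep i (bracket V W)) (xcoord i p) =
    vbracket (vrep i U) (vbracket (vrep i V) (vrep i W)) (xcoord i p).
  move=> vU vV vW; apply: eq_vbracket => //.
  - by move=> z; rewrite inE => Uz; exact: vrep_bracket.
  - exact: vfield_smooth.
  - exact: (vfield_smooth i (vB _ _ vV vW)).
rewrite (E X Y Z) // (E Y Z X) // (E Z X Y) //.
exact: (vbracket_jacobi (chart_open i) (vfield_smooth i vX) (vfield_smooth i vY)
  (vfield_smooth i vZ) (chart_image dp)).
Qed.

Lemma rep_lie i Y (f : T -> R) z : vfield Y -> smooth A (f : _ -> R^o) ->
  (xcoord i @` dom i) z ->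
  rep i (lie Y f : T -> R^o) z = 'd (rep i (f : T -> R^o)) z (vrep i Y z).
Proof.
move=> vY sf [p dp <-]; rewrite repE // (lieE (proj1 vY p) sf dp).
by rewrite vrepE.
Qed.

Lemma smooth_lie X (f : T -> R) : vfield X -> smooth A (f : _ -> R^o) ->
  smooth A (lie X f : _ -> R^o).
Proof.
move=> vX sf i; have oU := chart_open i.
apply: (eq_Cinf oU _ (Cinf_dfield oU (sf i) (vfield_smooth i vX))) => z.
by rewrite inE => Uz; rewrite rep_lie.
Qed.

(** Serves to show that the curvature of a metric connection is skew. *)
Lemma lie_bracket X Y (f : T -> R) p : vfield X -> vfield Y ->
  smooth A (f : _ -> R^o) ->
  lie (bracket X Y) f p = lie X (lie Y f) p - lie Y (lie X f) p.
Proof.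
move=> vX vY sf; have [i dp] := atlas_cover sA p.
have oU := chart_open i; have Up := chart_image dp.
rewrite (lieE (proj1 (vfield_bracket vX vY) p) sf dp) bracketE //.
rewrite -(diff_comm_field oU (sf i) (vfield_smooth i vX) (vfield_smooth i vY) Up).
have E (Z V : T -> tvec A) : vfield Z -> vfield V -> lie Z (lie V f) p =
    'd (fun y => 'd (rep i (f : T -> R^o)) y (vrep i V y) : R^o) (xcoord i p) (vrep i Z (xcoord i p)).
  move=> vZ vV; rewrite (lieE (proj1 vZ p) (smooth_lie vV sf) dp) (vrepE Z dp).
  apply: (open_eq_diff _ oU) => //.
  - by move=> z; rewrite inE => Uz; rewrite rep_lie.
  - exact: (Cinf_differentiable (smooth_lie vV sf i) Up).
by rewrite (E X Y) // (E Y X).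
Qed.

Lemma lieD X (f g : T -> R) p : tangent p (X p) ->
  smooth A (f : _ -> R^o) -> smooth A (g : _ -> R^o) ->
  lie X (fun q => f q + g q) p = lie X f p + lie X g p.
Proof.
move=> tX sf sg; have [i dp] := atlas_cover sA p.
have oU := chart_open i; have Up := chart_image dp.
have E : {in xcoord i @` dom i, rep i (f : T -> R^o) + rep i (g : T -> R^o) =1
    rep i ((fun q => f q + g q) : T -> R^o)}.
  by move=> z; rewrite inE => -[q dq <-]; rewrite -[LHS]/(_ + _) !repE.
have sfg : smooth A ((fun q => f q + g q) : _ -> R^o).
  move=> j; apply: (eq_Cinf (chart_open j) _ (CinfD (chart_open j) (sf j) (sg j))).
  by move=> z; rewrite inE => -[q dq <-]; rewrite !repE.
rewrite (lieE tX sfg dp) (lieE tX sf dp) (lieE tX sg dp).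
have df := Cinf_differentiable (sf i) Up; have dg := Cinf_differentiable (sg i) Up.
have H := f_equal (fun h : _ -> R^o => h (X p i)) (diffD df dg).
rewrite -[RHS]H; apply/esym; apply: (open_eq_diff _ oU E Up).
exact: differentiableD.
Qed.

End SmoothAtlas.
Arguments chart_open {R T m A} sA i.

(** * The bundle of nonzero tangent vectors *)

Lemma base_smooth_atlas (R : realType) (M : topologicalType) (n : nat)
    (A : atlas R M n) : smooth_manifold A -> smooth_atlas A.
Proof.
move=> hA; split.
- exact: manifold_cover hA.
- exact: manifold_coord_inj hA.
- move=> i j; apply: (manifold_coord_open hA); last by move=> p [].
  by apply: openI; exact: (manifold_dom_open hA).
- exact: manifold_transition hA.
Qed.

Section SlitAtlas.
Context {R : realType} {M : Type} {n : nat} {A : atlas R M n}.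
Hypothesis sA : smooth_atlas A.
Implicit Types (i j : chart A) (p : M) (u : slit A).

Lemma diff_transition_id i p y : dom i p ->
  'd (rep i (xcoord i)) (xcoord i p) y = y.
Proof.
move=> dp; have -> : y = 'd id (xcoord i p) y.
  exact (esym (f_equal (fun g : 'rV[R]_n -> 'rV[R]_n => g y)
    (@diff_val _ _ _ _ _ _ _ (is_diff_id (xcoord i p))))).
rewrite -[in RHS](f_equal (fun g : 'rV[R]_n -> 'rV[R]_n => g y)
    (@diff_val _ _ _ _ _ _ _ (is_diff_id (xcoord i p)))).
apply: (open_eq_diff _ (chart_open sA i)).
- by move=> z; rewrite inE => -[q dq <-]; rewrite repE.
- exact: chart_image.
- exact: differentiable_transition.
Qed.

(** The components are transported by the Jacobians from chart [i]; their compatibility on overlaps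
    is the chain rule. *)
Lemma exists_tangent i p (y : 'rV[R]_n) : dom i p ->
  exists2 v : tvec A, tangent p v & v i = y.
Proof.
move=> dp; exists (fun j => if pselect (dom j p) then
   'd (rep i (xcoord j)) (xcoord i p) y else 0); last first.
  by case: pselect => // ?; exact: diff_transition_id.
split=> [j ndp|j k dj dk]; first by case: pselect.
case: pselect => // dk'; case: pselect => // dj'.
exact (diff_rep_change sA y dp dj (differentiable_transition sA dj dk)).
Qed.

Lemma slit_tangent u : tangent (base u) (sval u).2.
Proof. by case: u => -[p v] []. Qed.

Lemma slit_neq0 u i : dom i (base u) -> (sval u).2 i != 0.
Proof.
move=> dp; apply/eqP => v0; move: dp v0; case: u => -[p v] [/= tv nv]; rewrite /base /= => dp v0.
apply: nv; apply: (tangent1_eq dp tv _ v0).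
by split=> // j k _ _; rewrite -[RHS]/('d _ _ (0 : 'rV[R]_n)) linear0.
Qed.

Lemma slit_inj u v i : dom i (base u) -> dom i (base v) ->
  xcoord (a := slit_atlas A) i u = xcoord (a := slit_atlas A) i v -> u = v.
Proof.
case: u v => -[p v] [/= tv nv] [[q w] [/= tw nw]]; rewrite /base /= => dp dq.
move=> /eq_row_mx[pq vw].
have {}pq : p = q by apply: (atlas_inj sA) pq; rewrite inE.
subst q; have {}vw : v = w by exact: (tangent1_eq dp tv tw vw).
by subst w; congr exist; exact: Prop_irrelevance.
Qed.

Lemma slit_image i j :
  xcoord (a := slit_atlas A) i @` (dom (a := slit_atlas A) i `&` dom (a := slit_atlas A) j) =
  (lsubmx @^-1` (xcoord i @` (dom i `&` dom j))) `&` (rsubmx @^-1` [set~ 0]).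
Proof.
apply/seteqP; split=> z /=.
  move=> [u [di dj] <-] /=; rewrite row_mxKl row_mxKr; split.
    by exists (base u).
  by apply/eqP; exact: slit_neq0.
move=> [[p [di dj] zp] z0].
have [v tv vi] := exists_tangent (rsubmx z) di.
have vn0 : v <> 0 by move=> v0; apply: z0; rewrite -vi v0.
exists (exist _ (p, v) (conj tv vn0)); first by split.
by rewrite /= vi zp hsubmxK.
Qed.

Lemma open_slit_image i j : open
  ((lsubmx @^-1` (xcoord i @` (dom i `&` dom j))) `&` (rsubmx @^-1` [set~ 0])
   : set 'rV[R]_(n + n)).
Proof.
apply: openI.
  apply: open_comp; last exact: atlas_open.
  by move=> z _; exact: continuous_lsubmx.
apply: open_comp; first by move=> z _; exact: continuous_rsubmx.
apply: closed_openC; apply: accessible_closed_set1.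
exact: hausdorff_accessible (@norm_hausdorff _ _).
Qed.

(** The change of the induced charts by formula. Unlike [rep], it also makes sense for y = 0, hence
    is smooth on the whole cylinder over the overlap. *)
Definition slit_transition i j (z : 'rV[R]_(n + n)) : 'rV[R]_(n + n) :=
  row_mx (rep i (xcoord j) (lsubmx z))
         ('d (rep i (xcoord j)) (lsubmx z) (rsubmx z)).

Lemma slit_repE (W : normedModType R) (F : slit A -> W) i u : dom i (base u) ->
  rep (A := slit_atlas A) i F (xcoord (a := slit_atlas A) i u) = F u.
Proof.
move=> dp; rewrite /rep; set S := (X in xget 0 X).
have : S (xget 0 S) by apply: xgetPex; exists (F u); exists u.
by case=> v [dv /= xv] <-; congr F; apply: slit_inj xv.
Qed.

Lemma rep_slit_transition i j z :
  (xcoord (a := slit_atlas A) i @` (dom (a := slit_atlas A) i `&` dom (a := slit_atlas A) j)) z ->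
  rep (A := slit_atlas A) i (xcoord (a := slit_atlas A) j) z = slit_transition i j z.
Proof.
move=> [u [di dj] <-]; rewrite slit_repE //.
rewrite /slit_transition /= row_mxKl row_mxKr repE //.
by congr row_mx; exact: (proj2 (slit_tangent u)).
Qed.

Lemma Cinf_row_mx (V : normedModType R) (U : set V) (f g : V -> 'rV[R]_n) :
  open U -> Cinf U f -> Cinf U g -> Cinf U (fun z => row_mx (f z) (g z)).
Proof.
move=> oU /(Cinf_rV _ oU) cf /(Cinf_rV _ oU) cg; apply/(Cinf_rV _ oU) => k.
have [h ->|h ->] := split_ordP k.
- by apply: eq_Cinf (cf h) => // z _; rewrite row_mxEl.
- by apply: eq_Cinf (cg h) => // z _; rewrite row_mxEr.
Qed.

Lemma Cinf_rsubmx (U : set 'rV[R]_(n + n)) :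
  Cinf U (rsubmx : 'rV[R]_(n + n) -> 'rV[R]_n).
Proof. exact (Cinf_linear U (l := rsubmx) (@continuous_rsubmx _ _ _ _)). Qed.

Lemma Cinf_comp_lsubmx (W : normedModType R) (U : set 'rV[R]_n) (f : 'rV[R]_n -> W) :
  Cinf U f -> Cinf (lsubmx @^-1` U) (fun z : 'rV[R]_(n + n) => f (lsubmx z)).
Proof. exact (@Cinf_pre_linear _ _ _ _ (lsubmx : {linear 'rV[R]_(n + n) -> _}) _ _ (@continuous_lsubmx _ _ _ _)). Qed.

Lemma Cinf_slit_transition i j :
  Cinf (lsubmx @^-1` (xcoord i @` (dom i `&` dom j))) (slit_transition i j).
Proof.
set U := xcoord i @` (dom i `&` dom j).
have oU : open U := atlas_open sA i j.
have oU' : open (lsubmx @^-1` U : set 'rV[R]_(n + n)).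
  by apply: open_comp => // z _; exact: continuous_lsubmx.
have ct : Cinf U (rep i (xcoord j)) := atlas_transition sA i j.
apply: Cinf_row_mx => //; first exact: Cinf_comp_lsubmx.
apply/(Cinf_rV _ oU') => k.
have ctk := (Cinf_rV _ oU).1 ct k.
(* The fibre part has components sum_h y^h d_h phi^k, where phi is the transition map of the
   base. *)
apply: (@eq_Cinf _ _ _ _ (fun z : 'rV[R]_(n + n) => \sum_h rsubmx z 0 h *
   'D_(delta_mx 0 h) (fun y => rep i (xcoord j) y 0 k : R^o) (lsubmx z) : R^o)) => //.
  move=> z; rewrite inE => Uz.
  rewrite (dfield_rV (fun=> rsubmx z) k oU ct Uz).
  exact (esym (dfield_coord (fun=> rsubmx z) ctk Uz)).
apply: Cinf_sum => // h; apply: CinfM => //.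
  by have := (Cinf_rV _ oU').1 (@Cinf_rsubmx _) h.
exact (Cinf_comp_lsubmx (Cinf_derive _ ctk)).
Qed.

Lemma slit_smooth_atlas : smooth_atlas (slit_atlas A).
Proof.
split.
- by move=> u; have [i di] := atlas_cover sA (base u); exists i.
- by move=> i u v; rewrite !inE => du dv; exact: slit_inj.
- by move=> i j; rewrite slit_image; exact: open_slit_image.
- move=> i j; rewrite slit_image.
  apply: (@eq_Cinf _ _ _ _ (slit_transition i j)); first exact: open_slit_image.
    by move=> z; rewrite inE -slit_image => Uz; rewrite rep_slit_transition.
  apply: Cinf_subset (@Cinf_slit_transition i j).
  by move=> z [].
Qed.

End SlitAtlas.

(** * Pi-vector fields, the projection rho and the vertical lift *)

Section PiFields.
Context {R : realType} {M : Type} {n : nat} {A : atlas R M n}.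
Hypothesis sA : smooth_atlas A.
Local Notation SA := (slit_atlas A).
Local Notation sS := (slit_smooth_atlas sA).
Implicit Types (i j : chart A) (u : slit A) (X Y : slit A -> tvec A)
  (V W : slit A -> stvec A).

Definition slit_coord i u : 'rV[R]_(n + n) := xcoord (a := SA) i u.
Definition slit_chart i : set 'rV[R]_(n + n) := xcoord (a := SA) i @` dom (a := SA) i.
Definition prep i X : 'rV[R]_(n + n) -> 'rV[R]_n :=
  rep (A := SA) i (fun u => X u i).

Lemma slit_chart_open i : open (slit_chart i).
Proof. exact: (chart_open sS i). Qed.
Arguments slit_chart_open : clear implicits.

Lemma slit_coord_chart i u : dom i (base u) -> slit_chart i (slit_coord i u).
Proof. by move=> di; exists u. Qed.

Lemma prepE i X u : dom i (base u) -> prep i X (slit_coord i u) = X u i.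
Proof. by move=> di; rewrite /prep slit_repE. Qed.

Lemma pivfield_smooth i X : pivfield X -> Cinf (slit_chart i) (prep i X).
Proof. by move=> pX; exact (proj2 pX i). Qed.

Lemma pivfield_of X : (forall u, tangent (base u) (X u)) ->
  (forall i, exists2 f, Cinf (slit_chart i) f &
     forall u, dom i (base u) -> X u i = f (slit_coord i u)) -> pivfield X.
Proof.
move=> tX sX; split=> // i; have [f cf Xf] := sX i.
apply: (eq_Cinf (slit_chart_open i) _ cf) => z; rewrite inE => -[u du <-].
by rewrite slit_repE // Xf.
Qed.

Lemma pivfieldD X Y : pivfield X -> pivfield Y -> pivfield (X + Y : slit A -> tvec A).
Proof.
move=> pX pY; apply: pivfield_of => [u|i].
  by apply: tangentD; [exact: (proj1 pX)|exact: (proj1 pY)].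
exists (fun z => prep i X z + prep i Y z).
  by apply: CinfD; [exact: slit_chart_open|exact: pivfield_smooth|exact: pivfield_smooth].
by move=> u du; rewrite !prepE.
Qed.

Lemma pivfieldN X : pivfield X -> pivfield (- X : slit A -> tvec A).
Proof.
move=> pX; apply: pivfield_of => [u|i]; first by apply: tangentN; exact: (proj1 pX).
exists (fun z => - prep i X z).
  by apply: Cinf_opp; [exact: slit_chart_open|exact: pivfield_smooth].
by move=> u du; rewrite !prepE.
Qed.

Lemma pivfieldB X Y : pivfield X -> pivfield Y -> pivfield (X - Y : slit A -> tvec A).
Proof. by move=> pX pY; apply: pivfieldD => //; exact: pivfieldN. Qed.

Lemma tangent0 (T : Type) (m : nat) (B : atlas R T m) p : tangent (A := B) p 0.
Proof.
split=> // i j _ _; rewrite -[LHS]/(0 : 'rV[R]_m) -[(0 : tvec B) i]/(0 : 'rV[R]_m).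
by apply/esym; exact: linear0.
Qed.

Lemma pivfield0 : pivfield (0 : slit A -> tvec A).
Proof.
apply: pivfield_of => [u|i]; first exact: tangent0.
by exists (cst 0) => //; exact: Cinf_cst.
Qed.

Lemma pivfield_eta : pivfield (etabar (A := A)).
Proof.
apply: pivfield_of => [u|i]; first exact: slit_tangent.
exists rsubmx; first exact: Cinf_rsubmx.
by move=> u du; rewrite /= row_mxKr.
Qed.

(** Differentiation of the identity saying that the transition maps commute with the projection to
    the base. *)
Lemma lsubmx_slit_transition i j (z : 'rV[R]_(n + n)) w :
  (lsubmx @^-1` (xcoord i @` (dom i `&` dom j))) z ->
  lsubmx ('d (slit_transition i j) z w) =
  'd (rep i (xcoord j)) (lsubmx z) (lsubmx w).
Proof.
move=> Uz; set phi := rep i (xcoord j).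
have lc : continuous (lsubmx : 'rV[R]_(n + n) -> 'rV[R]_n) by exact: continuous_lsubmx.
have dl x : differentiable (lsubmx : 'rV[R]_(n + n) -> 'rV[R]_n) x.
  exact: differentiable_lsubmx.
have dphi : differentiable phi (lsubmx z).
  exact: (Cinf_differentiable (atlas_transition sA i j)).
have dPhi : differentiable (slit_transition i j) z.
  exact: (Cinf_differentiable (Cinf_slit_transition sA i j)).
have lE x y : 'd (lsubmx : 'rV[R]_(n + n) -> 'rV[R]_n) x y = lsubmx y.
  exact (f_equal (fun g : _ -> 'rV[R]_n => g y) (diff_lin x lc)).
have E1 := f_equal (fun g : _ -> 'rV[R]_n => g w) (diff_comp dPhi (dl _)).
have E2 := f_equal (fun g : _ -> 'rV[R]_n => g w) (diff_comp (dl z) dphi).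
have E : lsubmx \o slit_transition i j = phi \o lsubmx.
  by apply/funext => y; rewrite /= /slit_transition row_mxKl.
rewrite E in E1.
exact (etrans (esym (etrans E1 (lE _ _))) (etrans E2 (f_equal ('d phi (lsubmx z)) (lE _ _)))).
Qed.

(** The transition map is linear on each fibre, so [derive_affine] applies in vertical
    directions. *)
Lemma diff_slit_transition_vertical i j (z : 'rV[R]_(n + n)) b :
  (lsubmx @^-1` (xcoord i @` (dom i `&` dom j))) z ->
  'd (slit_transition i j) z (row_mx 0 b) =
  row_mx 0 ('d (rep i (xcoord j)) (lsubmx z) b).
Proof.
move=> Uz.
have dPhi : differentiable (slit_transition i j) z.
  exact: (Cinf_differentiable (Cinf_slit_transition sA i j)).
rewrite -(deriveE _ dPhi); apply: derive_affine => h.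
have l1 : lsubmx (h *: row_mx 0 b + z) = lsubmx z.
  by rewrite linearD linearZ /= row_mxKl scaler0 add0r.
have r1 : rsubmx (h *: row_mx 0 b + z) = h *: b + rsubmx z.
  by rewrite linearD linearZ /= row_mxKr.
rewrite /slit_transition l1 r1 scale_row_mx scaler0 add_row_mx addr0; congr row_mx.
exact (etrans (linearP _ h b (rsubmx z)) (addrC _ _)).
Qed.

Lemma tangent_slit u i j (w : stvec A) : tangent (A := SA) u w ->
  dom i (base u) -> dom j (base u) ->
  w j = 'd (slit_transition i j) (slit_coord i u) (w i).
Proof.
move=> tw di dj; have -> := proj2 tw i j di dj.
apply: (open_eq_diff _ (atlas_open sS i j)).
- by move=> z; rewrite inE => Uz; rewrite rep_slit_transition.
- by exists u.
- exact: (differentiable_transition sS (i := i) (j := j)).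
Qed.

Lemma slit_coord_overlap u i j : dom i (base u) -> dom j (base u) ->
  (lsubmx @^-1` (xcoord i @` (dom i `&` dom j))) (slit_coord i u).
Proof. by move=> di dj; rewrite /= row_mxKl; exists (base u). Qed.

Lemma lsubmx_slit_coord u i : lsubmx (slit_coord i u) = xcoord i (base u).
Proof. exact: row_mxKl. Qed.

Lemma tangent_rho u (w : stvec A) : tangent (A := SA) u w ->
  tangent (base u) (fun i => lsubmx (w i)).
Proof.
move=> tw; split=> [i nd|i j di dj].
  by rewrite (proj1 tw i nd); exact: linear0.
have -> := tangent_slit tw di dj.
rewrite lsubmx_slit_transition; last exact: slit_coord_overlap.
by rewrite lsubmx_slit_coord.
Qed.

Lemma tangent_vertical u (v : tvec A) : tangent (base u) v <->
  tangent (A := SA) u ((fun i => row_mx 0 (v i)) : stvec A).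
Proof.
have tE i j b : dom i (base u) -> dom j (base u) ->
    'd (rep (A := SA) i (xcoord (a := SA) j)) (slit_coord i u) (row_mx 0 b) =
    row_mx 0 ('d (rep i (xcoord j)) (xcoord i (base u)) b).
  move=> di dj; rewrite -lsubmx_slit_coord -diff_slit_transition_vertical.
    apply: (open_eq_diff _ (atlas_open sS i j)).
    - by move=> z; rewrite inE => Uz; rewrite rep_slit_transition.
    - by exists u.
    - exact: (differentiable_transition sS (i := i) (j := j)).
  exact: slit_coord_overlap.
split=> -[v0 tv]; split.
- by move=> i nd; rewrite v0 // row_mx0.
- by move=> i j di dj; rewrite (tv i j) // -tE.
- by move=> i nd; move/(congr1 rsubmx) : (v0 i nd); rewrite row_mxKr linear0.
- move=> i j di dj; have := tv i j di dj; rewrite (tE i j) //.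
  by move/(congr1 rsubmx); rewrite !row_mxKr.
Qed.

Lemma pivfield_rho V : vfield V -> pivfield (rho V).
Proof.
move=> vV; apply: pivfield_of => [u|i].
  exact: (tangent_rho (proj1 vV u)).
exists (fun z => lsubmx (vrep (A := SA) i V z)).
  have oU := slit_chart_open i; apply/(Cinf_rV _ oU) => k.
  have := (Cinf_rV _ oU).1 (vfield_smooth (A := SA) i vV) (lshift n k).
  by apply: eq_Cinf => // z _; rewrite mxE.
by move=> u du; rewrite (vrepE sS).
Qed.

Lemma vfield_vlift X : pivfield X -> vfield (vlift X).
Proof.
move=> pX; split=> [u|i].
  exact: ((tangent_vertical u (X u)).1 (proj1 pX u)).
have oU := slit_chart_open i.
apply: (@eq_Cinf _ _ _ _ (fun z => row_mx 0 (prep i X z))) => //.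
  by move=> z; rewrite inE => -[u du <-]; rewrite prepE // slit_repE.
by apply: Cinf_row_mx => //; [exact: (Cinf_cst (slit_chart i) 0)|exact: pivfield_smooth].
Qed.

(** Exactness at the middle of the sequence gamma, rho, for smooth fields. *)
Lemma exists_vlift V : vfield V -> rho V = 0 ->
  exists2 X, pivfield X & V = vlift X.
Proof.
move=> vV rV; pose X u i : 'rV[R]_n := rsubmx (V u i).
have VE : V = vlift X.
  apply/funext => u; apply/funext => i; rewrite -[LHS]hsubmxK /vlift /X.
  congr row_mx; exact (f_equal (fun F : slit A -> tvec A => F u i) rV).
exists X => //; apply: pivfield_of => [u|i].
  by apply/tangent_vertical; have := proj1 vV u; rewrite {1}VE.
exists (fun z => rsubmx (vrep (A := SA) i V z)).
  have oU := slit_chart_open i; apply/(Cinf_rV _ oU) => k.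
  have := (Cinf_rV _ oU).1 (vfield_smooth (A := SA) i vV) (rshift n k).
  by apply: eq_Cinf => // z _; rewrite mxE.
by move=> u du; rewrite (vrepE sS).
Qed.

Lemma rho_vlift X : rho (vlift X) = 0.
Proof. by apply/funext => u; apply/funext => i; rewrite /rho /vlift row_mxKl. Qed.

Lemma rhoD V W : rho (V + W) = rho V + rho W.
Proof. by apply/funext => u; apply/funext => i; exact: linearD. Qed.

Lemma rhoN V : rho (- V) = - rho V.
Proof. by apply/funext => u; apply/funext => i; exact: linearN. Qed.

Lemma vliftD X Y : vlift (X + Y) = vlift X + vlift Y.
Proof.
apply/funext => u; apply/funext => i; rewrite -[RHS]/(row_mx _ _ + row_mx _ _).
by rewrite add_row_mx addr0.
Qed.

(** As rho (gamma X) = 0, only the derivative of rho V along gamma X survives. The right side sees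
    [V] through [rho V] alone. *)
Lemma rho_bracket_vlift X V u i : pivfield X -> vfield V -> dom i (base u) ->
  rho (bracket (vlift X) V) u i =
  'd (prep i (rho V)) (slit_coord i u) (row_mx 0 (X u i)).
Proof.
move=> pX vV di; rewrite /rho /bracket linearB /=.
have oU := slit_chart_open i; have Uu := slit_coord_chart di.
have lc : continuous (lsubmx : 'rV[R]_(n + n) -> 'rV[R]_n) by exact: continuous_lsubmx.
have dl x : differentiable (lsubmx : 'rV[R]_(n + n) -> 'rV[R]_n) x.
  exact: differentiable_lsubmx.
have lE x y : 'd (lsubmx : 'rV[R]_(n + n) -> 'rV[R]_n) x y = lsubmx y.
  exact (f_equal (fun g : _ -> 'rV[R]_n => g y) (diff_lin x lc)).
have H W w : vfield W -> lsubmx ('d (vrep (A := SA) i W) (slit_coord i u) w) =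
    'd (prep i (rho W)) (slit_coord i u) w.
  move=> vW; have dW := vfield_differentiable (A := SA) (i := i) (p := u) vW di.
  have E := f_equal (fun g : _ -> 'rV[R]_n => g w) (diff_comp dW (dl _)).
  refine (etrans (esym (etrans E (lE _ _))) _).
  apply: (open_eq_diff _ oU) => //.
    by move=> z; rewrite inE => -[v dv <-]; rewrite prepE //= (vrepE sS).
  exact: differentiable_comp.
have E0 : 'd (prep i (rho (vlift X))) (slit_coord i u) (V u i) = 0.
  refine (etrans (open_eq_diff (g := cst (0 : 'rV[R]_n)) (V u i) oU _ Uu _) _).
  - by move=> z; rewrite inE => -[v dv <-]; rewrite prepE // rho_vlift.
  - exact (Cinf_differentiable (pivfield_smooth i (pivfield_rho (vfield_vlift pX))) Uu).
  - exact (f_equal (fun g : _ -> 'rV[R]_n => g (V u i)) (diff_cst _ _)).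
have sub0 (a b c : 'rV[R]_n) : a = b -> c = 0 -> a - c = b.
  by move=> -> ->; rewrite subr0.
exact (sub0 _ _ _ (H V (vlift X u i) vV) (etrans (H (vlift X) (V u i) (vfield_vlift pX)) E0)).
Qed.

End PiFields.
Arguments slit_chart_open {R M n A} sA i.

(** * Second derivatives in directions that vary with the point *)

Section HigherDerivatives.
Context {R : realType} {m : nat}.
Local Notation V := 'rV[R]_m.
Implicit Types (U : set V) (f : V -> R^o) (X Y Z : V -> V).

Lemma derive_coord U f (c z : V) : Cinf U f -> U z ->
  'D_c f z = \sum_k c 0 k * 'D_(delta_mx 0 k) f z.
Proof.
move=> cf Uz; rewrite -(Cinf_diffE _ cf Uz).
exact: (dfield_coord (fun=> c) cf Uz).
Qed.

Lemma derive_lin_comb U (F : 'I_m -> V -> R^o) (c b z : V) :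
  (forall k, Cinf U (F k)) -> U z ->
  'D_b (fun y => \sum_k c 0 k * F k y : R^o) z = \sum_k c 0 k * 'D_b (F k) z.
Proof.
move=> cF Uz; have dF k := Cinf_differentiable (cF k) Uz.
rewrite derive_sumE => [|k].
  by apply: eq_bigr => k _; exact: derive_cstM.
exact: (differentiableZ (c 0 k) (dF k)).
Qed.

Lemma derive2_coord U f (b c z : V) : open U -> Cinf U f -> U z ->
  'D_b ('D_c f) z = \sum_k c 0 k * 'D_b ('D_(delta_mx 0 k) f) z.
Proof.
move=> oU cf Uz.
have E : {in U, 'D_c f =1 (fun y => \sum_k c 0 k * 'D_(delta_mx 0 k) f y : R^o)}.
  by move=> y; rewrite inE => Uy; exact: derive_coord cf Uy.
have cfk k : Cinf U ('D_(delta_mx 0 k) f) by exact: Cinf_derive.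
exact (etrans (open_eq_derive b oU E Uz) (derive_lin_comb c b cfk Uz)).
Qed.

Lemma derive3_coord U f (a b c z : V) : open U -> Cinf U f -> U z ->
  'D_a ('D_b ('D_c f)) z = \sum_k c 0 k * 'D_a ('D_b ('D_(delta_mx 0 k) f)) z.
Proof.
move=> oU cf Uz.
have E : {in U, 'D_b ('D_c f) =1 (fun y => \sum_k c 0 k * 'D_b ('D_(delta_mx 0 k) f) y : R^o)}.
  by move=> y; rewrite inE => Uy; exact: derive2_coord oU cf Uy.
have cfk k : Cinf U ('D_b ('D_(delta_mx 0 k) f)) by do 2!apply: Cinf_derive.
exact (etrans (open_eq_derive a oU E Uz) (derive_lin_comb c a cfk Uz)).
Qed.

Lemma Cinf_derive2 U f X Y : open U -> Cinf U f -> Cinf U X -> Cinf U Y ->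
  Cinf U (fun z => 'D_(X z) ('D_(Y z) f) z : R^o).
Proof.
move=> oU cf cX cY.
apply: (@eq_Cinf _ _ _ _ (fun z => \sum_k Y z 0 k * 'd ('D_(delta_mx 0 k) f) z (X z) : R^o)) => //.
  move=> z; rewrite inE => Uz; rewrite (derive2_coord _ _ oU cf Uz).
  by apply: eq_bigr => k _; rewrite (Cinf_diffE _ (Cinf_derive _ cf) Uz).
apply: Cinf_sum => // k; apply: CinfM => //; first exact: ((Cinf_rV _ oU).1 cY k).
by apply: Cinf_dfield => //; exact: Cinf_derive.
Qed.

Lemma product_rule_sum (y w p q r r' t u v : R) :
  w = p + q -> t = u -> r = r' -> q = v -> y * w + r * t = y * p + y * v + u * r'.
Proof. by move=> -> -> -> ->; rewrite mulrDr [r' * _]mulrC. Qed.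

(** The product rule for a Hessian evaluated on two fields: a third derivative with both directions
    frozen at [z], then one term for the variation of each field. It will be applied to g(Y,Z). *)
Lemma diff_derive2 U f X Y z a : open U -> Cinf U f -> Cinf U X -> Cinf U Y -> U z ->
  'd (fun y => 'D_(X y) ('D_(Y y) f) y : R^o) z a =
  'D_a ('D_(X z) ('D_(Y z) f)) z + 'D_('d X z a) ('D_(Y z) f) z
    + 'D_(X z) ('D_('d Y z a) f) z.
Proof.
move=> oU cf cX cY Uz.
have cfk k : Cinf U ('D_(delta_mx 0 k) f) by exact: Cinf_derive.
have cYk k : Cinf U (fun y => Y y 0 k : R^o) by exact: ((Cinf_rV _ oU).1 cY k).
have cG k : Cinf U (fun y => 'd ('D_(delta_mx 0 k) f) y (X y) : R^o).
  exact: Cinf_dfield.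
have cH k := CinfM oU (cYk k) (cG k).
have E : {in U, (fun y => 'D_(X y) ('D_(Y y) f) y : R^o) =1
    (fun y => \sum_k Y y 0 k * 'd ('D_(delta_mx 0 k) f) y (X y) : R^o)}.
  move=> y; rewrite inE => Uy; refine (etrans (derive2_coord _ _ oU cf Uy) _).
  by apply: eq_bigr => k _; congr (_ * _); rewrite -(Cinf_diffE _ (cfk k) Uy).
have dH k := Cinf_differentiable (cH k) Uz.
refine (etrans (Cinf_diffE a (Cinf_derive2 oU cf cX cY) Uz) _).
refine (etrans (open_eq_derive a oU E Uz) _).
refine (etrans (derive_sumE _ a dH) _).
have E3 := derive3_coord a (X z) (Y z) oU cf Uz.
have E2 := derive2_coord ('d X z a) (Y z) oU cf Uz.
have E1 := derive2_coord (X z) ('d Y z a) oU cf Uz.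
refine (etrans _ (esym (f_equal2 (fun p q : R => p + q) (f_equal2 (fun p q : R => p + q) E3 E2) E1))).
rewrite -!big_split; apply: eq_bigr => k _.
refine (etrans (derive_mul a (Cinf_differentiable (cYk k) Uz) (Cinf_differentiable (cG k) Uz)) _).
have D1 := derive_dfield a oU (cfk k) cX Uz.
have D2 : 'D_a (fun y => Y y 0 k : R^o) z = 'd Y z a 0 k.
  by rewrite (Cinf_diffE _ cY Uz) derive_rV //; exact: (Cinf_differentiable cY Uz).
have D3 : 'd ('D_(delta_mx 0 k) f) z (X z) = 'D_(X z) ('D_(delta_mx 0 k) f) z.
  exact: (Cinf_diffE _ (cfk k) Uz).
have D4 : 'd ('D_(delta_mx 0 k) f) z ('D_a X z) = 'D_('d X z a) ('D_(delta_mx 0 k) f) z.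
  by rewrite -(Cinf_diffE _ (cfk k) Uz) (Cinf_diffE _ cX Uz).
exact (product_rule_sum _ D1 D2 D3 D4).
Qed.

End HigherDerivatives.

(** * The fundamental tensor and the Cartan tensor *)

Section FundamentalTensor.
Context {R : realType} {M : Type} {n : nat} {A : atlas R M n}.
Hypothesis sA : smooth_atlas A.
Variables (L : M -> tvec A -> R).
Hypothesis hL : finsler L.
Local Notation SA := (slit_atlas A).
Local Notation sS := (slit_smooth_atlas sA).
Local Notation g := (fundamental_tensor L).
Implicit Types (i j : chart A) (u : slit A) (X Y Z : slit A -> tvec A)
  (V W : slit A -> stvec A).

(** L^2 in the induced coordinates (x, y). Half its Hessian in y is the fundamental tensor. *)
Definition energy i : 'rV[R]_(n + n) -> R^o :=
  rep (A := SA) i (fun u => (L (base u) (sval u).2) ^+ 2 : R^o).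

Definition vert (b : 'rV[R]_n) : 'rV[R]_(n + n) := row_mx 0 b.

Lemma vertD b c : vert (b + c) = vert b + vert c.
Proof. by rewrite /vert add_row_mx addr0. Qed.

Lemma Cinf_energy i : Cinf (slit_chart i) (energy i).
Proof.
have cL := finsler_smooth hL i; have oU := slit_chart_open sA i.
apply: (eq_Cinf oU _ (CinfM oU cL cL)) => z; rewrite inE => -[u du <-].
by rewrite /energy !slit_repE // expr2.
Qed.

Lemma energyE i u (x : tvec A) y : dom i (base u) -> slit_chart i y ->
  tangent (base u) x -> lsubmx y = xcoord i (base u) -> rsubmx y = x i ->
  energy i y = L (base u) x ^+ 2.
Proof.
move=> du [u' /= du' <-] tx; rewrite row_mxKl row_mxKr => bb xx.
rewrite /energy slit_repE //.
have bE : base u' = base u by apply: (atlas_inj sA) bb; rewrite inE.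
have tx' : tangent (base u) (sval u').2 by rewrite -bE; exact: slit_tangent.
by rewrite bE (tangent1_eq du tx' tx xx).
Qed.

Lemma lsubmx_line (z : 'rV[R]_(n + n)) t b : lsubmx (z + t *: vert b) = lsubmx z.
Proof. by rewrite linearD linearZ /= row_mxKl scaler0 addr0. Qed.

Lemma rsubmx_line (z : 'rV[R]_(n + n)) t b :
  rsubmx (z + t *: vert b) = rsubmx z + t *: b.
Proof. by rewrite linearD linearZ /= row_mxKr. Qed.

Lemma rsubmx_slit_coord u i : rsubmx (slit_coord i u) = (sval u).2 i.
Proof. by rewrite /slit_coord /= row_mxKr. Qed.

(** Both one-variable derivatives are taken at 0, so only small parameters matter. For these the
    vector stays nonzero and the derivatives are those of [energy] along lines in the fibre. *)
Lemma fundamental_tensorE i u (v w : tvec A) : dom i (base u) ->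
  tangent (base u) v -> tangent (base u) w ->
  g u v w = 2^-1 * 'D_(vert (v i)) ('D_(vert (w i)) (energy i)) (slit_coord i u).
Proof.
move=> du tv tw; refine (f_equal (fun r : R => 2^-1 * r) _).
have oU := slit_chart_open sA i; have Uu := slit_coord_chart du.
rewrite derive1E -(derive_line _ _ (vert (v i))); apply: near_eq_derive.
have N := near_line (vert (v i)) oU Uu.
apply: filterS N => s Us.
rewrite derive1E -(derive_line _ _ (vert (w i))); apply: near_eq_derive.
apply: filterS (near_line (vert (w i)) oU Us) => t Ut.
apply/esym; apply: energyE => //.
- exact: (tangentD (tangentD (slit_tangent u) (tangentZ s tv)) (tangentZ t tw)).
- by rewrite !lsubmx_line lsubmx_slit_coord.
- by rewrite !rsubmx_line rsubmx_slit_coord.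
Qed.

Lemma ftC u (v w : tvec A) : tangent (base u) v -> tangent (base u) w ->
  g u v w = g u w v.
Proof.
move=> tv tw; have [i du] := atlas_cover sA (base u).
rewrite (fundamental_tensorE du tv tw) (fundamental_tensorE du tw tv).
refine (f_equal (fun r : R => 2^-1 * r) _).
exact: (derive_comm _ _ (slit_chart_open sA i) (Cinf_energy i) (slit_coord_chart du)).
Qed.

Lemma ftDl u (v v' w : tvec A) : tangent (base u) v -> tangent (base u) v' ->
  tangent (base u) w -> g u (v + v') w = g u v w + g u v' w.
Proof.
move=> tv tv' tw; have [i du] := atlas_cover sA (base u).
rewrite (fundamental_tensorE du (tangentD tv tv') tw).
rewrite (fundamental_tensorE du tv tw) (fundamental_tensorE du tv' tw) -mulrDr.
refine (f_equal (fun r : R => 2^-1 * r) _).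
rewrite -[(v + v') i]/(v i + v' i) vertD; apply: derive_add_vec.
exact: (Cinf_differentiable (Cinf_derive _ (Cinf_energy i)) (slit_coord_chart du)).
Qed.

Lemma ft0l u (w : tvec A) : tangent (base u) w -> g u 0 w = 0.
Proof.
move=> tw; have := ftDl (tangent0 _ (base u)) (tangent0 _ (base u)) tw.
by rewrite addr0 => /eqP; rewrite -subr_eq0 opprD addrA subrr sub0r oppr_eq0 => /eqP.
Qed.

Lemma ftNl u (v w : tvec A) : tangent (base u) v -> tangent (base u) w ->
  g u (- v) w = - g u v w.
Proof.
move=> tv tw; have := ftDl tv (tangentN tv) tw.
by rewrite subrr ft0l // => /eqP; rewrite eq_sym addrC addr_eq0 => /eqP.
Qed.

Lemma ftBl u (v v' w : tvec A) : tangent (base u) v -> tangent (base u) v' ->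
  tangent (base u) w -> g u (v - v') w = g u v w - g u v' w.
Proof.
move=> tv tv' tw; rewrite (ftDl tv (tangentN tv') tw).
by rewrite (ftNl tv' tw).
Qed.

(** Stated with the single test vector [v - w], so that for fields [X] and [Y] the test vector is a
    value of the smooth field [X - Y]. *)
Lemma ft_nondegenerate u (v w : tvec A) : tangent (base u) v ->
  tangent (base u) w -> g u v (v - w) = g u w (v - w) -> v = w.
Proof.
move=> tv tw vw; have tvw : tangent (base u) (v - w).
  exact: (tangentD tv (tangentN tw)).
apply/eqP; rewrite -subr_eq0; apply/eqP; apply: contrapT => n0.
have := finsler_convex hL tvw n0.
by rewrite (ftBl tv tw tvw) vw subrr ltxx.
Qed.

Definition ftfield X Y : slit A -> R := fun u => g u (X u) (Y u).

Lemma Cinf_vert i X : pivfield X -> Cinf (slit_chart i) (fun z => vert (prep i X z)).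
Proof.
move=> pX; have oU := slit_chart_open sA i.
by apply: Cinf_row_mx => //; [exact: (Cinf_cst (slit_chart i) 0)|exact: pivfield_smooth].
Qed.

Definition ftchart i X Y : 'rV[R]_(n + n) -> R^o := fun z =>
  'D_(vert (prep i X z)) ('D_(vert (prep i Y z)) (energy i)) z.

Lemma Cinf_ftchart i X Y : pivfield X -> pivfield Y ->
  Cinf (slit_chart i) (ftchart i X Y).
Proof.
move=> pX pY.
exact (Cinf_derive2 (slit_chart_open sA i) (Cinf_energy i) (Cinf_vert i pX) (Cinf_vert i pY)).
Qed.

Lemma rep_ftfield i X Y : pivfield X -> pivfield Y ->
  {in slit_chart i, (fun z => 2^-1 * ftchart i X Y z : R^o) =1
    rep (A := SA) i (ftfield X Y : _ -> R^o)}.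
Proof.
move=> pX pY z; rewrite inE => -[u du <-].
refine (etrans _ (esym (slit_repE sA (ftfield X Y : _ -> R^o) du))).
refine (etrans _ (esym (fundamental_tensorE du (proj1 pX u) (proj1 pY u)))).
by rewrite /ftchart (prepE sA X du) (prepE sA Y du).
Qed.

Lemma smooth_ftfield X Y : pivfield X -> pivfield Y ->
  smooth SA (ftfield X Y : _ -> R^o).
Proof.
move=> pX pY i; have oU := slit_chart_open sA i.
exact (eq_Cinf oU (@rep_ftfield i X Y pX pY)
  (CinfM oU (Cinf_cst _ (2^-1 : R^o)) (Cinf_ftchart i pX pY))).
Qed.

(* Components of twice the Cartan tensor. *)
Definition ctens i u (a b c : 'rV[R]_n) : R :=
  2^-1 * 'D_(vert a) ('D_(vert b) ('D_(vert c) (energy i))) (slit_coord i u).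

Lemma ctensC12 i u a b c : dom i (base u) -> ctens i u a b c = ctens i u b a c.
Proof.
move=> du; refine (f_equal (fun r : R => 2^-1 * r) _).
exact: (derive_comm _ _ (slit_chart_open sA i) (Cinf_derive _ (Cinf_energy i))
  (slit_coord_chart du)).
Qed.

Lemma diff_vert i X z a : pivfield X -> slit_chart i z ->
  'd (fun z => vert (prep i X z)) z a = vert ('d (prep i X) z a).
Proof.
move=> pX Uz.
have dX : differentiable (prep i X) z := Cinf_differentiable (pivfield_smooth i pX) Uz.
have dv := Cinf_differentiable (Cinf_vert i pX) Uz.
apply/rowP => k; refine (etrans (diff_rV a k dv) _).
have dvk := (differentiable_rV _ _).1 dv k.
have [h kh|h kh] := split_ordP k.
- refine (etrans (open_eq_diff (g := cst (0 : R^o)) a (slit_chart_open sA i) _ Uz dvk) _).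
    by move=> y _; rewrite kh /vert row_mxEl mxE.
  refine (etrans (f_equal (fun g : _ -> R^o => g a) (diff_cst _ _)) _).
  by rewrite kh /vert row_mxEl mxE.
- rewrite kh /vert row_mxEr; refine (etrans _ (esym (diff_rV a h dX))).
  refine (open_eq_diff a (slit_chart_open sA i) _ Uz _).
    by move=> y _; rewrite row_mxEr.
  by rewrite kh in dvk; exact dvk.
Qed.

Lemma half_third_derivative (f : 'rV[R]_(n + n) -> R^o) z a b b' c c' d d' e e' :
  b = b' -> c = c' -> d = d' -> e = e' ->
  2^-1 * ('D_a ('D_b ('D_c f)) z + 'D_d ('D_c f) z + 'D_b ('D_e f) z) =
  2^-1 * 'D_a ('D_b' ('D_c' f)) z + 2^-1 * 'D_d' ('D_c' f) z
    + 2^-1 * 'D_b' ('D_e' f) z :> R.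
Proof. by move=> -> -> -> ->; rewrite !mulrDr. Qed.

(** By [diff_derive2]: the third derivative is [ctens], and the derivatives of the components of [Y]
    and [Z] along gamma X are the projected brackets of [rho_bracket_vlift]. *)
Lemma lie_vlift_ft i u X Y Z V W : pivfield X -> pivfield Y -> pivfield Z ->
  vfield V -> vfield W -> rho V = Y -> rho W = Z -> dom i (base u) ->
  lie (vlift X) (ftfield Y Z) u =
  ctens i u (X u i) (Y u i) (Z u i)
  + g u (rho (bracket (vlift X) V) u) (Z u)
  + g u (Y u) (rho (bracket (vlift X) W) u).
Proof.
move=> pX pY pZ vV vW rV rW du; have oU := slit_chart_open sA i.
have Uu := slit_coord_chart du.
have vX := vfield_vlift sA pX.
have pV := pivfield_rho sA (vfield_bracket sS vX vV).
have pW := pivfield_rho sA (vfield_bracket sS vX vW).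
refine (etrans (lieE sS (proj1 vX u) (smooth_ftfield pY pZ) (du : dom (a := SA) i u)) _).
have dH := Cinf_differentiable (CinfM oU (Cinf_cst _ (2^-1 : R^o)) (Cinf_ftchart i pY pZ)) Uu.
refine (etrans (esym (open_eq_diff _ oU (@rep_ftfield i Y Z pY pZ) Uu dH)) _).
have dF := Cinf_differentiable (Cinf_ftchart i pY pZ) Uu.
refine (etrans (esym (deriveE _ dH)) (etrans (derive_cstM _ _ dF) _)).
rewrite (deriveE _ dF).
have E := diff_derive2 (vert (X u i)) oU (Cinf_energy i) (Cinf_vert i pY) (Cinf_vert i pZ) Uu.
refine (etrans (f_equal (fun r : R => 2^-1 * r) E) _).
have EV := rho_bracket_vlift sA pX vV du; have EW := rho_bracket_vlift sA pX vW du.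
rewrite rV in EV; rewrite rW in EW.
have DY := diff_vert (vert (X u i)) pY Uu; have DZ := diff_vert (vert (X u i)) pZ Uu.
have {}EV := etrans DY (f_equal vert (esym EV)).
have {}EW := etrans DZ (f_equal vert (esym EW)).
have PY := f_equal vert (prepE sA Y du); have PZ := f_equal vert (prepE sA Z du).
have GY := fundamental_tensorE du (proj1 pV u) (proj1 pZ u).
have GZ := fundamental_tensorE du (proj1 pY u) (proj1 pW u).
refine (etrans _ (esym (f_equal2 (fun p q : R => p + q)
  (f_equal (fun q : R => ctens i u (X u i) (Y u i) (Z u i) + q) GY) GZ))).
exact (half_third_derivative _ _ _ PY PZ EV EW).
Qed.

End FundamentalTensor.

(** * Homogeneity of L along the fibres *)

Section Homogeneity.
Context {R : realType} {M : Type} {n : nat} {A : atlas R M n}.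
Hypothesis sA : smooth_atlas A.
Variables (L : M -> tvec A -> R).
Hypothesis hL : finsler L.
Local Notation SA := (slit_atlas A).
Implicit Types (i : chart A) (u : slit A) (z : 'rV[R]_(n + n)).

Definition fiber_scale (t : R) z : 'rV[R]_(n + n) :=
  row_mx (lsubmx z) (t *: rsubmx z).

Lemma slit_chartP i z : slit_chart i z <->
  (xcoord i @` dom i) (lsubmx z) /\ rsubmx z <> 0.
Proof.
have := slit_image sA i i; rewrite !setIid => E.
by rewrite /slit_chart E.
Qed.

Lemma slit_chart_scale i t z : 0 < t -> slit_chart i z ->
  slit_chart i (fiber_scale t z).
Proof.
move=> t0 /slit_chartP[lz rz]; apply/slit_chartP.
rewrite row_mxKl row_mxKr; split=> // /eqP.
by rewrite scaler_eq0 gt_eqF //= => /eqP.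
Qed.

Lemma energy_scale i t z : 0 < t -> slit_chart i z ->
  energy L i (fiber_scale t z) = t ^+ 2 * energy L i z.
Proof.
move=> t0 Uz; have Ut := slit_chart_scale t0 Uz.
case: (Uz) => u du zE; have tu := slit_tangent u.
have E1 : energy L i (fiber_scale t z) = L (base u) (t *: (sval u).2) ^+ 2.
  apply: (energyE sA L (i := i) du Ut (tangentZ t tu)).
  - by rewrite row_mxKl -zE row_mxKl.
  - by rewrite row_mxKr -zE row_mxKr.
have E2 : energy L i z = L (base u) (sval u).2 ^+ 2.
  apply: (energyE sA L (i := i) du Uz tu).
  - by rewrite -zE row_mxKl.
  - by rewrite -zE row_mxKr.
by rewrite E1 E2 (finsler_homogeneous hL tu t0) exprMn.
Qed.

(** A vertical derivative lowers the degree of homogeneity by one. *)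
Lemma derive_scale_invariant i (f : 'rV[R]_(n + n) -> R^o) (t k : R) z b :
  0 < t -> Cinf (slit_chart i) f ->
  (forall y, slit_chart i y -> f (fiber_scale t y) = k * f y) ->
  slit_chart i z ->
  t * 'D_(vert b) f (fiber_scale t z) = k * 'D_(vert b) f z.
Proof.
move=> t0 cf fE Uz; have oU := slit_chart_open sA i.
have dt := Cinf_differentiable cf (slit_chart_scale t0 Uz).
have dz := Cinf_differentiable cf Uz.
have S1 h : fiber_scale t (h *: vert b + z) = h *: (t *: vert b) + fiber_scale t z.
  have l1 : lsubmx (h *: vert b + z) = lsubmx z.
    by rewrite addrC lsubmx_line.
  have r1 : rsubmx (h *: vert b + z) = rsubmx z + h *: b.
    by rewrite addrC rsubmx_line.
  rewrite /fiber_scale l1 r1 /vert !scale_row_mx !scaler0 add_row_mx add0r.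
  by rewrite scalerDr addrC !scalerA [t * h]mulrC.
refine (etrans (esym (derive_scale t (vert b) dt)) _).
refine (etrans (esym (derive_comp_line f S1)) _).
refine (etrans _ (derive_cstM k (vert b) dz)).
by apply: (open_eq_derive _ oU) Uz => y; rewrite inE; exact: fE.
Qed.

(** L^2 has degree 2, so its vertical Hessian has degree 0: it is constant along rays, and its
    derivative in the direction y vanishes. *)
Lemma ctens_eta i u b c : dom i (base u) -> ctens L i u ((sval u).2 i) b c = 0.
Proof.
move=> du; have oU := slit_chart_open sA i; have Uu := slit_coord_chart du.
have cE := Cinf_energy sA hL i.
set G := 'D_(vert b) ('D_(vert c) (energy L i)).
have GE t y : 0 < t -> slit_chart i y -> G (fiber_scale t y) = G y.
  move=> t0 Uy; have tn : t != 0 by rewrite gt_eqF.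
  have H1 x : slit_chart i x -> 'D_(vert c) (energy L i) (fiber_scale t x) =
      t * 'D_(vert c) (energy L i) x.
    move=> Ux; apply: (mulfI tn).
    have := derive_scale_invariant c t0 cE (fun y => @energy_scale i t y t0) Ux.
    by rewrite expr2 -mulrA.
  apply: (mulfI tn).
  exact (derive_scale_invariant b t0 (Cinf_derive _ cE) H1 Uy).
have D0 : 'D_(vert ((sval u).2 i)) G (slit_coord i u) = 0.
  refine (etrans (near_line_derive (g := cst (G (slit_coord i u))) _) _); last exact: derive_cst.
  (* On the line through (x, y) in direction y, the point at parameter t is (x, y) scaled by 1 + t,
     which is positive for t near 0. *)
  near=> t.
  have t1 : 0 < 1 + t.
    by rewrite -ltrBlDl sub0r; near: t; exact: lt_nbhsr.
  rewrite -[RHS](GE _ _ t1 Uu); congr G.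
  rewrite -[LHS]hsubmxK lsubmx_line rsubmx_line rsubmx_slit_coord.
  by rewrite /fiber_scale rsubmx_slit_coord scalerDl scale1r.
by rewrite /ctens D0 mulr0.
Unshelve. all: by end_near. Qed.

End Homogeneity.

(** * The Cartan tensor under a conformal change *)

Section Conformal.
Context {R : realType} {M : Type} {n : nat} {A : atlas R M n}.
Hypothesis sA : smooth_atlas A.
Variables (L L' : M -> tvec A -> R) (sigma : M -> R).
Hypotheses (hL : finsler L) (hc : conformal L L' sigma).

(** The conformal relation is the case of Hessians, and its factor depends on the base point only.
    One further vertical derivative therefore passes through it; agreement on the fibre of [u]
    suffices for this. *)
Lemma ctens_conformal i (u : slit A) a b c : dom i (base u) ->
  ctens L' i u a b c = expR (2 * sigma (base u)) * ctens L i u a b c.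
Proof.
move=> du; have oU := slit_chart_open sA i; have Uu := slit_coord_chart du.
set k := expR _.
pose G := 'D_(vert b) ('D_(vert c) (energy L i)).
pose G' := 'D_(vert b) ('D_(vert c) (energy L' i)).
have GE y : slit_chart i y -> lsubmx y = xcoord i (base u) -> G' y = k * G y.
  move=> [v dv <-]; rewrite row_mxKl => bb.
  have bE : base v = base u by apply: (atlas_inj sA) bb; rewrite inE.
  (* [conformal] speaks of tangent vectors, so the constant components [b] and [c] are realised by
     tangent vectors at the base point of [v]. *)
  have [x tx xi] := exists_tangent sA b (dv : dom i (base v)).
  have [x' tx' xi'] := exists_tangent sA c (dv : dom i (base v)).
  have E1 := fundamental_tensorE sA L (dv : dom i (base v)) tx tx'.
  have E2 := fundamental_tensorE sA L' (dv : dom i (base v)) tx tx'.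
  have := hc tx tx'; rewrite E1 E2 bE xi xi' -/k mulrCA.
  by apply: mulfI; rewrite invr_neq0.
have dG : differentiable G (slit_coord i u).
  exact: (Cinf_differentiable (Cinf_derive _ (Cinf_derive _ (Cinf_energy sA hL i))) Uu).
have D1 : 'D_(vert a) G' (slit_coord i u) = k * 'D_(vert a) G (slit_coord i u).
  refine (etrans (near_line_derive (g := fun y => k * G y : R^o) _) (derive_cstM _ _ dG)).
  apply: filterS (near_line (vert a) oU Uu) => t Ut.
  by apply: GE => //; rewrite lsubmx_line lsubmx_slit_coord.
exact (etrans (f_equal (fun r : R => 2^-1 * r) D1) (mulrCA (2^-1 : R) k _)).
Qed.

End Conformal.

(** * Connections and the first Bianchi identity *)

Local Opaque bracket.

Section FieldAlgebra.
Context {R : realType} {M : Type} {n : nat} {A : atlas R M n}.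
Implicit Types (X Y : slit A -> tvec A).

Lemma fieldP X Y : (forall u i k, X u i 0 k = Y u i 0 k) -> X = Y.
Proof.
by move=> XY; apply/funext => u; apply/funext => i; apply/rowP => k; exact: XY.
Qed.

Lemma field_addE X Y u (i : chart A) k : (X + Y) u i 0 k = X u i 0 k + Y u i 0 k.
Proof. by rewrite -[(X + Y) u i]/(X u i + Y u i) mxE. Qed.

Lemma field_oppE X u (i : chart A) k : (- X) u i 0 k = - X u i 0 k.
Proof. by rewrite -[(- X) u i]/(- X u i) mxE. Qed.

Lemma field_zeroE u (i : chart A) k : (0 : slit A -> tvec A) u i 0 k = 0.
Proof. by rewrite -[(0 : slit A -> tvec A) u i]/(0 : 'rV_n) mxE. Qed.

End FieldAlgebra.

Ltac field_ring :=
  apply: fieldP => ? ? ?; rewrite ?(field_addE, field_oppE, field_zeroE); ring.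

(** The properties, common to the Cartan and the Hashiguchi connections, on which the torsion and
    curvature identities rest. For the latter they come from the additivity of [hatP]. *)
Record additive_connop (R : realType) (M : Type) (n : nat) (A : atlas R M n)
    (D : connop A) : Prop := AdditiveConnop {
  op_smooth : forall X Y, vfield X -> pivfield Y -> pivfield (D X Y);
  op_addl : forall X X' Y, vfield X -> vfield X' -> pivfield Y ->
    D (X + X') Y = D X Y + D X' Y;
  op_addr : forall X Y Y', vfield X -> pivfield Y -> pivfield Y' ->
    D X (Y + Y') = D X Y + D X Y' }.

Lemma linear_connection_additive (R : realType) (M : Type) (n : nat)
    (A : atlas R M n) (D : connop A) : linear_connection D -> additive_connop D.
Proof. by case. Qed.

Section Connections.
Context {R : realType} {M : Type} {n : nat} {A : atlas R M n}.
Hypothesis sA : smooth_atlas A.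
Local Notation sS := (slit_smooth_atlas sA).
Implicit Types (u : slit A) (X Y Z : slit A -> tvec A) (V W : slit A -> stvec A).

Lemma vfield0 : vfield (0 : slit A -> stvec A).
Proof.
have := vfield_vlift sA (pivfield0 sA); congr vfield.
apply/funext => u; apply/funext => i.
by rewrite /vlift -[(0 : slit A -> tvec A) u i]/(0 : 'rV[R]_n) row_mx0.
Qed.

Variable D : connop A.
Hypothesis hD : additive_connop D.

Lemma conn0r V : vfield V -> D V 0 = 0.
Proof.
move=> vV; have := op_addr hD vV (pivfield0 sA) (pivfield0 sA).
by rewrite addr0 => /(congr1 (fun F => F - D V 0)); rewrite subrr addrK.
Qed.

Lemma conn0l Y : pivfield Y -> D 0 Y = 0.
Proof.
move=> pY; have := op_addl hD vfield0 vfield0 pY.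
by rewrite addr0 => /(congr1 (fun F => F - D 0 Y)); rewrite subrr addrK.
Qed.

Lemma connNr V Y : vfield V -> pivfield Y -> D V (- Y) = - D V Y.
Proof.
move=> vV pY; have := op_addr hD vV pY (pivfieldN sA pY).
by rewrite subrr conn0r // => /esym/eqP; rewrite addrC addr_eq0 => /eqP.
Qed.

Lemma connNl V Y : vfield V -> pivfield Y -> D (- V) Y = - D V Y.
Proof.
move=> vV pY; have := op_addl hD vV (vfieldN sS vV) pY.
by rewrite subrr conn0l // => /esym/eqP; rewrite addrC addr_eq0 => /eqP.
Qed.

Lemma connBr V X Y : vfield V -> pivfield X -> pivfield Y ->
  D V (X - Y) = D V X - D V Y.
Proof.
move=> vV pX pY.
by rewrite (op_addr hD vV pX (pivfieldN sA pY)) (connNr vV pY).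
Qed.

Lemma connBl V W Y : vfield V -> vfield W -> pivfield Y ->
  D (V - W) Y = D V Y - D W Y.
Proof.
move=> vV vW pY.
by rewrite (op_addl hD vV (vfieldN sS vW) pY) (connNl vW pY).
Qed.

Lemma pivfield_torsion V W : vfield V -> vfield W -> pivfield (torsion D V W).
Proof.
move=> vV vW; have pr U : vfield U -> pivfield (rho U) := @pivfield_rho _ _ _ _ sA U.
apply: (pivfieldB sA); last exact/pr/(vfield_bracket sS vV vW).
apply: (pivfieldB sA).
- exact: (op_smooth hD vV (pr _ vW)).
- exact: (op_smooth hD vW (pr _ vV)).
Qed.

Lemma pivfield_curvature V W Z : vfield V -> vfield W -> pivfield Z ->
  pivfield (curvature D V W Z).
Proof.
move=> vV vW pZ; have cs := op_smooth hD.
apply: (pivfieldD sA); last exact: (cs _ _ (vfield_bracket sS vV vW) pZ).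
apply: (pivfieldD sA); last exact: (cs _ _ vW (cs _ _ vV pZ)).
exact: (pivfieldN sA (cs _ _ vV (cs _ _ vW pZ))).
Qed.

Lemma curvatureC V W Z : vfield V -> vfield W -> pivfield Z ->
  curvature D V W Z = - curvature D W V Z.
Proof.
move=> vV vW pZ; rewrite /curvature (bracketC V W).
rewrite (connNl (vfield_bracket sS vW vV) pZ).
move: (D V _) (D W (D V Z)) (D (bracket _ _) Z) => a b c; field_ring.
Qed.

Lemma torsionC V W : torsion D V W = - torsion D W V.
Proof.
rewrite /torsion (bracketC V W) rhoN.
move: (D V _) (D W _) (rho (bracket W V)) => a b c; field_ring.
Qed.

Lemma torsionDr V W W' : vfield V -> vfield W -> vfield W' ->
  torsion D V (W + W') = torsion D V W + torsion D V W'.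
Proof.
move=> vV vW vW'; have pr U : vfield U -> pivfield (rho U) := @pivfield_rho _ _ _ _ sA U.
rewrite /torsion rhoD (op_addr hD vV (pr _ vW) (pr _ vW')).
rewrite (op_addl hD vW vW' (pr _ vV)) (bracketDr sS vV vW vW') rhoD.
move: (D V (rho W)) (D V (rho W')) (D W _) (D W' _) (rho (bracket V W)) (rho (bracket _ _)).
by move=> a b c d e f; field_ring.
Qed.

(** One third of the cyclic sum in [first_bianchi]; the two occurrences of D_U rho [V,W] cancel. *)
Lemma bianchi_term U V W : vfield U -> vfield V -> vfield W ->
  D U (torsion D V W) + torsion D U (bracket V W) =
  D U (D V (rho W)) - D U (D W (rho V)) - D (bracket V W) (rho U)
    - rho (bracket U (bracket V W)).
Proof.
move=> vU vV vW; have pr V' : vfield V' -> pivfield (rho V') := @pivfield_rho _ _ _ _ sA V'.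
have cs := op_smooth hD.
have p1 := cs _ _ vV (pr _ vW); have p2 := cs _ _ vW (pr _ vV).
have p3 := pr _ (vfield_bracket sS vV vW).
rewrite /torsion (connBr vU (pivfieldB sA p1 p2) p3) (connBr vU p1 p2).
move: (D U (D V _)) (D U (D W _)) (D U (rho (bracket _ _))) (D (bracket V W) _) (rho (bracket U _)).
by move=> a b c d e; field_ring.
Qed.

(** Adding three [bianchi_term], the double brackets disappear by the Jacobi identity. The minus
    sign reflects the sign convention of [curvature]. *)
Lemma first_bianchi U V W : vfield U -> vfield V -> vfield W ->
  curvature D U V (rho W) + curvature D V W (rho U) + curvature D W U (rho V) =
  - (D U (torsion D V W) + torsion D U (bracket V W)
     + (D V (torsion D W U) + torsion D V (bracket W U))
     + (D W (torsion D U V) + torsion D W (bracket U V))).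
Proof.
move=> vU vV vW; rewrite (bianchi_term vU vV vW) (bianchi_term vV vW vU).
rewrite (bianchi_term vW vU vV).
have J : rho (bracket U (bracket V W)) =
    - rho (bracket V (bracket W U)) - rho (bracket W (bracket U V)).
  have := f_equal (@rho _ _ _ _) (bracket_jacobi sS vU vV vW).
  rewrite (rhoD (bracket U (bracket V W) + bracket V (bracket W U))).
  rewrite (rhoD (bracket U (bracket V W))) => J; have r0 : rho (0 : slit A -> stvec A) = 0.
    by apply/funext => u; apply/funext => i; exact: linear0.
  move: J; rewrite r0; move: (rho (bracket U _)) (rho (bracket V _)) (rho (bracket W _)) => a b c abc.
  have -> : a = (a + b + c) - b - c by field_ring.
  by rewrite abc; field_ring.
rewrite J /curvature.
move: (rho (bracket V _)) (rho (bracket W _)) => a b.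
move: (D U (D V _)) (D V (D U _)) (D V (D W _)) (D W (D V _)) (D W (D U _)) (D U (D W _)).
move: (D (bracket U V) _) (D (bracket V W) _) (D (bracket W U) _).
by move=> c d e f g h i j k; field_ring.
Qed.

End Connections.

(** * The Cartan connection *)

Section VerticalBracket.
Context {R : realType} {M : Type} {n : nat} {A : atlas R M n}.
Hypothesis sA : smooth_atlas A.
Local Notation sS := (slit_smooth_atlas sA).
Implicit Types (u : slit A) (X Y Z : slit A -> tvec A) (V W : slit A -> stvec A).

Lemma rho_bracket_vertical X V W : pivfield X -> vfield V -> vfield W ->
  rho V = rho W -> rho (bracket (vlift X) V) = rho (bracket (vlift X) W).
Proof.
move=> pX vV vW VW; apply/funext => u.
have [i du] := atlas_cover sA (base u); have vX := vfield_vlift sA pX.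
apply: (tangent1_eq du).
- exact: (proj1 (pivfield_rho sA (vfield_bracket sS vX vV)) u).
- exact: (proj1 (pivfield_rho sA (vfield_bracket sS vX vW)) u).
rewrite (rho_bracket_vlift sA pX vV du) (rho_bracket_vlift sA pX vW du).
by rewrite VW.
Qed.

(** All vertical fields have the same projection, so the value does not depend on the second field.
    Comparing [Y] with [Y + Y] shows that it is 0. *)
Lemma rho_bracket_vlift2 X Y : pivfield X -> pivfield Y ->
  rho (bracket (vlift X) (vlift Y)) = 0.
Proof.
move=> pX pY; have vX := vfield_vlift sA pX; have vY := vfield_vlift sA pY.
have v0 := vfield_vlift sA (pivfield0 sA).
have rV0 Z : rho (vlift Z) = 0 by exact: rho_vlift.
have H Z : pivfield Z -> rho (bracket (vlift X) (vlift Z)) =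
    rho (bracket (vlift X) (vlift Y)).
  by move=> pZ; apply: rho_bracket_vertical => //; rewrite ?rV0 //; exact: (vfield_vlift sA).
have := H _ (pivfieldD sA pY pY).
rewrite vliftD (bracketDr sS vX vY vY) rhoD.
by move/(congr1 (fun F => F - rho (bracket (vlift X) (vlift Y)))); rewrite addrK subrr.
Qed.

(** In a chart the components of eta are the fibre coordinates y, whose derivative along gamma X is
    X. *)
Lemma rho_bracket_eta X V : pivfield X -> vfield V -> rho V = etabar (A := A) ->
  rho (bracket (vlift X) V) = X.
Proof.
move=> pX vV rV; apply/funext => u.
have [i du] := atlas_cover sA (base u); have vX := vfield_vlift sA pX.
have oU := slit_chart_open sA i; have Uu := slit_coord_chart du.
apply: (tangent1_eq du).
- exact: (proj1 (pivfield_rho sA (vfield_bracket sS vX vV)) u).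
- exact: (proj1 pX u).
rewrite (rho_bracket_vlift sA pX vV du) rV.
have E : {in slit_chart i, prep i (etabar (A := A)) =1 rsubmx}.
  by move=> z; rewrite inE => -[v dv <-]; rewrite prepE //= row_mxKr.
refine (etrans (open_eq_diff _ oU E Uu (Cinf_differentiable (pivfield_smooth i (pivfield_eta sA)) Uu)) _).
refine (etrans (f_equal (fun g : _ -> 'rV[R]_n => g _)
  (diff_lin (f := (rsubmx : {linear 'rV[R]_(n + n) -> 'rV[R]_n})) _ (@continuous_rsubmx _ _ _ _))) _).
exact: row_mxKr.
Qed.

End VerticalBracket.

Section Cartan.
Context {R : realType} {M : Type} {n : nat} {A : atlas R M n}.
Hypothesis sA : smooth_atlas A.
Variables (L : M -> tvec A -> R) (nabla : connop A)
  (beta : (slit A -> tvec A) -> (slit A -> stvec A)).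
Hypotheses (hL : finsler L) (hC : cartan_connection L nabla beta).
Local Notation sS := (slit_smooth_atlas sA).
Local Notation g := (fundamental_tensor L).
Local Notation eta := (etabar (A := A)).
Local Notation T := (hvtorsion nabla beta).
Local Notation hD := (linear_connection_additive (cartan_linear hC)).
Implicit Types (u : slit A) (X Y Z W : slit A -> tvec A) (V U : slit A -> stvec A).

Lemma vbeta X : pivfield X -> vfield (beta X).
Proof. by move=> /(cartan_lift hC)[]. Qed.

Lemma rho_beta X : pivfield X -> rho (beta X) = X.
Proof. by move=> /(cartan_lift hC)[]. Qed.

Lemma nabla_beta_eta X : pivfield X -> nabla (beta X) eta = 0.
Proof.
move=> pX; have [vX hX _] := cartan_lift hC pX.
by apply/funext => u; apply: (proj2 (hX u)).
Qed.

Lemma pnabla V Y : vfield V -> pivfield Y -> pivfield (nabla V Y).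
Proof. exact: (op_smooth hD). Qed.

(** With an arbitrary lift [V] of [Y]: two Cartan connections can then be compared through one
    common lift. *)
Lemma hvtorsionE X Y V : pivfield X -> pivfield Y -> vfield V -> rho V = Y ->
  T X Y = nabla (vlift X) Y - rho (bracket (vlift X) V).
Proof.
move=> pX pY vV rV; rewrite /hvtorsion /torsion rho_beta // rho_vlift.
rewrite (conn0r sA hD (vbeta pY)) subr0.
by rewrite (rho_bracket_vertical sA pX (vbeta pY) vV) // rho_beta.
Qed.

Lemma pivfield_T X Y : pivfield X -> pivfield Y -> pivfield (T X Y).
Proof.
move=> pX pY; exact: (pivfield_torsion sA hD (vfield_vlift sA pX) (vbeta pY)).
Qed.

Lemma eq_ftfield X Y : pivfield X -> pivfield Y ->
  (forall Z, pivfield Z -> forall u, g u (X u) (Z u) = g u (Y u) (Z u)) -> X = Y.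
Proof.
move=> pX pY XY; apply/funext => u.
apply: (ft_nondegenerate sA hL (proj1 pX u) (proj1 pY u)).
exact: (XY _ (pivfieldB sA pX pY)).
Qed.

Lemma double_torsion (a b c d e : R) :
  a + c = e + b + d -> a - b = c - d -> 2 * (a - b) = e.
Proof. by move=> H1 H2; lra. Qed.

Lemma double_inj (a b : R) : 2 * a = 2 * b -> a = b.
Proof. by move=> H; lra. Qed.

(** Equating the two expressions of (gamma X) g(Y,Z), by nabla g = 0 and by [lie_vlift_ft], gives
    g(T(X,Y),Z) + g(Y,T(X,Z)) = [ctens]. The two summands are equal by [cartan_hvtorsion]. *)
Lemma hvtorsion_ctens (i : chart A) X Y Z u : pivfield X -> pivfield Y -> pivfield Z ->
  dom i (base u) ->
  2 * g u (T X Y u) (Z u) = ctens L i u (X u i) (Y u i) (Z u i).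
Proof.
move=> pX pY pZ du; have vX := vfield_vlift sA pX.
have E1 := cartan_metric hC vX pY pZ u.
have E2 := lie_vlift_ft sA hL pX pY pZ (vbeta pY) (vbeta pZ) (rho_beta pY) (rho_beta pZ) du.
have E3 := cartan_hvtorsion hC pX pY pZ u.
have tY := hvtorsionE pX pY (vbeta pY) (rho_beta pY).
have tZ := hvtorsionE pX pZ (vbeta pZ) (rho_beta pZ).
have pNY := pnabla vX pY; have pNZ := pnabla vX pZ.
have pRY := pivfield_rho sA (vfield_bracket sS vX (vbeta pY)).
have pRZ := pivfield_rho sA (vfield_bracket sS vX (vbeta pZ)).
have F1 : g u (T X Y u) (Z u) = g u (nabla (vlift X) Y u) (Z u) -
    g u (rho (bracket (vlift X) (beta Y)) u) (Z u).
  rewrite tY; exact: (ftBl sA hL (proj1 pNY u) (proj1 pRY u) (proj1 pZ u)).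
have F2 : g u (T X Z u) (Y u) = g u (Y u) (nabla (vlift X) Z u) -
    g u (Y u) (rho (bracket (vlift X) (beta Z)) u).
  rewrite tZ (ftC sA hL (proj1 pY u) (proj1 pNZ u)) (ftC sA hL (proj1 pY u) (proj1 pRZ u)).
  exact: (ftBl sA hL (proj1 pNZ u) (proj1 pRZ u) (proj1 pY u)).
have E := etrans (esym E1) E2.
rewrite F1 F2 in E3; rewrite F1.
exact (double_torsion E E3).
Qed.

Lemma hvtorsionC X Y : pivfield X -> pivfield Y -> T X Y = T Y X.
Proof.
move=> pX pY; apply: (eq_ftfield (pivfield_T pX pY) (pivfield_T pY pX)) => Z pZ u.
have [i du] := atlas_cover sA (base u).
have E1 := hvtorsion_ctens pX pY pZ du; have E2 := hvtorsion_ctens pY pX pZ du.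
have E3 := ctensC12 sA hL (X u i) (Y u i) (Z u i) du.
exact (double_inj (etrans E1 (etrans E3 (esym E2)))).
Qed.

Lemma hvtorsion_eta X : pivfield X -> T X eta = 0.
Proof.
move=> pX; have pe := pivfield_eta sA.
apply: (eq_ftfield (pivfield_T pX pe) (pivfield0 sA)) => Z pZ u.
have [i du] := atlas_cover sA (base u).
have E1 := hvtorsion_ctens pX pe pZ du.
have E2 := ctensC12 sA hL (X u i) (eta u i) (Z u i) du.
have E3 := ctens_eta sA hL (X u i) (Z u i) du.
have -> : g u ((0 : slit A -> tvec A) u) (Z u) = 0 by exact: (ft0l sA hL (proj1 pZ u)).
exact (double_inj (etrans E1 (etrans E2 (etrans E3 (esym (mulr0 2)))))).
Qed.

(** K is a left inverse of gamma: this is T(X,eta) = 0 combined with [rho_bracket_eta]. *)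
Lemma nabla_vlift_eta X : pivfield X -> nabla (vlift X) eta = X.
Proof.
move=> pX; have pe := pivfield_eta sA.
have := hvtorsionE pX pe (vbeta pe) (rho_beta pe).
rewrite hvtorsion_eta // (rho_bracket_eta sA pX (vbeta pe) (rho_beta pe)).
by move/(congr1 (fun F => F + X)); rewrite subrK add0r.
Qed.

(** V - beta (rho V) is vertical, hence some gamma W with W smooth. Applying K, which kills beta and
    inverts gamma, identifies W as K V. *)
Lemma vfield_decomposition V : vfield V -> V = beta (rho V) + vlift (nabla V eta).
Proof.
move=> vV; have pV := pivfield_rho sA vV; have pe := pivfield_eta sA.
have vB := vbeta pV.
have [|W pW WE] := exists_vlift sA (vfieldB sS vV vB).
  by rewrite rhoD rhoN (rho_beta pV) subrr.
have VE : V = beta (rho V) + vlift W by rewrite -WE addrC subrK.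
suff -> : nabla V eta = W by [].
rewrite {1}VE (op_addl hD vB (vfield_vlift sA pW) pe).
by rewrite nabla_beta_eta // nabla_vlift_eta // add0r.
Qed.

(** Characterises beta X by its images under rho and K. Additivity of beta and the formula for beta'
    are both read off from it. *)
Lemma beta_unique V X : vfield V -> rho V = X -> nabla V eta = 0 -> V = beta X.
Proof.
move=> vV rV kV; rewrite [LHS]vfield_decomposition // kV rV.
apply/funext => u; apply/funext => i; rewrite -[LHS]/(beta X u i + row_mx 0 0).
by rewrite row_mx0 addr0.
Qed.

Lemma betaD X Y : pivfield X -> pivfield Y -> beta (X + Y) = beta X + beta Y.
Proof.
move=> pX pY; have vX := vbeta pX; have vY := vbeta pY; apply/esym/beta_unique.
- exact: (vfieldD sS vX vY).
- by rewrite rhoD !rho_beta.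
- by rewrite (op_addl hD vX vY (pivfield_eta sA)) !nabla_beta_eta // addr0.
Qed.

Local Notation hP := (hatP nabla beta).

(** The terms of the curvature simplify because K (beta X) = 0 and K (gamma Y) = Y: hatP compares
    the vertical part of [beta X, gamma Y] with nabla_{beta X} Y. *)
Lemma hatPE X Y : pivfield X -> pivfield Y ->
  hP X Y = nabla (bracket (beta X) (vlift Y)) eta - nabla (beta X) Y.
Proof.
move=> pX pY; rewrite /hatP /hvcurv /curvature nabla_vlift_eta // nabla_beta_eta //.
rewrite (conn0r sA hD (vfield_vlift sA pY)).
by move: (nabla _ _) (nabla _ _) => a b; field_ring.
Qed.

Lemma pivfield_hatP X Y : pivfield X -> pivfield Y -> pivfield (hP X Y).
Proof.
move=> pX pY; apply: (pivfield_curvature sA hD (vbeta pX) (vfield_vlift sA pY)).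
exact: pivfield_eta.
Qed.

Lemma hatPDr X Y Y' : pivfield X -> pivfield Y -> pivfield Y' ->
  hP X (Y + Y') = hP X Y + hP X Y'.
Proof.
move=> pX pY pY'; have pe := pivfield_eta sA; have vX := vbeta pX.
have vY := vfield_vlift sA pY; have vY' := vfield_vlift sA pY'.
rewrite (hatPE pX (pivfieldD sA pY pY')) (hatPE pX pY) (hatPE pX pY').
rewrite vliftD (bracketDr sS vX vY vY').
rewrite (op_addl hD (vfield_bracket sS vX vY) (vfield_bracket sS vX vY') pe).
rewrite (op_addr hD vX pY pY').
exact (sub_split erefl erefl).
Qed.

Lemma hatPDl X X' Y : pivfield X -> pivfield X' -> pivfield Y ->
  hP (X + X') Y = hP X Y + hP X' Y.
Proof.
move=> pX pX' pY; have pe := pivfield_eta sA; have vX := vbeta pX.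
have vY := vfield_vlift sA pY; have vX' := vbeta pX'.
rewrite (hatPE (pivfieldD sA pX pX') pY) (hatPE pX pY) (hatPE pX' pY).
rewrite betaD // (bracketDl sS vX vX' vY).
rewrite (op_addl hD (vfield_bracket sS vX vY) (vfield_bracket sS vX' vY) pe).
rewrite (op_addl hD vX vX' pY).
exact (sub_split erefl erefl).
Qed.

Lemma hatP0l Y : pivfield Y -> hP 0 Y = 0.
Proof.
move=> pY; have := hatPDl (pivfield0 sA) (pivfield0 sA) pY.
by rewrite addr0 => /(congr1 (fun F => F - hP 0 Y)); rewrite subrr addrK.
Qed.

Lemma rho_bracket_beta X Y : pivfield X -> pivfield Y ->
  rho (bracket (beta X) (beta Y)) = nabla (beta X) Y - nabla (beta Y) X.
Proof.
move=> pX pY; have := cartan_htorsion hC pX pY.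
rewrite /htorsion /torsion !rho_beta //.
by move/(congr1 (fun F => F + rho (bracket (beta X) (beta Y)))); rewrite subrK add0r.
Qed.

End Cartan.

(** * Symmetry of the Landsberg tensor *)

Section LandsbergSymmetry.
Context {R : realType} {M : Type} {n : nat} {A : atlas R M n}.
Hypothesis sA : smooth_atlas A.
Variables (L : M -> tvec A -> R) (nabla : connop A)
  (beta : (slit A -> tvec A) -> (slit A -> stvec A)).
Hypotheses (hL : finsler L) (hC : cartan_connection L nabla beta).
Local Notation sS := (slit_smooth_atlas sA).
Local Notation g := (fundamental_tensor L).
Local Notation eta := (etabar (A := A)).
Local Notation T := (hvtorsion nabla beta).
Local Notation hP := (hatP nabla beta).
Local Notation hD := (linear_connection_additive (cartan_linear hC)).
Local Notation tors := (torsion nabla).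
Local Notation curv := (curvature nabla).
Local Notation vb := (vbeta hC).
Local Notation vg := (vfield_vlift sA).
Local Notation vbr := (vfield_bracket sS).
Local Notation pe := (pivfield_eta sA).
Local Notation pn := (pnabla hC).
Local Notation pT := (pivfield_T sA hC).
Local Notation pP := (pivfield_hatP sA hC).
Implicit Types (u : slit A) (X Y Z W : slit A -> tvec A) (V U : slit A -> stvec A).

Definition gf X Y u : R := g u (X u) (Y u).

Lemma gfDl X X' Y u : pivfield X -> pivfield X' -> pivfield Y ->
  gf (X + X') Y u = gf X Y u + gf X' Y u.
Proof. by move=> pX pX' pY; exact: (ftDl sA hL (proj1 pX u) (proj1 pX' u) (proj1 pY u)). Qed.

Lemma gfNl X Y u : pivfield X -> pivfield Y -> gf (- X) Y u = - gf X Y u.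
Proof. by move=> pX pY; exact: (ftNl sA hL (proj1 pX u) (proj1 pY u)). Qed.

Lemma gfBl X X' Y u : pivfield X -> pivfield X' -> pivfield Y ->
  gf (X - X') Y u = gf X Y u - gf X' Y u.
Proof. by move=> pX pX' pY; exact: (ftBl sA hL (proj1 pX u) (proj1 pX' u) (proj1 pY u)). Qed.

Lemma gfC X Y u : pivfield X -> pivfield Y -> gf X Y u = gf Y X u.
Proof. by move=> pX pY; exact: (ftC sA hL (proj1 pX u) (proj1 pY u)). Qed.

Lemma gf0l Y u : pivfield Y -> gf 0 Y u = 0.
Proof. by move=> pY; exact: (ft0l sA hL (proj1 pY u)). Qed.

Lemma lie_gf V Y Z u : vfield V -> pivfield Y -> pivfield Z ->
  lie V (gf Y Z) u = gf (nabla V Y) Z u + gf Y (nabla V Z) u.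
Proof. by move=> vV pY pZ; exact: (cartan_metric hC vV pY pZ u). Qed.

Lemma smooth_gf Y Z : pivfield Y -> pivfield Z ->
  smooth (slit_atlas A) (gf Y Z : _ -> R^o).
Proof. exact: (smooth_ftfield sA hL). Qed.

Lemma lie_lie_gf V U Y Z u : vfield V -> vfield U -> pivfield Y -> pivfield Z ->
  lie V (lie U (gf Y Z)) u =
  gf (nabla V (nabla U Y)) Z u + gf (nabla U Y) (nabla V Z) u
  + (gf (nabla V Y) (nabla U Z) u + gf Y (nabla V (nabla U Z)) u).
Proof.
move=> vV vU pY pZ; have pUY := pn vU pY; have pUZ := pn vU pZ.
have -> : lie U (gf Y Z) = fun v => gf (nabla U Y) Z v + gf Y (nabla U Z) v.
  by apply/funext => v; exact: lie_gf.
refine (etrans (lieD sS (proj1 vV u) (smooth_gf pUY pZ) (smooth_gf pY pUZ)) _).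
exact (f_equal2 (fun p q : R => p + q) (lie_gf u vV pUY pZ) (lie_gf u vV pY pUZ)).
Qed.

Lemma skew_scalar (a b c d e f h k l m p d' f' k' : R) :
  l = a + b + (c + d) - (e + c + (b + f)) -> l = h + k ->
  m = - a + e + h -> p = - d' + f' + k' -> d' = d -> f' = f -> k' = k ->
  m + p = 0.
Proof. by move=> H1 H2 H3 H4 H5 H6 H7; lra. Qed.

(** Expand [V,U] g(Y,Z) both directly and as a commutator. The mixed terms, with one derivative on
    each argument, cancel. *)
Lemma curvature_skew V U Y Z u : vfield V -> vfield U -> pivfield Y -> pivfield Z ->
  gf (curv V U Y) Z u + gf (curv V U Z) Y u = 0.
Proof.
move=> vV vU pY pZ; have vVU := vbr vV vU.
have E := lie_bracket sS u vV vU (smooth_gf pY pZ).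
have {}E := etrans E (f_equal2 (fun p q : R => p - q) (lie_lie_gf u vV vU pY pZ)
  (lie_lie_gf u vU vV pY pZ)).
have E2 := lie_gf u vVU pY pZ.
have C (Y' Z' : slit A -> tvec A) : pivfield Y' -> pivfield Z' ->
    gf (curv V U Y') Z' u = - gf (nabla V (nabla U Y')) Z' u
      + gf (nabla U (nabla V Y')) Z' u + gf (nabla (bracket V U) Y') Z' u.
  move=> pY' pZ'; have p1 := pn vV (pn vU pY'); have p2 := pn vU (pn vV pY').
  have p3 := pn vVU pY'; have p1N := pivfieldN sA p1.
  refine (etrans (gfDl u (pivfieldD sA p1N p2) p3 pZ') _).
  refine (f_equal (fun r : R => r + _) (etrans (gfDl u p1N p2 pZ') _)).
  exact (f_equal (fun r : R => r + _) (gfNl u p1 pZ')).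
have C1 := C Y Z pY pZ.
have C2 := C Z Y pZ pY.
have S1 := gfC u (pn vV (pn vU pZ)) pY; have S2 := gfC u (pn vU (pn vV pZ)) pY.
have S3 := gfC u (pn vVU pZ) pY.
exact (skew_scalar E E2 C1 C2 S1 S2 S3).
Qed.

Lemma torsion_beta_beta X Y : pivfield X -> pivfield Y -> tors (beta X) (beta Y) = 0.
Proof. exact: (cartan_htorsion hC). Qed.

Lemma torsion_vlift_vlift X Y : pivfield X -> pivfield Y -> tors (vlift X) (vlift Y) = 0.
Proof.
move=> pX pY; rewrite /torsion (rho_bracket_vlift2 sA pX pY) !rho_vlift.
by rewrite (conn0r sA hD (vg pX)) (conn0r sA hD (vg pY)) !subrr.
Qed.

(** The torsion vanishes on two horizontal fields (Q = 0) and on two vertical ones, so after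
    [vfield_decomposition] only a value of T is left. [torsion_vlift] holds likewise. *)
Lemma torsion_beta X V : pivfield X -> vfield V ->
  tors (beta X) V = - T (nabla V eta) X.
Proof.
move=> pX vV; have pV := pivfield_rho sA vV; have pK := pn vV pe.
rewrite {1}(vfield_decomposition sA hL hC vV).
rewrite (torsionDr sA hD (vb pX) (vb pV) (vg pK)) torsion_beta_beta // add0r.
exact: torsionC.
Qed.

Lemma torsion_vlift X V : pivfield X -> vfield V ->
  tors (vlift X) V = T X (rho V).
Proof.
move=> pX vV; have pV := pivfield_rho sA vV; have pK := pn vV pe.
rewrite {1}(vfield_decomposition sA hL hC vV).
by rewrite (torsionDr sA hD (vg pX) (vb pV) (vg pK)) torsion_vlift_vlift // addr0.
Qed.

Lemma hvtorsionDl X X' Y : pivfield X -> pivfield X' -> pivfield Y ->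
  T (X + X') Y = T X Y + T X' Y.
Proof.
move=> pX pX' pY; have vX := vg pX; have vX' := vg pX'; have vY := vb pY.
rewrite /hvtorsion vliftD (torsionC nabla (vlift X + vlift X')).
rewrite (torsionDr sA hD vY vX vX') opprD.
by rewrite -(torsionC nabla (vlift X)) -(torsionC nabla (vlift X')).
Qed.

Lemma hvtorsionNl X Y : pivfield X -> pivfield Y -> T (- X) Y = - T X Y.
Proof.
move=> pX pY; have pN := pivfieldN sA pX; have := hvtorsionDl pX pN pY.
have T0 : T 0 Y = 0.
  have := hvtorsionDl (pivfield0 sA) (pivfield0 sA) pY.
  by rewrite addr0 => /(congr1 (fun F => F - T 0 Y)); rewrite subrr addrK.
by rewrite subrr T0 => /esym/eqP; rewrite addrC addr_eq0 => /eqP.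
Qed.

Lemma bracket_vlift_beta_eta X Y : pivfield X -> pivfield Y ->
  nabla (bracket (beta X) (vlift Y)) eta = nabla (beta X) Y + hP X Y.
Proof. by move=> pX pY; rewrite (hatPE sA hL hC pX pY) addrC subrK. Qed.

(** [first_bianchi] for beta X, gamma Y, beta Z: one curvature acts on rho (gamma Y) = 0, and
    [hatPE] supplies the vertical parts of the mixed brackets. *)
Lemma hv_bianchi X Y Z : pivfield X -> pivfield Y -> pivfield Z ->
  curv (beta X) (vlift Y) Z - curv (beta Z) (vlift Y) X =
  - (nabla (beta X) (T Y Z) + T (nabla (beta Z) Y + hP Z Y) X
     + T Y (nabla (beta Z) X - nabla (beta X) Z)
     + (- nabla (beta Z) (T Y X) - T (nabla (beta X) Y + hP X Y) Z)).
Proof.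
move=> pX pY pZ; have vX := vb pX; have vY := vg pY; have vZ := vb pZ.
have pr U : vfield U -> pivfield (rho U) := @pivfield_rho _ _ _ _ sA U.
have := first_bianchi sA hD vX vY vZ.
rewrite (rho_beta hC pX) (rho_beta hC pZ) rho_vlift.
have -> : curv (beta Z) (beta X) 0 = 0.
  rewrite /curvature (conn0r sA hD vX) (conn0r sA hD vZ) (conn0r sA hD vX).
  by rewrite (conn0r sA hD (vbr vZ vX)) oppr0 !addr0.
rewrite (curvatureC sA hD vY vZ pX) addr0 => ->.
rewrite (torsion_beta_beta pZ pX) (conn0r sA hD vY) add0r.
rewrite (torsion_beta pX (vbr vY vZ)) (torsion_beta pZ (vbr vX vY)).
rewrite (torsion_vlift pY (vbr vZ vX)) (rho_bracket_beta hC pZ pX).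
rewrite (bracket_vlift_beta_eta pX pY) (bracketC (vlift Y)).
rewrite (connNl sA hD (vbr vZ vY) pe) (bracket_vlift_beta_eta pZ pY).
have pZY := pivfieldD sA (pn vZ pY) (pP pZ pY).
rewrite (hvtorsionNl pZY pX) opprK.
rewrite (torsionC nabla (beta X)) (connNr sA hD vZ (pT pY pX)).
by [].
Qed.

Lemma gf_hvtorsion X Y Z u : pivfield X -> pivfield Y -> pivfield Z ->
  gf (T X Y) Z u = gf (T X Z) Y u.
Proof. by move=> pX pY pZ; exact: (cartan_hvtorsion hC pX pY pZ u). Qed.

(** The property shared by all terms on the right of [hv_bianchi]. *)
Definition perp_eta X := forall u, gf X eta u = 0.

Lemma perp_etaD X Y : pivfield X -> pivfield Y ->
  perp_eta X -> perp_eta Y -> perp_eta (X + Y).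
Proof.
move=> pX pY X0 Y0 u; refine (etrans (gfDl u pX pY pe) _).
by rewrite X0 Y0 addr0.
Qed.

Lemma perp_etaN X : pivfield X -> perp_eta X -> perp_eta (- X).
Proof.
move=> pX X0 u; refine (etrans (gfNl u pX pe) _).
by rewrite X0 oppr0.
Qed.

Lemma perp_eta_hvtorsion X Y : pivfield X -> pivfield Y -> perp_eta (T X Y).
Proof.
move=> pX pY u; refine (etrans (gf_hvtorsion u pX pY pe) _).
by rewrite (hvtorsion_eta sA hL hC pX) (gf0l u pY).
Qed.

Lemma perp_eta_nabla X Y : pivfield X -> pivfield Y -> perp_eta Y ->
  perp_eta (nabla (beta X) Y).
Proof.
move=> pX pY Y0 u; have vX := vb pX; have p0 := pivfield0 sA.
(* [E2] shows that the Lie derivative of the zero function vanishes, by writing this function as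
   g(0, eta). With nabla_{beta X} eta = 0, [E1] then leaves one term. *)
have E1 := lie_gf u vX pY pe; have E2 := lie_gf u vX p0 pe.
rewrite (nabla_beta_eta hC pX) in E1 E2; rewrite (conn0r sA hD vX) in E2.
have YE : gf Y eta = gf 0 eta.
  by apply/funext => v; exact (etrans (Y0 v) (esym (gf0l v pe))).
have Z0 := gf0l u p0.
have Y00 := etrans (gfC u pY p0) (gf0l u pY).
have Ze := gf0l u pe.
rewrite YE E2 Z0 Ze Y00 !addr0 in E1.
exact (esym E1).
Qed.

Lemma hatP_curvature X Y : curv (beta X) (vlift Y) eta = hP X Y.
Proof. by []. Qed.

(** Skewness of the curvature with both arguments equal to eta. *)
Lemma perp_eta_hatP X Y : pivfield X -> pivfield Y -> perp_eta (hP X Y).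
Proof.
move=> pX pY u.
have E : gf (hP X Y) eta u + gf (hP X Y) eta u = 0.
  exact (curvature_skew u (vb pX) (vg pY) pe pe).
by move/eqP : E; rewrite -mulr2n mulrn_eq0 /= => /eqP.
Qed.

Lemma hatP_swap_scalar (a b c d : R) : a + c = 0 -> b + d = 0 -> c - d = 0 -> a = b.
Proof. by move=> H1 H2 H3; lra. Qed.

(** By skewness the two sides are, up to sign, the eta-components of the curvatures on the left of
    [hv_bianchi]. Its right side is orthogonal to eta term by term. *)
Lemma gf_hatP_swap X Y Z u : pivfield X -> pivfield Y -> pivfield Z ->
  gf (hP X Y) Z u = gf (hP Z Y) X u.
Proof.
move=> pX pY pZ; have vX := vb pX; have vY := vg pY; have vZ := vb pZ.
have E1 := curvature_skew u vX vY pe pZ.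
have E2 := curvature_skew u vZ vY pe pX.
have p1 := pivfield_curvature sA hD vX vY pZ.
have p2 := pivfield_curvature sA hD vZ vY pX.
have E3 := gfBl u p1 p2 pe.
have pXY := pn vX pY; have pZY := pn vZ pY; have pZX := pn vZ pX; have pXZ := pn vX pZ.
have q1 := pivfieldD sA pXY (pP pX pY); have q2 := pivfieldD sA pZY (pP pZ pY).
have q3 := pivfieldB sA pZX pXZ.
have E4 : gf (curv (beta X) (vlift Y) Z - curv (beta Z) (vlift Y) X) eta u = 0.
  rewrite (hv_bianchi pX pY pZ).
  have t1 := pn vX (pT pY pZ); have t2 := pT q2 pX; have t3 := pT pY q3.
  have t4 := pn vZ (pT pY pX); have t5 := pT q1 pZ.
  have t12 := pivfieldD sA t1 t2; have t123 := pivfieldD sA t12 t3.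
  have t4N := pivfieldN sA t4; have t5N := pivfieldN sA t5.
  have t45 := pivfieldD sA t4N t5N.
  apply: (perp_etaN (pivfieldD sA t123 t45)); apply: (perp_etaD t123 t45).
    apply: (perp_etaD t12 t3); last exact: perp_eta_hvtorsion.
    apply: (perp_etaD t1 t2); last exact: perp_eta_hvtorsion.
    by apply: perp_eta_nabla; [|exact: pT|exact: perp_eta_hvtorsion].
  apply: (perp_etaD t4N t5N).
    apply: (perp_etaN t4).
    by apply: perp_eta_nabla; [|exact: pT|exact: perp_eta_hvtorsion].
  by apply: (perp_etaN t5); exact: perp_eta_hvtorsion.
exact (hatP_swap_scalar E1 E2 (etrans (esym E3) E4)).
Qed.

(** By the swap, g(hatP(eta,Y),Z) = g(hatP(Z,Y),eta), which is 0. *)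
Lemma hatP_eta Y : pivfield Y -> hP eta Y = 0.
Proof.
move=> pY; apply: (eq_ftfield sA hL (pP pe pY) (pivfield0 sA)) => Z pZ u.
have E := etrans (gf_hatP_swap u pe pY pZ) (perp_eta_hatP pZ pY u).
exact (etrans E (esym (gf0l u pZ))).
Qed.

(* [beta eta] is the geodesic spray. *)
Definition spray_torsion X Y : slit A -> tvec A :=
  nabla (beta eta) (T Y X) - T (nabla (beta eta) Y) X - T Y (nabla (beta eta) X).

Lemma spray_torsionC X Y : pivfield X -> pivfield Y ->
  spray_torsion X Y = spray_torsion Y X.
Proof.
move=> pX pY; have vE := vb pe; rewrite /spray_torsion.
rewrite (hvtorsionC sA hL hC pY pX) (hvtorsionC sA hL hC (pn vE pY) pX).
by rewrite (hvtorsionC sA hL hC pY (pn vE pX)) addrAC.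
Qed.

Lemma pivfield_spray_torsion X Y : pivfield X -> pivfield Y ->
  pivfield (spray_torsion X Y).
Proof.
move=> pX pY; have vE := vb pe.
apply: (pivfieldB sA); last exact: (pT pY (pn vE pX)).
by apply: (pivfieldB sA); [exact: (pn vE (pT pY pX))|exact: (pT (pn vE pY) pX)].
Qed.

Lemma spray_scalar (l l' a b c a' b' c' : R) :
  l = l' -> a = a' -> b = b' -> c = c' -> l - a - b - c = l' - c' - b' - a'.
Proof. by move=> -> -> -> ->; ring. Qed.

Lemma hatP_scalar (a b c d e f : R) : a - c = e -> b - d = f -> a = b -> e = f ->
  c + d = 0 -> a = e.
Proof. by move=> H1 H2 H3 H4 H5; lra. Qed.

Lemma gf_spray_torsion X Y W u : pivfield X -> pivfield Y -> pivfield W ->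
  gf (spray_torsion X Y) W u =
  lie (beta eta) (gf (T Y X) W) u - gf (T Y X) (nabla (beta eta) W) u
  - gf (T (nabla (beta eta) Y) X) W u - gf (T Y (nabla (beta eta) X)) W u.
Proof.
move=> pX pY pW; have vE := vb pe.
have p1 := pn vE (pT pY pX); have p2 := pT (pn vE pY) pX; have p3 := pT pY (pn vE pX).
have E := lie_gf u vE (pT pY pX) pW.
refine (etrans (gfBl u (pivfieldB sA p1 p2) p3 pW) (f_equal (fun r : R => r - _) _)).
refine (etrans (gfBl u p1 p2 pW) (f_equal (fun r : R => r - _) _)).
by rewrite E addrK.
Qed.

(** T(Y,.) is self-adjoint for g, and nabla g = 0 passes this on to its covariant derivative along
    beta eta. *)
Lemma gf_spray_torsion_swap X Y W u : pivfield X -> pivfield Y -> pivfield W ->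
  gf (spray_torsion X Y) W u = gf (spray_torsion W Y) X u.
Proof.
move=> pX pY pW; have vE := vb pe.
refine (etrans (gf_spray_torsion u pX pY pW) (etrans _ (esym (gf_spray_torsion u pW pY pX)))).
have E0 : gf (T Y X) W = gf (T Y W) X.
  by apply/funext => v; exact: gf_hvtorsion.
have E1 := gf_hvtorsion u pY pX (pn vE pW).
have E2 := gf_hvtorsion u (pn vE pY) pX pW.
have E3 := gf_hvtorsion u pY (pn vE pX) pW.
exact (spray_scalar (f_equal (fun F => lie (beta eta) F u) E0) E1 E2 E3).
Qed.

(** In [hv_bianchi] with Z = eta, the terms T(.,eta), nabla_{beta X} eta and hatP(eta,Y) all
    vanish. *)
Lemma hatP_spray X Y : pivfield X -> pivfield Y ->
  hP X Y - curv (beta eta) (vlift Y) X = spray_torsion X Y.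
Proof.
move=> pX pY; have vX := vb pX; have vE := vb pe.
rewrite -hatP_curvature (hv_bianchi pX pY pe) (hatP_eta pY) addr0.
rewrite (hvtorsion_eta sA hL hC pY) (conn0r sA hD vX) add0r.
rewrite (nabla_beta_eta hC pX) subr0.
rewrite (hvtorsion_eta sA hL hC (pivfieldD sA (pn vX pY) (pP pX pY))) subr0.
rewrite /spray_torsion.
by move: (T (nabla (beta eta) Y) X) (T Y (nabla (beta eta) X)) (nabla (beta eta) (T Y X)) => a b c; field_ring.
Qed.

(** In [hatP_spray], paired with W, the terms in hatP and in the spray torsion are symmetric in X
    and W while the curvature term is skew. The curvature term is therefore 0. *)
Lemma hatP_spray_torsion X Y : pivfield X -> pivfield Y ->
  hP X Y = spray_torsion X Y.
Proof.
move=> pX pY; apply: (eq_ftfield sA hL (pP pX pY) (pivfield_spray_torsion pX pY)).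
move=> W pW u; have vE := vb pe; have vY := vg pY.
have pc Z : pivfield Z -> pivfield (curv (beta eta) (vlift Y) Z).
  by move=> pZ; exact: (pivfield_curvature sA hD vE vY pZ).
have H Z Z' : pivfield Z -> pivfield Z' ->
    gf (hP Z Y) Z' u - gf (curv (beta eta) (vlift Y) Z) Z' u = gf (spray_torsion Z Y) Z' u.
  by move=> pZ pZ'; rewrite -(hatP_spray pZ pY); exact (esym (gfBl u (pP pZ pY) (pc _ pZ) pZ')).
exact (hatP_scalar (H X W pX pW) (H W X pW pX) (gf_hatP_swap u pX pY pW)
  (gf_spray_torsion_swap u pX pY pW) (curvature_skew u vE vY pX pW)).
Qed.

Lemma hatPC X Y : pivfield X -> pivfield Y -> hP X Y = hP Y X.
Proof.
move=> pX pY; rewrite (hatP_spray_torsion pX pY) (hatP_spray_torsion pY pX).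
exact: spray_torsionC.
Qed.

End LandsbergSymmetry.

(** * Change of the Hashiguchi connection *)

Section Hashiguchi.
Context {R : realType} {M : Type} {n : nat} {A : atlas R M n}.
Hypothesis sA : smooth_atlas A.
Variables (L : M -> tvec A -> R) (nabla : connop A)
  (beta : (slit A -> tvec A) -> (slit A -> stvec A)).
Hypotheses (hL : finsler L) (hC : cartan_connection L nabla beta).
Local Notation hD := (linear_connection_additive (cartan_linear hC)).
Local Notation D := (hashiguchi nabla beta).
Local Notation pr := (pivfield_rho sA).

Lemma hashiguchi_additive : additive_connop D.
Proof.
split=> [X Y vX pY|X X' Y vX vX' pY|X Y Y' vX pY pY']; rewrite /hashiguchi.
- apply: (pivfieldD sA); first exact: (op_smooth hD vX pY).
  exact: (pivfield_hatP sA hC (pr vX) pY).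
- rewrite (op_addl hD vX vX' pY) rhoD (hatPDl sA hL hC (pr vX) (pr vX') pY).
  exact: addrACA.
- rewrite (op_addr hD vX pY pY') (hatPDr sA hL hC (pr vX) pY pY').
  exact: addrACA.
Qed.

Lemma hashiguchi_vlift X Y : pivfield Y -> D (vlift X) Y = nabla (vlift X) Y.
Proof. by move=> pY; rewrite /hashiguchi rho_vlift (hatP0l sA hL hC pY) addr0. Qed.

Lemma hashiguchi_rho_bracket X Y : pivfield X -> pivfield Y ->
  rho (bracket (beta X) (beta Y)) = D (beta X) Y - D (beta Y) X.
Proof.
move=> pX pY; rewrite (rho_bracket_beta hC pX pY) /hashiguchi.
rewrite (rho_beta hC pX) (rho_beta hC pY) (hatPC sA hL hC pX pY).
by move: (nabla _ Y) (nabla _ X) (hatP _ _ _ _) => a b c; field_ring.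
Qed.

Lemma hashiguchi_hvtorsion X Y : pivfield X -> pivfield Y ->
  hvtorsion nabla beta Y X = D (vlift Y) X + rho (bracket (beta X) (vlift Y)).
Proof.
move=> pX pY.
rewrite (hvtorsionE sA hC pY pX (vbeta hC pX) (rho_beta hC pX)).
by rewrite (hashiguchi_vlift Y pX) (bracketC (beta X)) rhoN.
Qed.

End Hashiguchi.

(** * Comparison of the two Cartan connections *)

Section ConformalCartan.
Context {R : realType} {M : Type} {n : nat} {A : atlas R M n}.
Hypothesis sA : smooth_atlas A.
Variables (L L' : M -> tvec A -> R) (sigma : M -> R) (nabla nabla' : connop A)
  (beta beta' : (slit A -> tvec A) -> (slit A -> stvec A)).
Hypotheses (hL : finsler L) (hL' : finsler L') (hc : conformal L L' sigma).
Hypotheses (hC : cartan_connection L nabla beta)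
  (hC' : cartan_connection L' nabla' beta').
Local Notation sS := (slit_smooth_atlas sA).
Local Notation eta := (etabar (A := A)).

Lemma conformal_scalar (k a b e e' : R) : k != 0 ->
  2 * (k * a) = e' -> e' = k * e -> 2 * b = e -> a = b.
Proof.
move=> k0 H1 H2 H3; apply: (mulfI k0).
by apply: double_inj; rewrite H1 H2 -H3; ring.
Qed.

(** With the common lift beta Y both torsions contain the same bracket, so it suffices that they are
    equal. They are, because the conformal factor multiplies the metric and [ctens] alike and
    cancels. *)
Lemma conformal_nabla_vlift X Y : pivfield X -> pivfield Y ->
  nabla' (vlift X) Y = nabla (vlift X) Y.
Proof.
move=> pX pY; have vY := vbeta hC pY; have rY := rho_beta hC pY.
have E := hvtorsionE sA hC pX pY vY rY; have E' := hvtorsionE sA hC' pX pY vY rY.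
have pT := pivfield_T sA hC pX pY; have pT' := pivfield_T sA hC' pX pY.
suff TT : hvtorsion nabla' beta' X Y = hvtorsion nabla beta X Y.
  move: TT; rewrite E E'.
  by move/(congr1 (fun F => F + rho (bracket (vlift X) (beta Y)))); rewrite !subrK.
apply: (eq_ftfield sA hL pT' pT) => Z pZ u.
have [i du] := atlas_cover sA (base u).
have E1 := hvtorsion_ctens sA hL hC pX pY pZ du.
have E2 := hvtorsion_ctens sA hL' hC' pX pY pZ du.
have E3 := ctens_conformal sA hL hc (X u i) (Y u i) (Z u i) du.
have E4 := hc (proj1 pT' u) (proj1 pZ u); rewrite E4 in E2.
exact (conformal_scalar (lt0r_neq0 (expR_gt0 _)) E2 E3 E1).
Qed.

(** The right side projects to X, and the subtracted term is chosen so that its K' vanishes, K'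
    being a left inverse of gamma. *)
Lemma conformal_beta X : pivfield X ->
  beta' X = beta X - vlift (nabla' (beta X) eta - nabla (beta X) eta).
Proof.
move=> pX; have pe := pivfield_eta sA; have vX := vbeta hC pX.
have pN := pivfieldB sA (pnabla hC' vX pe) (pnabla hC vX pe).
have vN := vfield_vlift sA pN.
apply/esym/(beta_unique sA hL' hC').
- exact: (vfieldB sS vX vN).
- by rewrite rhoD rhoN rho_vlift subr0 (rho_beta hC pX).
- rewrite (connBl sA (linear_connection_additive (cartan_linear hC')) vX vN pe).
  by rewrite (nabla_vlift_eta sA hL' hC' pN) (nabla_beta_eta hC pX) subr0 subrr.
Qed.

End ConformalCartan.

(** * Curvatures of a deformed connection, for abstract D and D' *)

Section DeformedCurvature.
Context {R : realType} {M : Type} {n : nat} {A : atlas R M n}.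
Hypothesis sA : smooth_atlas A.
Local Notation sS := (slit_smooth_atlas sA).
Variables (D D' : connop A) (beta beta' : (slit A -> tvec A) -> (slit A -> stvec A))
  (N : (slit A -> tvec A) -> (slit A -> tvec A))
  (T : (slit A -> tvec A) -> (slit A -> tvec A) -> (slit A -> tvec A)).
Hypotheses (aD : additive_connop D) (aD' : additive_connop D').
Hypothesis vbeta : forall X, pivfield X -> vfield (beta X).
Hypothesis betaD : forall X Y, pivfield X -> pivfield Y ->
  beta (X + Y) = beta X + beta Y.
Hypothesis split_vfield : forall V, vfield V ->
  exists2 W, pivfield W & V = beta (rho V) + vlift W.
Hypothesis pN : forall X, pivfield X -> pivfield (N X).
Hypothesis beta'E : forall X, pivfield X -> beta' X = beta X - vlift (N X).
Hypothesis deformed_op_vlift : forall X Y, pivfield X -> pivfield Y ->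
  D' (vlift X) Y = D (vlift X) Y.
Hypothesis TE : forall X Y, pivfield X -> pivfield Y ->
  T Y X = D (vlift Y) X + rho (bracket (beta X) (vlift Y)).
Hypothesis torsion_free : forall X Y, pivfield X -> pivfield Y ->
  rho (bracket (beta X) (beta Y)) = D (beta X) Y - D (beta Y) X.

Definition deformation X Y := D' (beta X) Y - D (beta X) Y.
Local Notation B := deformation.
Local Notation vg := (vfield_vlift sA).
Local Notation vbr := (vfield_bracket sS).
Local Notation pr := (pivfield_rho sA).
Local Notation pD := (op_smooth aD).

Lemma pivfield_deformation X Y : pivfield X -> pivfield Y -> pivfield (B X Y).
Proof.
move=> pX pY; have vX := vbeta pX.
exact: (pivfieldB sA (op_smooth aD' vX pY) (op_smooth aD vX pY)).
Qed.

Lemma deformationDl X X' Y : pivfield X -> pivfield X' -> pivfield Y ->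
  B (X + X') Y = B X Y + B X' Y.
Proof.
move=> pX pX' pY; have vX := vbeta pX; have vX' := vbeta pX'.
rewrite /deformation (betaD pX pX') (op_addl aD vX vX' pY) (op_addl aD' vX vX' pY).
by rewrite opprD addrACA.
Qed.

Lemma deformationDr X Y Y' : pivfield X -> pivfield Y -> pivfield Y' ->
  B X (Y + Y') = B X Y + B X Y'.
Proof.
move=> pX pY pY'; have vX := vbeta pX.
rewrite /deformation (op_addr aD vX pY pY') (op_addr aD' vX pY pY').
by rewrite opprD addrACA.
Qed.

Lemma deformationBr X Y Y' : pivfield X -> pivfield Y -> pivfield Y' ->
  B X (Y - Y') = B X Y - B X Y'.
Proof.
move=> pX pY pY'; have := deformationDr pX (pivfieldB sA pY pY') pY'.
by rewrite subrK => ->; rewrite addrK.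
Qed.

Lemma deformationBl X X' Y : pivfield X -> pivfield X' -> pivfield Y ->
  B (X - X') Y = B X Y - B X' Y.
Proof.
move=> pX pX' pY; have := deformationDl (pivfieldB sA pX pX') pX' pY.
by rewrite subrK => ->; rewrite addrK.
Qed.

Lemma deformation0l Y : pivfield Y -> B 0 Y = 0.
Proof.
move=> pY; have := deformationDl (pivfield0 sA) (pivfield0 sA) pY.
by rewrite addr0 => /(congr1 (fun F => F - B 0 Y)); rewrite subrr addrK.
Qed.

(** On the vertical part of [V] the two operators agree, so only beta (rho V) contributes to the
    difference. *)
Lemma deformed_opE V Y : vfield V -> pivfield Y -> D' V Y = D V Y + B (rho V) Y.
Proof.
move=> vV pY; have [W pW VE] := split_vfield vV.
have vb := vbeta (pr vV); have vW := vg pW.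
have E' := op_addl aD' vb vW pY; have E := op_addl aD vb vW pY.
rewrite -VE (deformed_op_vlift pW pY) in E'; rewrite -VE in E.
rewrite E E' /deformation.
by move: (D' _ _) (D (beta _) _) (D (vlift _) _) => a b c; field_ring.
Qed.

Lemma deformed_op_beta X Y : pivfield X -> pivfield Y ->
  D' (beta' X) Y = D (beta X) Y + B X Y - D (vlift (N X)) Y.
Proof.
move=> pX pY; have vX := vbeta pX; have vN := vg (pN pX).
rewrite (beta'E pX) (connBl sA aD' vX vN pY) (deformed_op_vlift (pN pX) pY) /deformation.
by move: (D' _ _) (D (beta _) _) (D (vlift _) _) => a b c; field_ring.
Qed.

Lemma deformed_op_vbracket X Y Z : pivfield X -> pivfield Y -> pivfield Z ->
  D' (bracket (vlift X) (vlift Y)) Z = D (bracket (vlift X) (vlift Y)) Z.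
Proof.
move=> pX pY pZ.
by rewrite (deformed_opE (vbr (vg pX) (vg pY)) pZ) (rho_bracket_vlift2 sA pX pY)
  deformation0l // addr0.
Qed.

Lemma vcurv_deformed X Y Z : pivfield X -> pivfield Y -> pivfield Z ->
  vcurv D' X Y Z = vcurv D X Y Z.
Proof.
move=> pX pY pZ; rewrite /vcurv /curvature (deformed_op_vbracket pX pY pZ).
rewrite (deformed_op_vlift pY pZ) (deformed_op_vlift pX pZ).
by rewrite (deformed_op_vlift pX (pD (vg pY) pZ)) (deformed_op_vlift pY (pD (vg pX) pZ)).
Qed.

(** By [TE] the bracket projects to T(Y,X) - D_{gamma Y} X. The first term is the torsion term of
    the result; the second completes a covariant derivative of B. *)
Lemma deformed_op_bracket_mixed X Y Z : pivfield X -> pivfield Y -> pivfield Z ->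
  D' (bracket (beta X) (vlift Y)) Z = D (bracket (beta X) (vlift Y)) Z
    + (B (T Y X) Z - B (D (vlift Y) X) Z).
Proof.
move=> pX pY pZ; have pYX := pD (vg pY) pX; have vXY := vbr (vbeta pX) (vg pY).
rewrite (deformed_opE vXY pZ) (TE pX pY) (deformationDl pYX (pr vXY) pZ).
by rewrite [B (D _ _) Z + _]addrC addrK.
Qed.

Lemma hvcurv_deformed X Y Z : pivfield X -> pivfield Y -> pivfield Z ->
  hvcurv D' beta' X Y Z = hvcurv D beta X Y Z - vcurv D (N X) Y Z
    + covder2 D (vlift Y) B X Z + B (T Y X) Z.
Proof.
move=> pX pY pZ; have pNX := pN pX; have vX := vbeta pX.
have vN := vg pNX; have vY := vg pY.
have pYZ := pD vY pZ; have pXZ := pD vX pZ; have pNZ := pD vN pZ.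
have pBZ := pivfield_deformation pX pZ.
rewrite /hvcurv /vcurv /curvature /covder2.
rewrite (deformed_op_vlift pY pZ) (deformed_op_beta pX pYZ) (deformed_op_beta pX pZ).
rewrite (deformed_op_vlift pY (pivfieldB sA (pivfieldD sA pXZ pBZ) pNZ)).
rewrite (connBr sA aD vY (pivfieldD sA pXZ pBZ) pNZ) (op_addr aD vY pXZ pBZ).
have E : D' (bracket (beta' X) (vlift Y)) Z =
    D (bracket (beta X) (vlift Y)) Z + (B (T Y X) Z - B (D (vlift Y) X) Z)
    - D (bracket (vlift (N X)) (vlift Y)) Z.
  rewrite (beta'E pX) (bracketBl sS vX vN vY).
  refine (etrans (connBl sA aD' (vbr vX vY) (vbr vN vY) pZ) _).
  exact (f_equal2 (fun F G => F - G) (deformed_op_bracket_mixed pX pY pZ) (deformed_op_vbracket pNX pY pZ)).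
rewrite E.
(* Once these terms are made atoms, what is left is a linear identity among them. *)
generalize (D (beta X) (D (vlift Y) Z)) (D (vlift (N X)) (D (vlift Y) Z))
  (D (vlift Y) (D (beta X) Z)) (D (vlift Y) (D (vlift (N X)) Z))
  (D (vlift Y) (B X Z)) (D (bracket (beta X) (vlift Y)) Z)
  (D (bracket (vlift (N X)) (vlift Y)) Z) (B (T Y X) Z) (B (D (vlift Y) X) Z)
  (B X (D (vlift Y) Z)).
by move=> *; field_ring.
Qed.

Lemma deformed_op_beta2 X Y Z : pivfield X -> pivfield Y -> pivfield Z ->
  D' (beta' X) (D' (beta' Y) Z) =
  D (beta X) (D (beta Y) Z) + D (beta X) (B Y Z) - D (beta X) (D (vlift (N Y)) Z)
  + (B X (D (beta Y) Z) + B X (B Y Z) - B X (D (vlift (N Y)) Z))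
  - (D (vlift (N X)) (D (beta Y) Z) + D (vlift (N X)) (B Y Z)
     - D (vlift (N X)) (D (vlift (N Y)) Z)).
Proof.
move=> pX pY pZ; have vX := vbeta pX; have vN := vg (pN pX).
have p1 := pD (vbeta pY) pZ; have p2 := pivfield_deformation pY pZ.
have p3 := pD (vg (pN pY)) pZ; have p12 := pivfieldD sA p1 p2.
rewrite (deformed_op_beta pY pZ) (deformed_op_beta pX (pivfieldB sA p12 p3)).
rewrite (connBr sA aD vX p12 p3) (op_addr aD vX p1 p2).
rewrite (connBr sA aD vN p12 p3) (op_addr aD vN p1 p2).
by rewrite (deformationBr pX p12 p3) (deformationDr pX p1 p2).
Qed.

Lemma deformed_op_bracket_beta X Y Z : pivfield X -> pivfield Y -> pivfield Z ->
  D' (bracket (beta' X) (beta' Y)) Z =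
  D (bracket (beta X) (beta Y)) Z + (B (D (beta X) Y) Z - B (D (beta Y) X) Z)
  - (D (bracket (beta X) (vlift (N Y))) Z
     + (B (T (N Y) X) Z - B (D (vlift (N Y)) X) Z))
  + (D (bracket (beta Y) (vlift (N X))) Z
     + (B (T (N X) Y) Z - B (D (vlift (N X)) Y) Z))
  + D (bracket (vlift (N X)) (vlift (N Y))) Z.
Proof.
move=> pX pY pZ; have pNX := pN pX; have pNY := pN pY.
have vX := vbeta pX; have vY := vbeta pY; have vNX := vg pNX; have vNY := vg pNY.
rewrite (beta'E pX) (beta'E pY) (bracketBl sS vX vNX (vfieldB sS vY vNY)).
rewrite (bracketBr sS vX vY vNY) (bracketBr sS vNX vY vNY).
have v1 := vbr vX vY; have v2 := vbr vX vNY; have v3 := vbr vNX vY.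
have v4 := vbr vNX vNY.
(* Here the symmetry of hatP enters, through [torsion_free]. *)
have E1 : D' (bracket (beta X) (beta Y)) Z = D (bracket (beta X) (beta Y)) Z
    + (B (D (beta X) Y) Z - B (D (beta Y) X) Z).
  rewrite (deformed_opE v1 pZ) (torsion_free pX pY).
  by rewrite (deformationBl (pD vX pY) (pD vY pX) pZ).
have E2 := deformed_op_bracket_mixed pX pNY pZ.
(* The bracket is turned round so that the horizontal field comes first, as in
   [deformed_op_bracket_mixed]. *)
have E3 : D' (bracket (vlift (N X)) (beta Y)) Z = - D' (bracket (beta Y) (vlift (N X))) Z.
  by rewrite (bracketC (vlift (N X)) (beta Y)); exact: (connNl sA aD' (vbr vY vNX) pZ).
have {}E3 := etrans E3 (f_equal (fun F => - F) (deformed_op_bracket_mixed pY pNX pZ)).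
have E4 := deformed_op_vbracket pNX pNY pZ.
refine (etrans (connBl sA aD' (vfieldB sS v1 v2) (vfieldB sS v3 v4) pZ) _).
refine (etrans (f_equal2 (fun F G => F - G) (connBl sA aD' v1 v2 pZ) (connBl sA aD' v3 v4 pZ)) _).
refine (etrans (f_equal2 (fun F G => F - G) (f_equal2 (fun F G => F - G) E1 E2)
  (f_equal2 (fun F G => F - G) E3 E4)) _).
generalize (D (bracket (beta X) (beta Y)) Z)
  (D (bracket (vlift (N X)) (vlift (N Y))) Z)
  (D (bracket (beta X) (vlift (N Y))) Z) (D (bracket (beta Y) (vlift (N X))) Z)
  (B (D (beta X) Y) Z) (B (D (beta Y) X) Z) (B (T (N X) Y) Z) (B (T (N Y) X) Z)
  (B (D (vlift (N X)) Y) Z) (B (D (vlift (N Y)) X) Z).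
by move=> *; field_ring.
Qed.

Lemma hcurv_deformed X Y Z : pivfield X -> pivfield Y -> pivfield Z ->
  hcurv D' beta' X Y Z = hcurv D beta X Y Z + vcurv D (N X) (N Y) Z
    - alternate (fun X Y =>
        hvcurv D beta X (N Y) Z + covder2 D (beta X) B Y Z
        - covder2 D (vlift (N X)) B Y Z + B X (B Y Z)
        - B (T (N X) Y) Z) X Y.
Proof.
move=> pX pY pZ; rewrite /hcurv {1}/curvature.
(* The second order part is expanded in both orders of X and Y; the difference produces the
   alternation. *)
rewrite (deformed_op_beta2 pX pY pZ) (deformed_op_beta2 pY pX pZ) (deformed_op_bracket_beta pX pY pZ).
rewrite /alternate /hvcurv /vcurv /curvature /covder2.
generalize (D (beta X) (D (beta Y) Z)) (D (beta Y) (D (beta X) Z))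
  (D (beta X) (B Y Z)) (D (beta Y) (B X Z)) (B X (B Y Z)) (B Y (B X Z))
  (D (beta X) (D (vlift (N Y)) Z)) (D (beta Y) (D (vlift (N X)) Z))
  (D (vlift (N X)) (D (beta Y) Z)) (D (vlift (N Y)) (D (beta X) Z))
  (D (vlift (N X)) (B Y Z)) (D (vlift (N Y)) (B X Z))
  (D (vlift (N X)) (D (vlift (N Y)) Z)) (D (vlift (N Y)) (D (vlift (N X)) Z))
  (B X (D (beta Y) Z)) (B Y (D (beta X) Z))
  (B X (D (vlift (N Y)) Z)) (B Y (D (vlift (N X)) Z))
  (D (bracket (beta X) (beta Y)) Z)
  (D (bracket (vlift (N X)) (vlift (N Y))) Z)
  (D (bracket (beta X) (vlift (N Y))) Z) (D (bracket (beta Y) (vlift (N X))) Z)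
  (B (D (beta X) Y) Z) (B (D (beta Y) X) Z) (B (T (N X) Y) Z) (B (T (N Y) X) Z)
  (B (D (vlift (N X)) Y) Z) (B (D (vlift (N Y)) X) Z).
by move=> *; field_ring.
Qed.

End DeformedCurvature.

Theorem theorem2p10 (R : realType) (n : nat) (M : topologicalType)
    (A : atlas R M n) (hA : smooth_manifold A)
    (L L' : M -> tvec A -> R) (hL : finsler L) (hL' : finsler L')
    (sigma : M -> R) (sigma_smooth : smooth A (sigma : M -> R^o))
    (sigma_pos : forall p, 0 < sigma p) (hconf : conformal L L' sigma)
    (nabla nabla' : connop A)
    (beta beta' : (slit A -> tvec A) -> (slit A -> stvec A))
    (hnabla : cartan_connection L nabla beta)
    (hnabla' : cartan_connection L' nabla' beta') :
  let D := hashiguchi nabla beta in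
  let D' := hashiguchi nabla' beta' in
  let T := hvtorsion nabla beta in
  let S := vcurv D in
  let P := hvcurv D beta in
  let Rc := hcurv D beta in
  let S' := vcurv D' in
  let P' := hvcurv D' beta' in
  let Rc' := hcurv D' beta' in
  let N := fun X => nabla' (beta X) (etabar (A := A))
                    - nabla (beta X) (etabar (A := A)) in
  let omega := fun X Y => D' X Y - D X Y in
  let B := fun X Y => omega (beta X) Y in
  forall X Y Z : slit A -> tvec A, pivfield X -> pivfield Y -> pivfield Z ->
  [/\ S' X Y Z = S X Y Z,
      P' X Y Z = P X Y Z - S (N X) Y Z + covder2 D (vlift Y) B X Z
                 + B (T Y X) Z &
      Rc' X Y Z = Rc X Y Z + S (N X) (N Y) Z
        - alternate (fun X Y =>
            P X (N Y) Z + covder2 D (beta X) B Y Z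
            - covder2 D (vlift (N X)) B Y Z + B X (B Y Z)
            - B (T (N X) Y) Z) X Y].
Proof.
move=> D D' T S P Rc S' P' Rc' N omega B X Y Z pX pY pZ.
have sA := base_smooth_atlas hA; have pe := pivfield_eta sA.
have aD := hashiguchi_additive sA hL hnabla.
have aD' := hashiguchi_additive sA hL' hnabla'.
have vb := vbeta hnabla.
have bD := betaD sA hL hnabla.
have pN U : pivfield U -> pivfield (N U).
  move=> pU; exact: (pivfieldB sA (pnabla hnabla' (vb _ pU) pe) (pnabla hnabla (vb _ pU) pe)).
have bE : forall U, pivfield U -> beta' U = beta U - vlift (N U).
  by move=> U pU; exact: (conformal_beta sA hL' hnabla hnabla').
(* Each Hashiguchi connection agrees with its Cartan connection on vertical fields, and there the
   two Cartan connections coincide. *)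
have DE U V : pivfield U -> pivfield V -> D' (vlift U) V = D (vlift U) V.
  move=> pU pV; refine (etrans (hashiguchi_vlift sA hL' hnabla' U pV) _).
  refine (etrans (conformal_nabla_vlift sA hL hL' hconf hnabla hnabla' pU pV) _).
  exact (esym (hashiguchi_vlift sA hL hnabla U pV)).
have sV : forall V : slit A -> stvec A, vfield V ->
    exists2 W, pivfield W & V = beta (rho V) + vlift W.
  (* The vertical component is K V. *)
  move=> V vV; exists (nabla V (etabar (A := A))); first exact: (pnabla hnabla vV pe).
  exact: (vfield_decomposition sA hL hnabla vV).
have TE := hashiguchi_hvtorsion sA hL hnabla.
have TF := hashiguchi_rho_bracket sA hL hnabla.
(* [B] unfolds to [deformation D D' beta], so the three abstract results apply up to conversion. *)
split.
- exact (vcurv_deformed sA aD aD' vb bD sV DE pX pY pZ).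
- exact (hvcurv_deformed sA aD aD' vb bD sV pN bE DE TE pX pY pZ).
- exact (hcurv_deformed sA aD aD' vb bD sV pN bE DE TE TF pX pY pZ).
Qed.
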